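(* Let $\Omega_0,\Omega_1$ be Polish spaces with Borel $\sigma$-algebras $\Sigma_0,\Sigma_1$, let $\mathcal E\subseteq\Omega_0\times\Omega_1$ be closed with all neighborhoods $N_1(x)$ ($x\in\Omega_0$) and $N_0(y)$ ($y\in\Omega_1$) nonempty, and let $\nu_0,\nu_1$ be finite nonzero measures on $\Omega_0,\Omega_1$. Fix $\iota\in\{0,1\}$ and $\bar\iota=1-\iota$, and let $\vartheta:[0,\infty)\to\mathbb R\cup\{+\infty\}$ be proper, lower semicontinuous, and strictly convex on $\operatorname{dom}\vartheta$. Let $(\pi_\iota,\pi_{\bar\iota})\in\Pi_\iota^{\mathcal E}\times\Pi_{\bar\iota}^{\mathcal E}$ satisfy $$\mathsf D_\vartheta(\pi_\iota\|\pi_{\bar\iota})=\inf_{(\rho_\iota,\rho_{\bar\iota})\in\Pi_\iota^{\mathcal E}\times\Pi_{\bar\iota}^{\mathcal E}}\mathsf D_\vartheta(\rho_\iota\|\rho_{\bar\iota})<+\infty.$$ Then: (i) $\pi_\iota$ is level-optimal maximin from side $\iota$ to side $\bar\iota$; (ii) $\pi_{\bar\iota}$ is a proportional response to $\pi_\iota$.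
   Context: Notation. $\mathcal M_+(\Omega)$ is the set of finite nonnegative measures; $T_\#$ is pushforward; $\mathrm{pr}_\iota:\Omega_0\times\Omega_1\to\Omega_\iota$ is the projection. $N_1(x)=\{y\in\Omega_1:(x,y)\in\mathcal E\}$, $N_0(y)=\{x\in\Omega_0:(x,y)\in\mathcal E\}$. Refinements. $\Pi^{\mathcal E}_\iota=\{\pi\in\mathcal M_+(\Omega_0\times\Omega_1):\pi(\mathcal E^c)=0,\ (\mathrm{pr}_\iota)_\#\pi=\nu_\iota\}$. $\vartheta$-divergence. For convex proper $\vartheta:[0,\infty)\to\mathbb R\cup\{+\infty\}$, $\operatorname{dom}\vartheta=\{\vartheta<\infty\}$, $\vartheta'_\infty=\lim_{t\to\infty}\vartheta(t)/t\in\mathbb R\cup\{+\infty\}$. For finite measures $P,Q$ on a measurable space $\Omega$ with Lebesgue decomposition $P=rQ+P_\perp$ ($P_\perp\perp Q$), $\mathsf D_\vartheta(P\|Q)=\int\vartheta(r)\,dQ+\vartheta'_\infty P_\perp(\Omega)$, where the last term is $0$ if $P_\perp=0$, and $\mathsf D_\vartheta(P\|Q)=+\infty$ if $\vartheta'_\infty=+\infty$ and $P_\perp\ne0$. Strict convexity on $\operatorname{dom}\vartheta$ means $\operatorname{dom}\vartheta$ is convex and the convexity inequality is strict for distinct points of $\operatorname{dom}\vartheta$ and weights in $(0,1)$. Level-optimal maximin. For $\pi\in\Pi^{\mathcal E}_\iota$ let $(\mathrm{pr}_{\bar\iota})_\#\pi=r\,\nu_{\bar\iota}+P^\perp$ be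 the Lebesgue decomposition with respect to $\nu_{\bar\iota}$. For $t\ge0$, $\mathsf{Feas}_{\bar\iota}(t)$ is the set of $\sigma\in\mathcal M_+(\Omega_0\times\Omega_1)$ with $\sigma(\mathcal E^c)=0$, $(\mathrm{pr}_\iota)_\#\sigma\le\nu_\iota$, $(\mathrm{pr}_{\bar\iota})_\#\sigma\le t\,\nu_{\bar\iota}$; $\mathsf{Fit}_{\bar\iota}(t)=\sup\{\sigma(\Omega_0\times\Omega_1):\sigma\in\mathsf{Feas}_{\bar\iota}(t)\}$. $\pi$ is level-optimal maximin from side $\iota$ to side $\bar\iota$ if $\int(r\wedge t)\,d\nu_{\bar\iota}=\mathsf{Fit}_{\bar\iota}(t)$ for every $t>0$. Kernel product. For $\eta\in\mathcal M_+(\Omega_{\bar\iota})$ and a kernel $K:\Omega_{\bar\iota}\times\Sigma_\iota\to[0,\infty)$, $\eta\bowtie K$ is the measure on $\Omega_0\times\Omega_1$ assigning $\int_B K(y,A)\,\eta(dy)$ to the set of pairs whose $\iota$-coordinate is in $A$ and whose $\bar\iota$-coordinate is in $B$. Proportional response. Let $\pi\in\Pi^{\mathcal E}_\iota$, $P=(\mathrm{pr}_{\bar\iota})_\#\pi$, and let $K^{(\pi)}$ be a disintegration kernel, $\pi=P\bowtie K^{(\pi)}$ ($P$-a.e. unique). Let $\nu_{\bar\iota}=(\nu_{\bar\iota})_{\mathrm{ac}}+(\nu_{\bar\iota})_\perp$ be the Lebesgue decomposition of $\nu_{\bar\iota}$ with respect to $P$. A proportional response to $\pi$ is any measure of the form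 $(\nu_{\bar\iota})_{\mathrm{ac}}\bowtie K^{(\pi)}+(\nu_{\bar\iota})_\perp\bowtie K^{\mathrm{fb}}$, where $K^{\mathrm{fb}}:\Omega_{\bar\iota}\times\Sigma_\iota\to[0,1]$ is a measurable probability kernel with $K^{\mathrm{fb}}(y,\cdot)$ carried by $N_\iota(y)$ for $(\nu_{\bar\iota})_\perp$-a.e. $y$. *)

(* Defs.v *)
From HB Require Import structures.
From mathcomp Require Import all_boot all_order all_algebra.
From mathcomp Require Import all_classical all_reals all_analysis.

Set Implicit Arguments.
Unset Strict Implicit.
Unset Printing Implicit Defensive.

Import Order.TTheory GRing.Theory Num.Theory.
Import numFieldNormedType.Exports.

Local Open Scope classical_set_scope.
Local Open Scope ring_scope.
Local Open Scope ereal_scope.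

Notation borel T := (g_sigma_algebraType (@open T)).

Definition polish (R : realType) (T : topologicalType) : Prop :=
  (exists2 D : set T, countable D & dense D) /\
  exists (M : metricType R) (f : T -> M),
    [/\ bijective f,
        forall U : set M, open U <-> open (f @^-1` U) &
        forall F : set_system M, ProperFilter F -> cauchy F ->
          exists x : M, F --> x].

Section lebesgue_decomposition.
Context (R : realType) (d : measure_display) (T : measurableType d).
Implicit Types P Q Pac Pperp : {finite_measure set T -> \bar R}.

Definition mutually_singular P Q : Prop :=
  exists2 S : set T, measurable S & P S = 0 /\ Q (~` S) = 0.

Definition lebesgue_decomposition P Q Pac Pperp : Prop :=
  [/\ forall A, measurable A -> P A = Pac A + Pperp A,
      Pac `<< Q &
      mutually_singular Pperp Q].

(* P = r Q + Pperp *)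
Definition lebesgue_density P Q (r : T -> R) Pperp : Prop :=
  [/\ measurable_fun setT r,
      forall x, (0 <= r x)%R,
      forall A, measurable A -> P A = \int[Q]_(x in A) (r x)%:E + Pperp A &
      mutually_singular Pperp Q].

End lebesgue_decomposition.

(* A function [0, +oo[ -> R u {+oo} is encoded as theta : R -> \bar R; only its
   values on [0, +oo[ are ever constrained or used. *)
Section entropy_function.
Context (R : realType) (theta : R -> \bar R).

Definition edom : set R := [set t | (0 <= t)%R /\ theta t < +oo].

Definition eproper : Prop :=
  edom !=set0 /\ forall t, (0 <= t)%R -> -oo < theta t.

Definition strictly_convex_on_dom : Prop :=
  (forall s t l : R, edom s -> edom t -> (0 <= l <= 1)%R ->
     edom (l * s + (1 - l) * t)%R) /\
  (forall s t l : R, edom s -> edom t -> s != t -> (0 < l < 1)%R ->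
     theta (l * s + (1 - l) * t)%R <
       l%:E * theta s + (1 - l)%R%:E * theta t).

Definition lsc_nonneg : Prop :=
  lower_semicontinuous (theta : subspace `[0%R, +oo[%classic -> \bar R).

Definition recession : \bar R := lim (theta t * (t^-1)%R%:E @[t --> +oo%R]).

(* The set below is a singleton for proper convex theta: the Lebesgue
   decomposition exists and r is unique Q-a.e.  Since +oo * 0 = 0 in \bar R, the
   second summand is 0 when Pperp = 0, and +oo when recession = +oo and
   Pperp != 0. *)
Definition divergence (d : measure_display) (T : measurableType d)
    (P Q : {finite_measure set T -> \bar R}) : \bar R :=
  get [set v | exists r Pperp, lebesgue_density P Q r Pperp /\
    v = \int[Q]_x theta (r x) + recession * Pperp setT].

End entropy_function.

(* The two sides are indexed by bool (false for 0, true for 1), so that ~~ i is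
   the side opposite to i.  Measurable types are pointed in the library, whence
   ptopologicalType: it only excludes empty spaces. *)
Section two_sides.
Context (R : realType) (Omega : bool -> ptopologicalType).
Context (E : set (Omega false * Omega true)).
Context (nu : forall i, {finite_measure set (borel (Omega i)) -> \bar R}).

Local Notation pairs := (borel (Omega false) * borel (Omega true))%type.
Local Notation plan := {finite_measure set pairs -> \bar R}.

Definition pr (i : bool) : pairs -> borel (Omega i) :=
  if i return pairs -> borel (Omega i) then snd else fst.

Lemma measurable_pr (i : bool) : measurable_fun setT (pr i).
Proof. by case: i; [exact: measurable_snd | exact: measurable_fst]. Qed.

Definition pair_of (i : bool) :
    Omega i -> Omega (~~ i) -> Omega false * Omega true :=
  if i return Omega i -> Omega (~~ i) -> Omega false * Omega true
  then fun y x => (x, y) else fun x y => (x, y).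

Definition neighborhood (i : bool) (y : Omega (~~ i)) : set (Omega i) :=
  [set x | E (pair_of x y)].

Definition marginal (i : bool) (p : plan) : set (borel (Omega i)) -> \bar R :=
  pushforward p (pr i).
Arguments marginal : clear implicits.

Section marginal_measure.
Context (i : bool) (p : plan).

Let measurable_pr_preimage (A : set (borel (Omega i))) :
  measurable A -> measurable (pr i @^-1` A).
Proof.
by move=> mA; rewrite -[X in measurable X]setTI; exact: measurable_pr.
Qed.

Let marginal0 : marginal i p set0 = 0.
Proof. by rewrite /marginal /pushforward preimage_set0 measure0. Qed.

Let marginal_ge0 A : 0 <= marginal i p A.
Proof. by rewrite /marginal /pushforward; exact: measure_ge0. Qed.

Let marginal_sigma_additive : semi_sigma_additive (marginal i p).
Proof.
move=> F mF tF mUF; rewrite /marginal /pushforward preimage_bigcup.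
apply: measure_semi_sigma_additive.
- by move=> n; exact: measurable_pr_preimage.
- apply/trivIsetP => /= j k _ _ jk; rewrite -preimage_setI.
  by move/trivIsetP : tF => /(_ _ _ _ _ jk) ->//; rewrite preimage_set0.
- by rewrite -preimage_bigcup; exact: measurable_pr_preimage.
Qed.

HB.instance Definition _ := isMeasure.Build _ _ _ (marginal i p)
  marginal0 marginal_ge0 marginal_sigma_additive.

Let marginal_fin : fin_num_fun (marginal i p).
Proof.
by move=> A mA; apply: fin_num_measure; exact: measurable_pr_preimage.
Qed.

HB.instance Definition _ := Measure_isFinite.Build _ _ _ (marginal i p)
  marginal_fin.

End marginal_measure.

Definition refinements (i : bool) : set plan :=
  [set p : plan | p (~` E) = 0 /\
           forall A, measurable A -> marginal i p A = nu i A].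

Definition feas (i : bool) (t : R) : set plan :=
  [set s : plan | [/\ s (~` E) = 0,
     forall A, measurable A -> marginal i s A <= nu i A &
     forall B, measurable B -> marginal (~~ i) s B <= t%:E * nu (~~ i) B]].

Definition fit (i : bool) (t : R) : \bar R :=
  ereal_sup [set (s : plan) setT | s in feas i t].

(* From side i to side ~~ i; r is unique (nu (~~ i))-a.e. *)
Definition level_optimal_maximin (i : bool) (p : plan) : Prop :=
  exists r Pperp, lebesgue_density (marginal (~~ i) p) (nu (~~ i)) r Pperp /\
    forall t : R, (0 < t)%R ->
      \int[nu (~~ i)]_y (Num.min (r y) t)%:E = fit i t.

(* mu is the kernel product of eta and K: the sets of pairs below form a
   pi-system generating the product sigma-algebra. *)
Definition is_kernel_product (i : bool)
    (eta : {finite_measure set (borel (Omega (~~ i))) -> \bar R})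
    (K : R.-pker (borel (Omega (~~ i))) ~> (borel (Omega i)))
    (mu : plan) : Prop :=
  forall A B, measurable A -> measurable B ->
    mu (pr i @^-1` A `&` pr (~~ i) @^-1` B) = \int[eta]_(y in B) K y A.

(* K is the disintegration kernel of p over its marginal on side ~~ i; it is
   unique up to a null set of that marginal, hence up to a nuac-null set. *)
Definition proportional_response (i : bool) (p q : plan) : Prop :=
  exists (nuac nuperp : {finite_measure set (borel (Omega (~~ i))) -> \bar R})
         (K Kfb : R.-pker (borel (Omega (~~ i))) ~> (borel (Omega i)))
         (mu1 mu2 : plan),
  [/\ lebesgue_decomposition (nu (~~ i)) (marginal (~~ i) p) nuac nuperp,
      is_kernel_product (marginal (~~ i) p) K p,
      {ae nuperp, forall y, Kfb y (~` @neighborhood i y) = 0},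
      is_kernel_product nuac K mu1 /\ is_kernel_product nuperp Kfb mu2 &
      forall C, measurable C -> q C = mu1 C + mu2 C].

End two_sides.
Arguments marginal {R Omega}.

(* Main.v *)
(* Write X for side iota, Y for the opposite side, r for the density with
   respect to nu_Y of the Y-marginal P of p, and phi for theta plus an affine
   function making it nonnegative; on refinements this shifts the divergence by
   a constant.

   A plan q with Y-marginal nu_Y is a randomization y |-> (G(y,u), y) with u
   uniform, so Jensen's inequality on the fibres gives D(P | nu_Y) <= D(p | q),
   with equality only if dp/dq = r(y) q-almost everywhere.  Conversely, for every
   p' there is a response q' whose density dp'/dq' depends on y only, and then
   D(p' | q') = D(P' | nu_Y).  Hence at a minimizing pair P minimizes
   D(. | nu_Y) among Y-marginals, and dp/dq = r(y).

   The second fact makes q proportional to p over each y with r(y) > 0, which is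
   (ii).  For (i), let sigma be feasible at level t.  If some points of X were
   charged both by p over {r >= t} and by sigma over {r < t}, then rerouting
   a small fraction of that mass from p to sigma would move r towards a level
   below t, from both sides, and strict convexity would lower D(. | nu_Y).
   So the points of X that sigma uses over {r < t} are sent by p into {r < t}
   only, which bounds the mass of sigma by the integral of min(r, t). *)

Require Import Defs.
From HB Require Import structures.
From mathcomp Require Import all_boot all_order all_algebra.
From mathcomp Require Import all_classical all_reals all_analysis.
From mathcomp Require Import measurable_realfun lra ring.

Set Implicit Arguments.
Unset Strict Implicit.
Unset Printing Implicit Defensive.

Import Order.TTheory GRing.Theory Num.Theory.
Import numFieldNormedType.Exports.

Local Open Scope classical_set_scope.
Local Open Scope ring_scope.
Local Open Scope ereal_scope.

(** * Densities and Lebesgue decompositions *)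

(** The plan p may be partly singular to q even where P has a density in nu_Y. Jensen's inequality
    is therefore proved with an escaping mass: the fibre mean of dp/dq falls short of r(y) by some
    s(y), which is charged at the recession constant. That constant enters as the supremum of the
    slopes of affine minorants, so every subgradient of phi is bounded by it, and a single
    subgradient controls densities and singular mass together.

    The same device replaces derivatives in the exchange. For t' < t a subgradient g is taken at the
    midpoint of t' and t, and a fixed fraction eps keeps the low densities below the midpoint and
    the high ones above it. Each value of phi then changes by at most g times the change of density,
    strictly less where the density changes. Mass is conserved, so the linear terms add up to g
    times the singular mass lost, and the recession term falls by at least as much. The gap t' < t
    makes eps uniform in y; it is removed at the end by letting t' increase to t. *)

Lemma addeIl (R : realType) (x a b : \bar R) : x \is a fin_num ->
  x + a = x + b -> a = b.
Proof.
move=> xfin xab; apply/eqP.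
by rewrite eq_le -(leeD2lE a b xfin) -(leeD2lE b a xfin) xab lexx.
Qed.

Lemma measurable_fun_inv (R : realType) d (T : measurableType d) (f : T -> R) :
  (forall x, (0 <= f x)%R) -> measurable_fun setT f ->
  measurable_fun setT (fun x => ((f x)^-1)%R).
Proof.
move=> f0 mf; rewrite (_ : (fun x => _) = (@powR R ^~ (-1)%R) \o f).
  by apply: measurableT_comp mf; exact: measurable_powR.
by apply/funext => x /=; rewrite powR_inv1.
Qed.

Section densities.
Context (R : realType) (d : measure_display) (T : measurableType d).
Implicit Types (M N P Q : {finite_measure set T -> \bar R}) (f g : T -> R).

(** On the set where [g < f] the two integrals agree over every measurable part, and finiteness
    turns this into almost everywhere equality there. *)
Lemma ae_le_of_integral M (f g : T -> \bar R) :
  measurable_fun setT f -> measurable_fun setT g ->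
  (forall x, 0 <= f x) -> (forall x, 0 <= g x) ->
  (forall A, measurable A -> \int[M]_(x in A) f x <= \int[M]_(x in A) g x) ->
  \int[M]_x g x < +oo ->
  {ae M, forall x, f x <= g x}.
Proof.
move=> mf mg f0 g0 fg goo.
pose A := [set x | g x < f x].
have mA : measurable A.
  by rewrite -[A]setTI; exact: measurable_lte.
have le_int h B : measurable B -> measurable_fun setT h ->
    (forall x, 0 <= h x) -> \int[M]_(x in B) h x <= \int[M]_x h x.
  by move=> mB mh h0; apply: ge0_subset_integral.
have fA : M.-integrable A f.
  apply/integrableP; split; first exact: measurable_funTS.
  under eq_integral do rewrite gee0_abs//.
  by apply: (le_lt_trans (fg _ mA)); apply: le_lt_trans goo; exact: le_int.
have : ae_eq M A f g.
  apply: integral_ae_eq => //; first exact: measurable_funTS.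
  move=> B BA mB; apply/eqP; rewrite eq_le fg//=.
  apply: ge0_le_integral => //; try exact: measurable_funTS.
  by move=> x /BA /ltW.
apply: filterS => x; rewrite leNgt => fgx; apply/negP => gf.
by move: (gf); rewrite fgx// ltxx.
Qed.

Definition has_density M N f : Prop :=
  [/\ measurable_fun setT f, forall x, (0 <= f x)%R &
      forall A, measurable A -> M A = \int[N]_(x in A) (f x)%:E].

(** Packs a set function as a finite measure inside a proof; all measures constructed below come
    from here. *)
Lemma finite_measure_of (m : set T -> \bar R) :
  m set0 = 0 -> (forall A, 0 <= m A) -> semi_sigma_additive m ->
  m setT < +oo -> exists M, forall A, M A = m A.
Proof.
move=> m0 mge0 madd moo.
have fm : fin_num_fun m.
  pose mM := isMeasure.Build _ _ _ m m0 mge0 madd.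
  pose M : {measure set T -> \bar R} := HB.pack m mM.
  move=> A mA; rewrite ge0_fin_numE//; apply: le_lt_trans moo.
  by apply: (@le_measure _ _ _ M); rewrite ?inE.
pose mM := isMeasure.Build _ _ _ m m0 mge0 madd.
pose M : {measure set T -> \bar R} := HB.pack m mM.
pose fM := Measure_isFinite.Build _ _ _ M fm.
pose M' : {finite_measure set T -> \bar R} := HB.pack m mM fM.
by exists M'.
Qed.

Lemma density_measure N f : measurable_fun setT f ->
  (forall x, (0 <= f x)%R) -> \int[N]_x (f x)%:E < +oo ->
  exists M, has_density M N f.
Proof.
move=> mf f0 foo.
have [M ME] : exists M, forall A, M A = \int[N]_(x in A) (f x)%:E.
  apply: finite_measure_of => //.
  - by rewrite integral_set0.
  - by move=> A; apply: integral_ge0 => x _; rewrite lee_fin.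
  - apply: semi_sigma_additive_nng_induced; first exact/measurable_EFinP.
    by move=> x; rewrite lee_fin.
by exists M; split => // A mA; exact: ME.
Qed.

Lemma finite_measure_add M N : exists P, forall A, P A = M A + N A.
Proof.
have [||||P PE] := @finite_measure_of (measure_add M N).
- exact: measure0.
- by [].
- exact: measure_semi_sigma_additive.
- by rewrite measure_addE; apply: lte_add_pinfty; rewrite -ge0_fin_numE// fin_num_measure.
by exists P => A; rewrite PE measure_addE.
Qed.

Lemma finite_measure_restr M (S : set T) : measurable S ->
  exists N, forall A, N A = M (A `&` S).
Proof.
move=> mS; apply: (@finite_measure_of (mrestr M mS)).
- exact: measure0.
- by move=> A; exact: measure_ge0.
- exact: measure_semi_sigma_additive.
- by rewrite /mrestr -ge0_fin_numE// fin_num_measure//; exact: measurableI.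
Qed.

Lemma has_density_dominates M N f : has_density M N f -> M `<< N.
Proof.
move=> [mf f0 ME]; apply/null_content_dominatesP => A mA NA.
rewrite ME//; apply: null_set_integral => //.
by apply/measurable_funTS/measurable_EFinP.
Qed.

(** Reduces to the change of variables for the Radon-Nikodym derivative, with which [f] agrees
    [N]-almost everywhere. *)
Lemma integral_density M N f (g : T -> \bar R) E :
  has_density M N f -> measurable E -> measurable_fun setT g ->
  (forall x, 0 <= g x) ->
  \int[M]_(x in E) g x = \int[N]_(x in E) (g x * (f x)%:E).
Proof.
move=> MN mE mg g0; have MdN := has_density_dominates MN.
have [mf f0 ME] := MN.
rewrite -(Radon_Nikodym_SigmaFinite.change_of_variables MdN g0 mE); last first.
  exact: measurable_funTS.
have mRN : measurable_fun setT (Radon_Nikodym_SigmaFinite.f M N).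
  by apply: (measurable_int N); exact: Radon_Nikodym_SigmaFinite.f_integrable.
have : ae_eq N E (Radon_Nikodym_SigmaFinite.f M N) (EFin \o f).
  apply: integral_ae_eq => //.
  - by apply: (integrableS measurableT) => //;
      exact: Radon_Nikodym_SigmaFinite.f_integrable.
  - exact/measurable_funTS/measurable_EFinP.
  - move=> A AE mA; rewrite -ME//.
    by rewrite -Radon_Nikodym_SigmaFinite.f_integral.
move=> RNf; apply: ge0_ae_eq_integral => //.
- by apply/measurable_funTS/emeasurable_funM.
- by apply/measurable_funTS/emeasurable_funM => //; exact/measurable_EFinP.
- move=> x _; apply: mule_ge0 => //.
  exact: Radon_Nikodym_SigmaFinite.f_ge0.
- by move=> x _; apply: mule_ge0 => //; rewrite lee_fin.
- by apply: filterS RNf => x + Ex => /(_ Ex) ->.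
Qed.

(** The derivative is at most 1 almost everywhere; truncating it at 1 makes the bound hold at every
    point, which later pointwise estimates rely on. *)
Lemma dominated_density M N : (forall A, measurable A -> M A <= N A) ->
  exists2 f, has_density M N f & forall x, (f x <= 1)%R.
Proof.
move=> MN.
have MdN : M `<< N.
  apply/null_content_dominatesP => A mA NA.
  by apply/eqP; rewrite eq_le measure_ge0 andbT -NA MN.
have [g [g0 gi gE]] := radon_nikodym_finite MdN.
have mg : measurable_fun setT g by exact: measurable_int gi.
have g1 : {ae N, forall x, g x <= 1}.
  apply: ae_le_of_integral => //.
  - by move=> A mA; rewrite -gE// integral_cst// mul1e MN.
  - by rewrite integral_cst// mul1e -ge0_fin_numE// fin_num_measure.
pose f x := fine (mine (g x) 1).
have fE x : (f x)%:E = mine (g x) 1.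
  rewrite /f fineK// ge0_fin_numE; last by rewrite le_min g0 lee01.
  by rewrite gt_min ltry orbT.
have mf : measurable_fun setT f.
  apply/measurable_EFinP; rewrite (_ : EFin \o f = fun x => mine (g x) 1).
    exact: measurable_mine.
  exact/funext.
exists f.
  split=> //.
  - by move=> x; rewrite -lee_fin fE le_min g0 lee01.
  - move=> A mA; rewrite gE//; apply: ge0_ae_eq_integral => //.
    + exact: measurable_funTS.
    + exact/measurable_funTS/measurable_EFinP.
    + by move=> x _; rewrite fE le_min g0 lee01.
    + apply: filterS g1 => x gx _; rewrite fE; apply/esym/min_idPl; exact: gx.
by move=> x; rewrite -lee_fin fE ge_min lexx orbT.
Qed.

(** Von Neumann's argument: if [h] is the density of [P] in [P + Q], then [Q] has density [1 - h],
    so [Q] does not charge [S], where [h = 1], and off [S] the density of [P] in [Q] is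
    [h / (1 - h)]. *)
Lemma lebesgue_density_exists P Q : exists r Pperp, Defs.lebesgue_density P Q r Pperp.
Proof.
have [M ME] := finite_measure_add P Q.
have [h Ph h1] : exists2 h, has_density P M h & forall x, (h x <= 1)%R.
  by apply: dominated_density => A mA; rewrite ME leeDl.
have [mh h0 PE] := Ph.
pose S := [set x | (1 <= h x)%R].
have mS : measurable S.
  by rewrite -[S]setTI; exact: (measurable_fun_ler (measurable_cst _) mh).
have mh' : measurable_fun setT (fun x => (1 - h x)%R).
  by apply: measurable_funB => //; exact: measurable_cst.
have h'0 x : (0 <= 1 - h x)%R by rewrite subr_ge0.
have Qh : has_density Q M (fun x => (1 - h x)%R).
  split => // A mA.
  have : M A = P A + \int[M]_(x in A) (1 - h x)%:E.
    rewrite PE// -ge0_integralD//.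
    - under eq_integral do rewrite -EFinD addrC subrK.
      by rewrite integral_cst// mul1e.
    - by move=> x _; rewrite lee_fin.
    - exact/measurable_funTS/measurable_EFinP.
    - by move=> x _; rewrite lee_fin.
    - exact/measurable_funTS/measurable_EFinP.
  by rewrite ME => /addeIl; apply; exact: fin_num_measure.
have QS : Q S = 0.
  case: Qh => _ _ ->//; apply: integral0_eq => x Sx.
  by congr EFin; apply/eqP; rewrite subr_eq0 eq_le h1 andbT.
(* On [S] the denominator is 0, and division by 0 gives [r x = 0] there. *)
pose r x := (h x / (1 - h x))%R.
have mr : measurable_fun setT r.
  by apply: measurable_funM => //; exact: measurable_fun_inv.
have r0 x : (0 <= r x)%R by rewrite divr_ge0.
have rE A : measurable A -> \int[Q]_(x in A) (r x)%:E = P (A `\` S).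
  move=> mA; have mrA : measurable_fun A (EFin \o r).
    exact/measurable_funTS/measurable_EFinP.
  rewrite (ge0_negligible_integral mS) => //; last 1 first.
    by move=> x _; rewrite lee_fin.
  have mAS : measurable (A `\` S) by exact: measurableD.
  have mer : measurable_fun setT (EFin \o r) by exact/measurable_EFinP.
  have er0 x : 0 <= (EFin \o r) x by rewrite lee_fin.
  rewrite (integral_density Qh mAS mer er0) PE//.
  apply: eq_integral => x; rewrite inE => -[Ax /negP]; rewrite -ltNge => hx.
  by rewrite -EFinM divfK// subr_eq0 gt_eqF.
have [Pp PpE] := finite_measure_restr P mS.
exists r, Pp; split => //.
  move=> A mA; rewrite rE// PpE.
  by rewrite -measureU ?setUIDK//; [rewrite setUC setUIDK|exact: measurableD|
    exact: measurableI|rewrite setDE setIACA setICl setI0].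
exists (~` S); first exact: measurableC.
by rewrite PpE setICl measure0 setCK.
Qed.

End densities.

Section density_off_null_set.
Context (R : realType) (d : measure_display) (T : measurableType d).
Implicit Types (M P Q : {finite_measure set T -> \bar R}) (r : T -> R).

Lemma integral_setD_null Q (f : T -> \bar R) A S :
  measurable A -> measurable S -> measurable_fun setT f ->
  (forall x, 0 <= f x) -> Q S = 0 ->
  \int[Q]_(x in A `\` S) f x = \int[Q]_(x in A) f x.
Proof.
move=> mA mS mf f0 QS; apply/esym/ge0_negligible_integral => //.
exact: measurable_funTS.
Qed.

(* P = r Q off S, where Q S = 0: a Lebesgue decomposition whose singular part
   is the restriction of P to S. *)
Definition density_off P Q r (S : set T) : Prop :=
  [/\ measurable_fun setT r, forall x, (0 <= r x)%R, measurable S, Q S = 0 &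
      forall A, measurable A -> P (A `\` S) = \int[Q]_(x in A) (r x)%:E].

Lemma lebesgue_density_off P Q r M : Defs.lebesgue_density P Q r M ->
  exists2 S, density_off P Q r S &
             forall A, measurable A -> M A = P (A `&` S).
Proof.
move=> [mr r0 PE [S' mS' [MS' QS']]].
pose S := ~` S'; have mS : measurable S by exact: measurableC.
have mer : measurable_fun setT (EFin \o r) by exact/measurable_EFinP.
have er0 x : 0 <= (EFin \o r) x by rewrite lee_fin.
have MD A : measurable A -> M (A `\` S) = 0.
  move=> mA; apply: (@subset_measure0 _ _ _ M _ S') => //.
    exact: measurableD.
  by move=> x [_]; rewrite /S/= notK.
have intS A : measurable A -> A `<=` S -> \int[Q]_(x in A) (r x)%:E = 0.
  move=> mA AS; apply: null_set_integral => //.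
    exact: measurable_funTS.
  exact: (@subset_measure0 _ _ _ Q _ S).
exists S.
  split => // A mA; have mAS : measurable (A `\` S) by exact: measurableD.
  rewrite PE// MD// adde0.
  exact: integral_setD_null.
move=> A mA; have mAS : measurable (A `&` S) by exact: measurableI.
rewrite PE// intS ?add0e//.
rewrite -[in LHS](setUIDK A S) measureU//.
- by rewrite [X in _ + X]MD// adde0.
- exact: measurableD.
- by rewrite setDE setIACA setICr setI0.
Qed.

Lemma density_off_lebesgue P Q r S : density_off P Q r S ->
  exists2 M, Defs.lebesgue_density P Q r M & forall A, M A = P (A `&` S).
Proof.
move=> [mr r0 mS QS PE].
have [M ME] := finite_measure_restr P mS.
exists M => //; split => //.
  move=> A mA; rewrite -PE// ME -measureU.
  - by rewrite setUC setUIDK.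
  - exact: measurableD.
  - exact: measurableI.
  - by rewrite setDE setIACA setICl setI0.
by exists (~` S); [exact: measurableC|rewrite ME setICl measure0 setCK].
Qed.

Lemma density_off_exists P Q : exists r S, density_off P Q r S.
Proof.
have [r [M /lebesgue_density_off[S PQ _]]] := lebesgue_density_exists P Q.
by exists r, S.
Qed.

Lemma density_off_integrable P Q r S : density_off P Q r S ->
  Q.-integrable setT (EFin \o r).
Proof.
move=> [mr r0 mS QS PE]; apply/integrableP; split; first exact/measurable_EFinP.
rewrite (eq_integral (EFin \o r)) => [|x _]; last first.
  by rewrite /= ger0_norm.
rewrite -PE// -ge0_fin_numE// fin_num_measure//; exact: measurableD.
Qed.

Lemma integral_density_off P Q r S (g : T -> \bar R) E :
  density_off P Q r S -> measurable E -> measurable_fun setT g ->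
  (forall x, 0 <= g x) ->
  \int[P]_(x in E `\` S) g x = \int[Q]_(x in E) (g x * (r x)%:E).
Proof.
move=> [mr r0 mS QS PE] mE mg g0.
have [P' P'E] := finite_measure_restr P (measurableC mS).
have P'Q : has_density P' Q r by split => // A mA; rewrite P'E -setDE PE.
have mES : measurable (E `\` S) by exact: measurableD.
have mgr : measurable_fun setT (fun x => g x * (r x)%:E).
  by apply: emeasurable_funM => //; exact/measurable_EFinP.
have gr0 x : 0 <= g x * (r x)%:E by rewrite mule_ge0// lee_fin.
have PP' A : measurable A -> A `<=` E `\` S -> P A = P' A.
  by move=> mA AS; rewrite P'E setIidl// => x /AS[].
rewrite (eq_measure_integral P' PP').
by rewrite (integral_density P'Q)// integral_setD_null.
Qed.

(** Makes the choice by [get] in [divergence] harmless. As [S] and [S'] are [Q]-null, both integrals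
    over [A] equal the [P]-mass of [A] off [S] and [S']; the masses of [S] and [S'] are what remains
    of the total mass. *)
Lemma density_off_unique P Q r r' S S' :
  density_off P Q r S -> density_off P Q r' S' ->
  {ae Q, forall x, r x = r' x} /\ P S = P S'.
Proof.
move=> PQ PQ'.
have [mr r0 mS QS PE] := PQ; have [mr' r'0 mS' QS' PE'] := PQ'.
have off r0' S0 S1 A : density_off P Q r0' S0 -> measurable S1 -> Q S1 = 0 ->
    measurable A ->
    \int[Q]_(x in A) (r0' x)%:E = P ((A `\` S1) `\` S0).
  move=> [mr0 r00 mS0 QS0 PE0] mS1 QS1 mA.
  rewrite PE0; last exact: measurableD.
  have mer0 : measurable_fun setT (EFin \o r0') by exact/measurable_EFinP.
  have er0 x : 0 <= (EFin \o r0') x by rewrite lee_fin.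
  by rewrite -(integral_setD_null mA mS1 mer0 er0 QS1).
have eqint A : measurable A ->
    \int[Q]_(x in A) (r x)%:E = \int[Q]_(x in A) (r' x)%:E.
  move=> mA; rewrite (off _ _ S' _ PQ)// (off _ _ S _ PQ')//.
  by rewrite !setDE setIAC.
split.
  have : ae_eq Q setT (EFin \o r) (EFin \o r').
    apply: integral_ae_eq => //; first exact: density_off_integrable PQ.
      exact/measurable_EFinP.
    by move=> A _ mA; exact: eqint.
  by apply: filterS => x /(_ I) [].
have PS0 r0' S0 : density_off P Q r0' S0 ->
    P setT = P S0 + \int[Q]_x (r0' x)%:E.
  move=> [_ _ mS0 _ <-//]; rewrite -measureU//.
  - by rewrite setTD setUv.
  - exact: measurableD.
  - by rewrite setTD setICr.
have := PS0 _ _ PQ; rewrite (PS0 _ _ PQ') eqint// => /esym.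
rewrite ![_ + \int[_]_x _]addeC => /addeIl; apply.
by rewrite -PE'// fin_num_measure//; exact: measurableD.
Qed.

Lemma divergence_density_off (theta : R -> \bar R) P Q r S :
  (forall r' : T -> R, measurable_fun setT r' -> (forall x, 0 <= r' x)%R ->
    measurable_fun setT (theta \o r')) ->
  density_off P Q r S ->
  divergence theta P Q = \int[Q]_x theta (r x) + recession theta * P S.
Proof.
move=> mtheta PQ; rewrite /divergence.
set V := [set v | _].
have [M PQM ME] := density_off_lebesgue PQ.
have V0 : V !=set0.
  by exists (\int[Q]_x theta (r x) + recession theta * M setT); exists r, M.
have /(@getPex _ V)[r' [M' [PQM' ->]]] : exists v, V v by case: V0 => v; exists v.
have [S' PQ' M'E] := lebesgue_density_off PQM'.
have [rr' SS'] := density_off_unique PQ PQ'.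
have [mr r0 _ _ _] := PQ; have [mr' r'0 _ _ _] := PQ'.
rewrite M'E// setTI SS'; congr (_ + _); apply: ae_eq_integral => //.
- exact: mtheta.
- exact: mtheta.
- by apply: filterS rr' => x + _ => ->.
Qed.

End density_off_null_set.

(** Lets a density vanish at every point off [H], not only almost everywhere, so that the exchange
    can argue by cases point by point. *)
Lemma has_density_indic (R : realType) (d : measure_display) (T : measurableType d)
    (M N : {finite_measure set T -> \bar R}) (f : T -> R) (H : set T) :
  has_density M N f -> measurable H -> M (~` H) = 0 ->
  has_density M N (fun x => f x * \1_H x)%R.
Proof.
move=> [mf f0 ME] mH MH; split.
- by apply: measurable_funM => //; apply: measurable_indic.
- by move=> x; rewrite mulr_ge0.
move=> A mA.
have mAH : measurable (A `&` H) by exact: measurableI.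
have -> : M A = M (A `&` H) + M (A `\` H).
  rewrite -measureU; [by rewrite setUIDK|by []|exact: measurableD|].
  by rewrite setDE setIACA setICr setI0.
have -> : M (A `\` H) = 0.
  have mHc : measurable (~` H) by exact: measurableC.
  have mAH' : measurable (A `\` H) by exact: measurableD.
  apply/eqP; rewrite eq_le measure_ge0 andbT -[leRHS]MH.
  by apply: le_measure; rewrite ?inE// => x [].
rewrite adde0 ME// integral_mkcondr; apply: eq_integral => x _.
rewrite patchE indicE; case: (x \in H); first by rewrite mulr1.
by rewrite mulr0.
Qed.

Lemma integral_scale (R : realType) (d : measure_display) (T : measurableType d)
    (Q : {finite_measure set T -> \bar R}) (w : T -> R) (eps : R) (D : set T) :
  measurable_fun setT w -> (forall x, 0 <= w x)%R -> (0 <= eps)%R -> measurable D ->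
  \int[Q]_(x in D) (eps * w x)%:E = eps%:E * \int[Q]_(x in D) (w x)%:E.
Proof.
move=> mw w0 e0 mD; rewrite -ge0_integralZl//.
- exact/measurable_funTS/measurable_EFinP.
- by move=> x _; rewrite lee_fin.
Qed.

(** Stated as a sum, so that no difference of extended reals occurs. *)
Lemma integral_onem_scale (R : realType) (d : measure_display) (T : measurableType d)
    (Q : {finite_measure set T -> \bar R}) (w : T -> R) (eps : R) (D : set T) :
  measurable_fun setT w -> (forall x, 0 <= w x)%R -> (0 <= eps)%R ->
  (forall x, eps * w x <= 1)%R -> measurable D ->
  \int[Q]_(x in D) (1 - eps * w x)%:E + eps%:E * \int[Q]_(x in D) (w x)%:E = Q D.
Proof.
move=> mw w0 e0 w1 mD; rewrite -integral_scale// -ge0_integralD//.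
- rewrite (eq_integral (cst 1)) ?integral_cst ?mul1e// => x _.
  by rewrite -EFinD subrK.
- by move=> x _; rewrite lee_fin subr_ge0.
- by apply/measurable_funTS/measurable_EFinP/measurable_funB => //; exact: measurable_funM.
- by move=> x _; rewrite lee_fin mulr_ge0.
- by apply/measurable_funTS/measurable_EFinP; exact: measurable_funM.
Qed.

(** * Strictly convex entropies *)

Section strict_convexity.
Local Open Scope ring_scope.
Context (R : realType) (D : set R) (f : R -> R).
Hypothesis convD : forall s t l : R, D s -> D t -> 0 <= l <= 1 ->
  D (l * s + (1 - l) * t).
Hypothesis convf : forall s t l : R, D s -> D t -> s != t -> 0 < l < 1 ->
  f (l * s + (1 - l) * t) < l * f s + (1 - l) * f t.

Lemma conv_coord (a m b : R) : a <= m <= b -> a < b ->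
  exists2 l, 0 <= l <= 1 & m = l * a + (1 - l) * b /\ l = (b - m) / (b - a).
Proof.
move=> /andP[am mb] ab; have ba : 0 < b - a by rewrite subr_gt0.
exists ((b - m) / (b - a)).
  rewrite divr_ge0 ?subr_ge0//=; last exact: ltW.
  by rewrite ler_pdivrMr// mul1r lerD2l lerN2.
by split => //; field; rewrite gt_eqF.
Qed.

Lemma dom_between a m b : D a -> D b -> a <= m <= b -> D m.
Proof.
move=> Da Db amb; have [ab|ba] := ltP a b.
  by have [l l01 [-> _]] := conv_coord amb ab; exact: convD.
by have -> : m = a by apply/eqP; rewrite eq_le; lra.
Qed.

Lemma three_points a m b : D a -> D b -> a < m < b ->
  (f m - f a) * (b - m) < (f b - f m) * (m - a).
Proof.
move=> Da Db /andP[am mb]; have ab : a < b := lt_trans am mb.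
have [|l l01 [mE lE]] := @conv_coord a m b _ ab; first by rewrite !ltW.
have ba : 0 < b - a by rewrite subr_gt0.
have l0 : 0 < l by rewrite lE divr_gt0// subr_gt0.
have l1 : l < 1 by rewrite lE ltr_pdivrMr// mul1r ltrD2l ltrN2.
have := convf Da Db (negbT (lt_eqF ab)) (introT andP (conj l0 l1)).
rewrite -mE => fm.
have e1 : b - m = l * (b - a) by rewrite lE divfK// gt_eqF.
have e2 : m - a = (1 - l) * (b - a) by rewrite lE; field; rewrite gt_eqF.
rewrite e1 e2 !mulrA ltr_pM2r//; nra.
Qed.

(** The supremum of the slopes on the left of [m] lies below every slope on the right, which gives a
    supporting line. If [f] met the line again at [z], strict convexity would put [f] below it
    halfway between [z] and [m]. *)
Lemma strict_subgradient m : D m -> (exists2 a, D a & a < m) ->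
  (exists2 b, D b & m < b) ->
  exists g, forall z, D z -> z != m -> f m + g * (z - m) < f z.
Proof.
move=> Dm [a Da am] [b Db mb].
pose slopes := [set s | exists2 c, D c /\ c < m & s = (f m - f c) / (m - c)].
have slopes_le z : D z -> m < z -> ubound slopes ((f z - f m) / (z - m)).
  move=> Dz mz _ [c [Dc cm] ->].
  have := three_points Dc Dz (introT andP (conj cm mz)).
  rewrite ler_pdivrMr ?subr_gt0// mulrAC ler_pdivlMr ?subr_gt0//.
  exact: ltW.
have slopes_sup : has_sup slopes.
  split; first by exists ((f m - f a) / (m - a)), a.
  by exists ((f b - f m) / (b - m)); exact: slopes_le.
pose g := sup slopes.
have weak z : D z -> f m + g * (z - m) <= f z.
  move=> Dz; have [zm|mz|->] := ltgtP z m; last by rewrite subrr mulr0 addr0.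
    have : (f m - f z) / (m - z) <= g.
      by apply: ub_le_sup; [case: slopes_sup|exists z].
    rewrite ler_pdivrMr ?subr_gt0//; lra.
  have : g <= (f z - f m) / (z - m).
    by apply: ge_sup; [case: slopes_sup|exact: slopes_le].
  rewrite ler_pdivlMr ?subr_gt0//; lra.
exists g => z Dz zm.
have h : 0 < (2^-1 : R) < 1 by rewrite invr_gt0 ltr0n invf_lt1// ltr1n.
have := convf Dz Dm zm h.
have Dmid : D (2^-1 * z + (1 - 2^-1) * m).
  by apply: convD => //; case/andP: h => /ltW -> /ltW ->.
have := weak _ Dmid.
set w := _ + _ * m in Dmid *.
have -> : w - m = 2^-1 * (z - m) by rewrite /w; field.
rewrite mulrCA; set gz := g * _; lra.
Qed.

(** Subtracting the supporting line at [t0] leaves a strictly convex function minimal at [t0]; it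
    decreases strictly as [x] moves towards [t0], from either side. *)
Lemma subgradient_between g t0 x y : D t0 -> D x ->
  (forall z, D z -> z != t0 -> f t0 + g * (z - t0) < f z) ->
  (x <= y <= t0) || (t0 <= y <= x) -> y != x ->
  f y < f x + g * (y - x).
Proof.
move=> Dt0 Dx gt0 xyt yx.
have [yt0|yt0] := eqVneq y t0.
  have xt0 : x != t0 by rewrite -yt0 eq_sym.
  by have := gt0 _ Dx xt0; rewrite yt0; lra.
have [l l01 yE] : exists2 l, 0 < l < 1 & y = l * x + (1 - l) * t0.
  case/orP: xyt => /andP[h1 h2].
  - have xy : x < y by rewrite lt_neqAle eq_sym yx.
    have yt : y < t0 by rewrite lt_neqAle yt0.
    have xt : x < t0 by exact: lt_trans yt.
    have [|l _ [yE lE]] := @conv_coord x y t0 _ xt; first by rewrite h1.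
    have l0 : 0 < l by rewrite lE divr_gt0 ?subr_gt0.
    have l1 : l < 1 by rewrite lE ltr_pdivrMr ?subr_gt0// mul1r ltrD2l ltrN2.
    by exists l; rewrite ?l0.
  - have yx' : y < x by rewrite lt_neqAle yx.
    have ty : t0 < y by rewrite lt_neqAle eq_sym yt0.
    have tx : t0 < x by exact: lt_trans yx'.
    have [|l _ [yE lE]] := @conv_coord t0 y x _ tx; first by rewrite h1.
    exists (1 - l); last by rewrite yE; ring.
    have l0 : 0 < l by rewrite lE divr_gt0 ?subr_gt0.
    have l1 : l < 1 by rewrite lE ltr_pdivrMr ?subr_gt0// mul1r ltrD2l ltrN2.
    by rewrite subr_gt0 l1/= ltrBlDr ltrDl.
have xt0 : x != t0.
  by apply: contra_neq yx => xt; rewrite yE xt -mulrDl addrC subrK mul1r.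
have fy := convf Dx Dt0 xt0 l01; rewrite -yE in fy.
have fx := gt0 _ Dx xt0.
have -> : y - x = (1 - l) * (t0 - x) by rewrite yE; ring.
case/andP: l01 => l0 l1.
apply: (lt_le_trans fy).
have : (1 - l) * f t0 <= (1 - l) * (f x - g * (x - t0)).
  by rewrite ler_wpM2l//; lra.
lra.
Qed.

End strict_convexity.

Section entropy.
Context (R : realType).
Implicit Types theta : R -> \bar R.

Lemma edom_fineK theta t : eproper theta -> edom theta t ->
  theta t = (fine (theta t))%:E.
Proof.
by move=> [_ th0] [t0 too]; rewrite fineK// fin_numE gt_eqF ?th0// lt_eqF.
Qed.

Lemma edomPn theta t : (0 <= t)%R -> ~ edom theta t -> theta t = +oo.
Proof.
move=> t0 Dt; apply/eqP; rewrite eq_le leey/= leNgt; apply/negP => h.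
by apply: Dt; split.
Qed.

Lemma strictly_convex_fine theta : eproper theta ->
  strictly_convex_on_dom theta ->
  forall s t l : R, edom theta s -> edom theta t -> s != t -> (0 < l < 1)%R ->
  (fine (theta (l * s + (1 - l) * t)) <
   l * fine (theta s) + (1 - l) * fine (theta t))%R.
Proof.
move=> pth [cD cth] s t l Ds Dt st l01; have := cth _ _ _ Ds Dt st l01.
have Dm : edom theta (l * s + (1 - l) * t)%R.
  by apply: cD => //; case/andP: l01 => /ltW -> /ltW ->.
rewrite (edom_fineK pth Ds) (edom_fineK pth Dt) (edom_fineK pth Dm).
by rewrite -!EFinM -EFinD lte_fin.
Qed.

Lemma entropy_subgradient theta m : eproper theta ->
  strictly_convex_on_dom theta -> edom theta m ->
  (exists2 a, edom theta a & (a < m)%R) ->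
  (exists2 b, edom theta b & (m < b)%R) ->
  exists g, forall z, (0 <= z)%R -> z != m ->
    (fine (theta m) + g * (z - m))%:E < theta z.
Proof.
move=> pth cth Dm am mb.
have [g Hg] := strict_subgradient cth.1 (strictly_convex_fine pth cth) Dm am mb.
exists g => z z0 zm; have [Dz|nDz] := pselect (edom theta z).
  by rewrite (edom_fineK pth Dz) lte_fin Hg.
by rewrite (edomPn z0 nDz) ltry.
Qed.

(** With these signs [a + b z] is nonnegative for nonnegative [z], and adding it makes [theta]
    nonnegative. If the domain is a single point a constant works; otherwise the midpoint of two
    domain points has a subgradient. *)
Lemma entropy_affine_minorant theta : eproper theta ->
  strictly_convex_on_dom theta ->
  exists a b, [/\ (0 <= a)%R, (0 <= b)%R &
    forall z, (0 <= z)%R -> (- (a + b * z))%:E <= theta z].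
Proof.
move=> pth cth; have [[c Dc] th0] := pth.
have [[b Db bc]|] := pselect (exists2 b, edom theta b & b != c); last first.
  move=> /forall2NP Dc1; exists `|fine (theta c)|%R, 0%R; split => // z z0.
  have [Dz|nDz] := pselect (edom theta z); last by rewrite (edomPn z0 nDz) leey.
  have -> : z = c by apply/eqP; case: (Dc1 z) => // /negP; rewrite negbK.
  by rewrite (edom_fineK pth Dc) lee_fin mul0r addr0 lerNl -normrN ler_norm.
have [a [b' [Da Db' ab']]] : exists a b', [/\ edom theta a, edom theta b' & (a < b')%R].
  by have [bc'|cb|/eqP] := ltgtP b c; [exists b, c|exists c, b|rewrite (negbTE bc)].
pose m := ((a + b') / 2)%R.
have am : (a < m)%R by rewrite /m; lra.
have mb : (m < b')%R by rewrite /m; lra.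
have Dm : edom theta m.
  by apply: (dom_between cth.1 Da Db'); rewrite !ltW.
have [||g Hg] := entropy_subgradient pth cth Dm.
- by exists a.
- by exists b'.
exists `|fine (theta m) - g * m|%R, `|g|%R; split => // z z0.
have h : (- (`|fine (theta m) - g * m| + `|g| * z) <=
    fine (theta m) + g * (z - m))%R.
  have := ler_norm (- (fine (theta m) - g * m))%R; rewrite normrN.
  have : (- g * z <= `|g| * z)%R.
    by rewrite ler_wpM2r// -normrN ler_norm.
  by rewrite mulrBr; lra.
have [zm|zm] := eqVneq z m; last first.
  by apply: le_trans (ltW (Hg _ z0 zm)); rewrite lee_fin.
rewrite zm (edom_fineK pth Dm) lee_fin; move: h.
by rewrite zm subrr mulr0 addr0.
Qed.

(** Sublevel sets of a convex function are intervals, hence Borel. *)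
Lemma measurable_entropy theta d (T : measurableType d) (r : T -> R) :
  strictly_convex_on_dom theta -> eproper theta ->
  measurable_fun setT r -> (forall x, (0 <= r x)%R) ->
  measurable_fun setT (theta \o r).
Proof.
move=> cth pth mr r0.
apply: (measurability _ (ErealGenOInfty.measurableE R)) => _ /= -[_ [c ->] <-].
rewrite setTI.
pose I : set R := [set z | (0 <= z)%R /\ theta z <= c%:E].
have itvI : is_interval I.
  move=> x y [x0 xc] [y0 yc] z /andP[xz zy].
  have Dx : edom theta x by split => //; exact: le_lt_trans (ltry c).
  have Dy : edom theta y by split => //; exact: le_lt_trans (ltry c).
  have [xy|yx] := ltP x y; last first.
    by have -> : z = x by apply/eqP; rewrite eq_le xz andbT (le_trans zy).
  have [|l l01 [zE _]] := @conv_coord _ x z y _ xy; first by rewrite xz.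
  have Dz : edom theta z by rewrite zE; exact: cth.1.
  split; first by case: Dz.
  move: xc yc; rewrite (edom_fineK pth Dx) (edom_fineK pth Dy) !lee_fin => xc yc.
  rewrite (edom_fineK pth Dz) lee_fin.
  have [->//|xz'] := eqVneq z x.
  have [->//|zy'] := eqVneq z y.
  have [l0 l1] : (0 < l)%R /\ (l < 1)%R.
    case/andP: l01 => l0 l1; split; rewrite lt_neqAle ?l0 ?l1 andbT.
      by apply: contraNneq zy' => l0'; rewrite zE -l0' mul0r add0r subr0 mul1r.
    by apply: contraNneq xz' => l1'; rewrite zE l1' mul1r subrr mul0r addr0.
  have := strictly_convex_fine pth cth Dx Dy (negbT (lt_eqF xy))
    (introT andP (conj l0 l1)).
  rewrite -zE => /ltW/le_trans; apply.
  have : (l * fine (theta x) <= l * c)%R by rewrite ler_wpM2l// ltW.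
  have : ((1 - l) * fine (theta y) <= (1 - l) * c)%R.
    by rewrite ler_wpM2l// subr_ge0 ltW.
  lra.
rewrite (_ : _ @^-1` _ = ~` (r @^-1` I)).
  apply: measurableC; rewrite -[X in measurable X]setTI.
  by apply: mr => //; exact: is_interval_measurable.
apply/seteqP; split => x /=; rewrite in_itv/= andbT.
  by move=> cx [_]; rewrite leNgt cx.
by move=> h; rewrite ltNge; apply/negP => h'; apply: h; split.
Qed.

Definition affine_minorant theta (g : R) : Prop :=
  exists A, forall z, (0 <= z)%R -> (A + g * z)%:E <= theta z.

(** This is the recession constant, by [recessionE]. As a supremum it dominates subgradients by
    definition and follows affine shifts without any limit. *)
Definition minorant_slope theta : \bar R :=
  ereal_sup (EFin @` affine_minorant theta).

Lemma minorant_slope_ub theta g : affine_minorant theta g ->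
  g%:E <= minorant_slope theta.
Proof. by move=> h; apply: ereal_sup_ubound; exists g. Qed.

(** On a bounded domain a line of any slope becomes a minorant once its constant term is low enough,
    so the supremum of the slopes would be infinite. *)
Lemma minorant_slope_unbounded theta : eproper theta ->
  strictly_convex_on_dom theta -> minorant_slope theta < +oo ->
  forall M, exists2 z, edom theta z & (M < z)%R.
Proof.
move=> pth cth loo M; apply: contrapT => /forall2NP DM.
have [a [b [a0 b0 ab]]] := entropy_affine_minorant pth cth.
have DM' z : edom theta z -> (z <= `|M|)%R.
  move=> Dz; case: (DM z) => // /negP; rewrite -leNgt => /le_trans; apply.
  exact: ler_norm.
suff : minorant_slope theta = +oo by move=> loo'; rewrite loo' ltxx in loo.
apply: eq_infty => g.
apply: minorant_slope_ub; exists (- (a + (b + `|g|) * `|M|))%R => z z0.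
have [Dz|nDz] := pselect (edom theta z); last by rewrite (edomPn z0 nDz) leey.
apply: le_trans (ab _ z0); rewrite lee_fin.
have zM := DM' _ Dz.
have h1 : (b * z <= b * `|M|)%R by rewrite ler_wpM2l.
have h2 : (g * z <= `|g| * `|M|)%R.
  apply: (@le_trans _ _ (`|g| * z)%R); first by rewrite ler_wpM2r// ler_norm.
  by rewrite ler_wpM2l.
by rewrite mulrDl; lra.
Qed.

(** A subgradient at [z] is the slope of a minorant, hence at most [minorant_slope theta]; its line,
    evaluated at [c], gives the bound. *)
Lemma minorant_slope_majorant theta c z : eproper theta ->
  strictly_convex_on_dom theta -> minorant_slope theta < +oo ->
  edom theta c -> (c <= z)%R ->
  edom theta z /\
  (fine (theta z) <= fine (theta c) + fine (minorant_slope theta) * (z - c))%R.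
Proof.
move=> pth cth loo Dc cz.
have unb := minorant_slope_unbounded pth cth loo.
have [b Db zb] := unb z.
have Dz : edom theta z.
  by apply: (dom_between cth.1 Dc Db); rewrite cz ltW.
split => //.
have [->|zc] := eqVneq z c; first by rewrite subrr mulr0 addr0.
have cz' : (c < z)%R by rewrite lt_neqAle eq_sym zc.
have [||g Hg] := entropy_subgradient pth cth Dz; [by exists c|by exists b|].
have gl : g%:E <= minorant_slope theta.
  apply: minorant_slope_ub; exists (fine (theta z) - g * z)%R => w w0.
  have [->|wz] := eqVneq w z; first by rewrite subrK -edom_fineK.
  by apply: le_trans (ltW (Hg _ w0 wz)); rewrite lee_fin; lra.
have lfin : minorant_slope theta \is a fin_num.
  by rewrite fin_numE (lt_eqF loo) andbT gt_eqF// (lt_le_trans (ltNyr g)).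
rewrite -(fineK lfin) lee_fin in gl.
have := Hg _ Dc.1 (negbT (lt_eqF cz')).
rewrite (edom_fineK pth Dc) lte_fin => h.
have : (g * (z - c) <= fine (minorant_slope theta) * (z - c))%R.
  by rewrite ler_wpM2r// subr_ge0.
by rewrite -(opprB z c) mulrN in h; lra.
Qed.

Lemma minorant_slope_gtNy theta : eproper theta ->
  strictly_convex_on_dom theta -> -oo < minorant_slope theta.
Proof.
move=> pth cth; have [a [b [a0 b0 ab]]] := entropy_affine_minorant pth cth.
apply: (@lt_le_trans _ _ (- b)%:E); first exact: ltNyr.
apply: minorant_slope_ub; exists (- a)%R => z /ab.
by rewrite opprD mulNr.
Qed.

Lemma affine_div_cvg (A g : R) : ((A + g * z) / z)%R @[z --> +oo%R] --> g.
Proof.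
apply/cvgrPdist_le => e e0; near=> z.
have z0 : (0 < z)%R by near: z; exact: nbhs_pinfty_gt.
rewrite (_ : g - _ = - (A / z))%R; last by field; rewrite gt_eqF.
rewrite normrN normrM normfV (gtr0_norm z0) ler_pdivrMr//.
by rewrite mulrC -ler_pdivrMr.
Unshelve. all: by end_near. Qed.

(** Each affine minorant bounds [theta z / z] from below in the limit, which settles the infinite
    case; when the slope is finite, [minorant_slope_majorant] bounds it from above. *)
Lemma recessionE theta : eproper theta -> strictly_convex_on_dom theta ->
  recession theta = minorant_slope theta.
Proof.
move=> pth cth; apply/cvg_lim => //.
have low g e : affine_minorant theta g -> (0 < e)%R ->
    \forall z \near +oo%R, (g - e)%:E <= theta z * (z^-1)%R%:E.
  move=> [A HA] e0; near=> z.
  have z0 : (0 < z)%R by near: z; exact: nbhs_pinfty_gt.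
  have : ((A + g * z) / z)%:E <= theta z * (z^-1)%R%:E.
    by rewrite EFinM lee_wpmul2r ?lee_fin ?invr_ge0 ?(ltW z0)// HA// ltW.
  apply: le_trans; rewrite lee_fin lerBlDr -lerBlDl.
  apply: le_trans (ler_norm _) _; near: z.
  by have /cvgrPdist_le := @affine_div_cvg A g; exact.
have [loo|] := ltP (minorant_slope theta) +oo; last first.
  rewrite leye_eq => /eqP loo; rewrite loo; apply/cvgeyPge => A.
  have [g [g' Hg' <-] Ag] : exists2 g, (EFin @` affine_minorant theta) g & (A + 1)%:E < g.
    by apply: ereal_sup_gt; rewrite -/(minorant_slope theta) loo ltry.
  have := low g' 1%R Hg' ltr01; apply: filterS => z; apply: le_trans.
  by rewrite lee_fin lerBrDr; rewrite lte_fin in Ag; exact: ltW.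
have lfin : minorant_slope theta \is a fin_num.
  by rewrite fin_numE (lt_eqF loo) andbT gt_eqF// minorant_slope_gtNy.
have [[c Dc] _] := pth.
rewrite -(fineK lfin).
set L := fine (minorant_slope theta).
suff : (fine (theta z) / z)%R @[z --> +oo%R] --> L.
  move=> h.
  have : (fine (theta z) / z)%:E @[z --> +oo%R] --> L%:E.
    by apply/fine_cvgP; split; [exact: nearW|exact: h].
  apply: cvg_trans; apply: near_eq_cvg; near=> z.
  have cz : (c <= z)%R by near: z; apply: nbhs_pinfty_ge; exact: num_real.
  have [Dz _] := minorant_slope_majorant pth cth loo Dc cz.
  by rewrite EFinM -(edom_fineK pth Dz).
apply/cvgrPdist_le => e e0.
have [g [g' Hg' <-] Ag] : exists2 g, (EFin @` affine_minorant theta) g & (L - e / 2)%:E < g.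
  apply: ereal_sup_gt; rewrite -/(minorant_slope theta) -(fineK lfin).
  by rewrite lte_fin ltrBlDr ltrDl divr_gt0.
near=> z.
have z0 : (0 < z)%R by near: z; exact: nbhs_pinfty_gt.
have cz : (c <= z)%R by near: z; apply: nbhs_pinfty_ge; exact: num_real.
have [Dz ub] := minorant_slope_majorant pth cth loo Dc cz.
have lb : (g' - e / 2)%:E <= theta z * (z^-1)%R%:E.
  by near: z; apply: low => //; rewrite divr_gt0.
rewrite (edom_fineK pth Dz) -EFinM lee_fin in lb; rewrite lte_fin in Ag.
rewrite ler_norml; apply/andP; split; last by lra.
rewrite lerNl opprB lerBlDl.
apply: (@le_trans _ _ ((fine (theta c) - L * c + L * z) / z)%R).
  by rewrite ler_wpM2r ?invr_ge0 ?(ltW z0)//; rewrite -/L mulrBr in ub; lra.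
rewrite -lerBlDl; apply: le_trans (ler_norm _) _; rewrite distrC.
by near: z; have /cvgrPdist_le := @affine_div_cvg (fine (theta c) - L * c) L; exact.
Unshelve. all: by end_near. Qed.

End entropy.

(** * Affine shifts of the entropy *)

Section shift.
Context (R : realType).
Implicit Types (theta : R -> \bar R) (a b : R).

(** The integral of [F] may be infinite. Then so is that of the positive part of [F - h], since [F]
    is at most this part plus [h], while the negative part is at most [h]. *)
Lemma integral_ge0_sub d (T : measurableType d)
    (mu : {measure set T -> \bar R}) (F : T -> \bar R) (h : T -> R) :
  measurable_fun setT F -> (forall x, 0 <= F x) ->
  mu.-integrable setT (EFin \o h) -> (forall x, 0 <= h x)%R ->
  \int[mu]_x (F x - (h x)%:E) = \int[mu]_x F x - \int[mu]_x (h x)%:E.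
Proof.
move=> mF F0 ih h0.
have mh : measurable_fun setT (EFin \o h) by exact: measurable_int ih.
have hfin : \int[mu]_x (h x)%:E \is a fin_num.
  exact: (integrable_fin_num measurableT ih).
have hoo : \int[mu]_x (h x)%:E < +oo by rewrite ltey_eq hfin.
have [Foo|] := ltP (\int[mu]_x F x) +oo.
  rewrite -integralB//. apply/integrableP; split => //.
  by under eq_integral do rewrite gee0_abs//.
rewrite leye_eq => /eqP Foo; rewrite Foo.
have mD : measurable_fun setT (fun x => F x - (h x)%:E).
  by apply: emeasurable_funB.
rewrite -(fineK hfin) addye//.
rewrite integralE.
have -> : \int[mu]_x ((fun x => F x - (h x)%:E)^\+ x) = +oo.
  have : \int[mu]_x F x <=
      \int[mu]_x ((fun x => F x - (h x)%:E)^\+ x + (h x)%:E).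
    apply: ge0_le_integral => //.
    - by apply: emeasurable_funD => //; exact: measurable_funepos.
    - move=> x _; by rewrite -leeBlDr// funeposE le_max lexx.
  rewrite ge0_integralD//; last 2 first.
  - exact: measurable_funepos.
  - by move=> x _; rewrite lee_fin.
  rewrite Foo leye_eq; move/eqP.
  by rewrite -(fineK hfin); case: (\int[mu]_x _).
have : \int[mu]_x ((fun x => F x - (h x)%:E)^\- x) < +oo.
  apply: le_lt_trans hoo; apply: ge0_le_integral => //.
  - exact: measurable_funeneg.
  - move=> x _; rewrite funenegE ge_max lee_fin h0 andbT.
    by rewrite fin_num_oppeB// -[leRHS]add0e leeD2r// oppe_le0.
by case: (\int[mu]_x _) => // r _.
Qed.

Definition shifted theta a b : R -> \bar R := fun z => theta z + (a + b * z)%:E.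

Lemma edom_shifted theta a b : edom (shifted theta a b) = edom theta.
Proof.
apply/seteqP; split => z [z0]; rewrite /shifted => h; split => //.
  by move: h; case: (theta z) => [r _||]//=; rewrite ltry.
by rewrite lte_add_pinfty// ltry.
Qed.

Lemma eproper_shifted theta a b : eproper theta -> eproper (shifted theta a b).
Proof.
move=> [D0 th0]; split; first by rewrite edom_shifted.
by move=> z /th0; rewrite /shifted; case: (theta z) => //= r _; rewrite ltNyr.
Qed.

Lemma strictly_convex_shifted theta a b : eproper theta ->
  strictly_convex_on_dom theta -> strictly_convex_on_dom (shifted theta a b).
Proof.
move=> pth cth; rewrite /strictly_convex_on_dom edom_shifted; split.
  exact: cth.1.
move=> s t l Ds Dt st l01.
have Dm : edom theta (l * s + (1 - l) * t)%R.
  by apply: cth.1 => //; case/andP: l01 => /ltW -> /ltW ->.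
have := strictly_convex_fine pth cth Ds Dt st l01.
rewrite /shifted (edom_fineK pth Ds) (edom_fineK pth Dt) (edom_fineK pth Dm).
by rewrite -!EFinD lte_fin /=; lra.
Qed.

Lemma minorant_slope_shifted theta a b : eproper theta ->
  strictly_convex_on_dom theta ->
  minorant_slope (shifted theta a b) = minorant_slope theta + b%:E.
Proof.
move=> pth cth.
have slope a' b' th g : affine_minorant th g ->
    affine_minorant (shifted th a' b') (g + b').
  move=> [A HA]; exists (A + a')%R => z z0.
  rewrite (_ : (A + a' + (g + b') * z)%:E = (A + g * z)%:E + (a' + b' * z)%:E).
    by rewrite leeD2r// HA.
  by rewrite -EFinD; congr EFin; ring.
apply/eqP; rewrite eq_le; apply/andP; split.
  apply: ge_ereal_sup => _ [g Hg <-]; rewrite -leeBlDr// -EFinB.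
  apply: minorant_slope_ub.
  have := slope (- a)%R (- b)%R _ _ Hg; rewrite (_ : shifted _ _ _ = theta)//.
  apply/funext => z; rewrite /shifted -addeA -EFinD.
  by rewrite [X in X%:E](_ : _ = 0%R) ?adde0//; ring.
rewrite -leeBrDr//; apply: ge_ereal_sup => _ [g Hg <-]; rewrite leeBrDr//.
by rewrite -EFinD; apply: minorant_slope_ub; exact: slope.
Qed.

(** The term [b] times the mass of [P] arises in two pieces: off [S] from the integral of [b r], on
    [S] from the shift of the recession constant. Only total masses enter, and these are the same
    for all refinements of one side. *)
Lemma divergence_shifted theta a b d (T : measurableType d)
    (P Q : {finite_measure set T -> \bar R}) :
  eproper theta -> strictly_convex_on_dom theta ->
  (0 <= a)%R -> (0 <= b)%R ->
  (forall z, (0 <= z)%R -> 0 <= shifted theta a b z) ->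
  divergence theta P Q =
    divergence (shifted theta a b) P Q - (a%:E * Q setT + b%:E * P setT).
Proof.
move=> pth cth a0 b0 phi0; set phi := shifted theta a b.
have pphi : eproper phi by exact: eproper_shifted.
have cphi : strictly_convex_on_dom phi by exact: strictly_convex_shifted.
have [r [S PQ]] := density_off_exists P Q.
have [mr r0 mS QS PE] := PQ.
rewrite (divergence_density_off _ PQ); last first.
  by move=> r' mr' r'0; exact: measurable_entropy.
rewrite (divergence_density_off _ PQ); last first.
  by move=> r' mr' r'0; exact: measurable_entropy.
rewrite !recessionE// minorant_slope_shifted//.
pose h x := (a + b * r x)%R.
have h0 x : (0 <= h x)%R by rewrite addr_ge0// mulr_ge0.
have ir := density_off_integrable PQ.
have ih : Q.-integrable setT (EFin \o h).
  rewrite (_ : EFin \o h = (EFin \o cst a) \+ (fun x => b%:E * (EFin \o r) x)).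
    apply: integrableD => //; first exact: finite_measure_integrable_cst.
    exact: integrableZl.
  by apply/funext.
have hE : \int[Q]_x (h x)%:E = a%:E * Q setT + b%:E * P (~` S).
  rewrite -setTD PE//= -integralZl// -integral_cst// -integralD//.
    exact: finite_measure_integrable_cst.
  exact: integrableZl.
have -> : \int[Q]_x theta (r x) = \int[Q]_x phi (r x) - \int[Q]_x (h x)%:E.
  rewrite -integral_ge0_sub//; last 2 first.
  - exact: measurable_entropy.
  - by move=> x; exact: phi0.
  apply: eq_integral => x _; rewrite /phi /shifted -addeA -EFinB.
  by rewrite [X in X%:E](_ : _ = 0%R) ?adde0// subrr.
have PS : P S \is a fin_num by exact: fin_num_measure.
have PSc : P (~` S) \is a fin_num.
  by apply: fin_num_measure; exact: measurableC.
have QT : Q setT \is a fin_num by exact: fin_num_measure.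
have PT : P setT = P S + P (~` S).
  rewrite -measureU ?setUv ?setICr//; exact: measurableC.
have I0 : 0 <= \int[Q]_x phi (r x) by apply: integral_ge0 => x _; exact: phi0.
have lN := minorant_slope_gtNy pth cth.
have IN : -oo < \int[Q]_x phi (r x) by exact: lt_le_trans I0.
have s0 : (0 <= fine (P S))%R by exact: fine_ge0.
rewrite PT hE -(fineK PS) -(fineK PSc) -(fineK QT).
rewrite -!EFinM -!EFinD; move: IN lN.
move: (fine (P S)) (fine (P (~` S))) (fine (Q _)) s0 => s s' q s0.
(* An identity between extended reals remains. When the slope is infinite, either the singular mass
   [s] is 0 or both sides are infinite. *)
case: (\int[Q]_x _) => [w _|_|]; last by rewrite ltxx.
- case: (minorant_slope theta) => [l _|_|]; last by rewrite ltxx.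
    by rewrite -!(EFinD, EFinM, EFinN); congr EFin; ring.
  have [->|s1] := eqVneq s 0%R.
    by rewrite !mule0 -!(EFinD, EFinM, EFinN); congr EFin; ring.
  have s2 : (0 < s)%R by rewrite lt_neqAle eq_sym s1.
  by rewrite addye// gt0_mulye ?lte_fin.
- case: (minorant_slope theta) => [l _|_|]; last by rewrite ltxx.
    by rewrite -!(EFinD, EFinM, EFinN) !addye.
  have [->|s1] := eqVneq s 0%R; first by rewrite !mule0.
  have s2 : (0 < s)%R by rewrite lt_neqAle eq_sym s1.
  by rewrite addye// gt0_mulye ?lte_fin.
Qed.

End shift.

(** * Polish spaces *)

Section binary_code.
Context (R : realType).
Local Open Scope ring_scope.

(* Base 4 leaves a gap between the codes with first digit 0 and 1, so the digits
   can be read off without the ambiguity of binary expansions. *)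
Fixpoint code_approx (b : nat -> R) (n : nat) : R :=
  if n is n'.+1 then (b 0%N + code_approx (b \o S) n') / 4 else 0.

Definition code (b : nat -> R) : R := limn (code_approx b).

Definition is_bits (b : nat -> R) := forall j, 0 <= b j <= 1.

Lemma code_approx_bounds b n : is_bits b -> 0 <= code_approx b n <= 1 / 3.
Proof.
elim: n b => [|n IHn] b bP /=; first by lra.
have := IHn _ (fun j => bP j.+1); have := bP 0%N; rewrite -/(b \o S); lra.
Qed.

Lemma code_approx_cvg b : is_bits b -> cvgn (code_approx b).
Proof.
move=> bP; apply: nondecreasing_is_cvgn.
  apply/nondecreasing_seqP => n; elim: n b bP => [|n IHn] b bP.
    by have /andP[] := code_approx_bounds 1 bP.
  have := IHn _ (fun j => bP j.+1); rewrite -/(b \o S) /=; lra.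
by exists (1 / 3) => _ [n _ <-]; have /andP[] := code_approx_bounds n bP.
Qed.

Lemma code_bounds b : is_bits b -> 0 <= code b <= 1 / 3.
Proof.
move=> bP; have bc := code_approx_cvg bP; apply/andP; split.
- apply: limr_ge => //; apply: nearW => n.
  by have /andP[] := code_approx_bounds n bP.
- apply: limr_le => //; apply: nearW => n.
  by have /andP[] := code_approx_bounds n bP.
Qed.

Lemma code_rec b : is_bits b -> code b = (b 0%N + code (b \o S)) / 4.
Proof.
move=> bP; apply/cvg_lim => //.
have bP' : is_bits (b \o S) by move=> j; exact: bP.
rewrite -cvg_shiftS /=.
apply: cvgMl; apply: cvgD; first exact: cvg_cst.
exact: code_approx_cvg.
Qed.

(** The shift on codes. A code with leading digit 0 is at most 1/12 and one with leading digit 1 is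
    at least 1/4, so the threshold 1/4 reads that digit. *)
Definition code_tail (s : R) : R := 4 * s - \1_`[(1 / 4)%R, +oo[ s.

Lemma code_digit b : is_bits b -> (forall j, b j = 0 \/ b j = 1) ->
  \1_`[(1 / 4)%R, +oo[ (code b) = b 0%N /\ code_tail (code b) = code (b \o S).
Proof.
move=> bP b01.
have [c0 c1] := andP (code_bounds (fun j => bP j.+1 : 0 <= (b \o S) j <= 1)).
suff h : \1_`[(1 / 4)%R, +oo[ (code b) = b 0%N.
  by split => //; rewrite /code_tail h (code_rec bP); lra.
rewrite indicE (code_rec bP); have [->|->] := b01 0%N.
  rewrite memNset//= in_itv/= andbT; apply/negP; rewrite -ltNge; lra.
by rewrite mem_set//= in_itv/= andbT; lra.
Qed.

Lemma measurable_code_tail : measurable_fun setT code_tail.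
Proof.
apply: measurable_funB; first exact: mulrl_measurable.
by apply: measurable_indic; exact: measurable_itv.
Qed.

(** The Marczewski function: [f x] codes the indicators of all [B m] at [x], and [D m] tests the
    digit of index [m] after [m] shifts. *)
Lemma countably_generated_real d (T : measurableType d) (B : nat -> set T) :
  (forall m, measurable (B m)) ->
  exists (f : T -> R) (D : nat -> set R), [/\ measurable_fun setT f,
    forall x, 0 <= f x <= 1, forall m, measurable (D m) &
    forall m, f @^-1` D m = B m].
Proof.
move=> mB; pose b m x : nat -> R := fun j => \1_(B (m + j)%N) x.
have bP m x : is_bits (b m x).
  by move=> j; rewrite /b indicE; case: (_ \in _); rewrite ?lexx ler01.
have b01 m x j : b m x j = 0 \/ b m x j = 1.
  by rewrite /b indicE; case: (_ \in _); [right|left].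
have bS m x : b m x \o S = b m.+1 x.
  by apply/funext => j; rewrite /b/= addnS.
have mapprox n m : measurable_fun setT (fun x => code_approx (b m x) n).
  elim: n m => [|n IHn] m /=; first exact: measurable_cst.
  apply: measurable_funM => //; apply: measurable_funD; last first.
    by apply: eq_measurable_fun (IHn m.+1) => x _; rewrite -bS.
  by apply: measurable_indic.
pose f x := code (b 0%N x).
have iterf m x : iter m code_tail (f x) = code (b m x).
  elim: m => [//|m IHm] /=; rewrite IHm.
  by have [_ ->] := code_digit (bP m x) (b01 m x); rewrite bS.
exists f, (fun m => (iter m code_tail) @^-1` `[(1 / 4)%R, +oo[%classic).
split.
- apply: (@measurable_fun_cvg _ _ _ _ (fun n x => code_approx (b 0%N x) n)) => //.
  by move=> x _; exact: code_approx_cvg.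
- by move=> x; have := code_bounds (bP 0%N x); rewrite /f; lra.
- move=> m; rewrite -[X in measurable X]setTI.
  have mit : measurable_fun setT (iter m code_tail).
    elim: m => [|m IHm] /=; first exact: measurable_id.
    exact: measurableT_comp measurable_code_tail IHm.
  by apply: mit => //; exact: measurable_itv.
- move=> m; apply/seteqP; split => x /=; rewrite iterf => h.
    have [+ _] := code_digit (bP m x) (b01 m x).
    rewrite indicE mem_set// /b addn0 indicE.
    by case: (boolP (x \in B m)) => [/set_mem//|_] /eqP; rewrite oner_eq0.
  have [+ _] := code_digit (bP m x) (b01 m x).
  rewrite /b addn0 [in RHS]indicE (mem_set h) indicE.
  by case: (boolP (_ \in _)) => [/set_mem//|_] /eqP; rewrite eq_sym oner_eq0.
Qed.

End binary_code.

Section polish_spaces.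
Context (R : realType).
Local Open Scope ring_scope.

(** Moves the metric to [T] and restates topology, density and completeness through radii, the form
    needed to code points by balls. *)
Lemma polish_metric (T : ptopologicalType) : polish R T ->
  exists (rho : T -> T -> R) (c : nat -> T),
  [/\ forall x y, rho x y = rho y x /\
        ((forall e, 0 < e -> rho x y < e) -> x = y),
      forall x y z, rho x z <= rho x y + rho y z,
      forall U : set T, open U <->
        forall x, U x -> exists2 e, 0 < e & forall y, rho x y < e -> U y,
      forall x e, 0 < e -> exists n, rho x (c n) < e &
      forall u : nat -> T,
        (forall e, 0 < e -> exists N, forall n, (N <= n)%N -> rho (u N) (u n) < e) ->
        exists x, forall e, 0 < e ->
          exists N, forall n, (N <= n)%N -> rho x (u n) < e].
Proof.
move=> [[D cD dD] [M [h [[k hK kK] openM complM]]]].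
pose rho x y := mdist (h x) (h y).
have rhoxx x : rho x x = 0 by exact: mdistxx.
have openP (U : set T) : open U <->
    forall x, U x -> exists2 e, 0 < e & forall y, rho x y < e -> U y.
  have -> : open U = open (k @^-1` U).
    apply/propext; rewrite openM -comp_preimage.
    by rewrite (_ : k \o h = id)//; apply/funext => x /=; rewrite hK.
  rewrite openE; split => [oU x Ux|HU y /= Uy].
    have : (k @^-1` U)^° (h x) by apply: oU; rewrite /= hK.
    rewrite /interior nbhs_ballP => -[e /= e0 eU]; exists e => // y xy.
    by have /= := eU (h y); rewrite hK; apply; rewrite ballEmdist.
  have [e e0 eU] := HU _ Uy; rewrite /interior nbhs_ballP; exists e => //= z.
  by rewrite ballEmdist/= => yz; apply: eU; rewrite /rho !kK.
have rhoC x y : rho x y = rho y x by exact: metric_sym.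
have rhoD x y z : rho x z <= rho x y + rho y z by exact: metric_triangle.
have D0 : D !=set0.
  by have [|x [_ Dx]] := dD setT _ openT; [exists point|exists x].
have [c cE] : exists c : nat -> T, forall x, D x -> exists n, c n = x.
  have /pfcard_geP[D00|[c]] := cD; first by move: D0; rewrite D00 => -[].
  by exists c => x Dx; have [n _ <-] := 'surj_c Dx; exists n.
exists rho, c; split => //.
- move=> x y; split => // xy; rewrite -[LHS]hK -[RHS]hK; congr k.
  apply: mdist_positivity; apply/eqP; rewrite eq_le mdist_ge0 andbT.
  by rewrite leNgt; apply/negP => /xy; rewrite ltxx.
- move=> x e e0; pose O := [set y | rho x y < e].
  have [||y [Oy Dy]] := dD O.
  + by exists x; rewrite /O/= rhoxx.
  + apply/openP => y Oy; exists (e - rho x y); first by rewrite subr_gt0.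
    by move=> z yz; rewrite /O/=; have := rhoD x y z; lra.
  + by have [n nE] := cE _ Dy; exists n; rewrite nE.
- move=> u cu.
  have [|x xF] := complM ((h \o u) @ \oo) _.
    apply: cauchy_exP => e e0; have [N HN] := cu _ e0.
    by exists (h (u N)); exists N => // n Nn /=; rewrite ballEmdist; exact: HN.
  exists (k x) => e e0.
  have : \forall n \near \oo, ball x e (h (u n)) by apply: xF; exact: nbhsx_ballx.
  move=> [N _ HN]; exists N => n Nn.
  by have := HN n Nn; rewrite ballEmdist/= /rho kK.
Qed.

(** Plays the part of the Borel isomorphism theorem: to transport laws from the line to [T] a
    measurable left inverse of a measurable code is enough. [f x] records which balls around the
    dense sequence contain [x], and [g] returns the limit of the centres of the recorded balls. *)
Lemma polish_retract (T : ptopologicalType) : polish R T ->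
  exists (f : borel T -> R) (g : R -> borel T),
  [/\ measurable_fun setT f, measurable_fun setT g,
      forall x, 0 <= f x <= 1 & forall x, g (f x) = x].
Proof.
move=> /polish_metric[rho [c [rhoS rhoD openP cdense compl]]].
have rhoC x y : rho x y = rho y x by case: (rhoS x y).
pose eps (n : nat) : R := n.+1%:R^-1.
have eps0 n : 0 < eps n by rewrite invr_gt0.
have epsP e : 0 < e -> exists N, forall n, (N <= n)%N -> eps n < e.
  move=> e0; have [N _ HN] := near_infty_natSinv_lt (PosNum e0).
  by exists N => n Nn; exact: HN.
have openB x e : open [set y | rho x y < e].
  apply/openP => y xy; exists (e - rho x y); first by rewrite subr_gt0.
  by move=> z yz /=; have := rhoD x y z; lra.
pose B (m : nat) : set (borel T) := if @unpickle (nat * nat)%type m is Some nk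
  then [set x | rho (c nk.2) x < eps nk.1] else set0.
have mB m : measurable (B m).
  rewrite /B; case: unpickle => [nk|]; last exact: measurable0.
  by apply: sub_sigma_algebra; exact: openB.
have [f [D [mf f01 mD fD]]] := @countably_generated_real R _ _ B mB.
pose bit (n k : nat) := D (pickle (n, k)).
have bitP n k x : bit n k (f x) <-> rho (c k) x < eps n.
  have -> : bit n k (f x) = B (pickle (n, k)) x.
    by rewrite -[RHS]/(_ x) -fD.
  by rewrite /B pickleK.
(* The reals that name a ball of every radius, with centres close enough for two balls to meet. For
   these the centres converge by completeness. *)
pose C := [set s | (forall n, exists k, bit n k s) /\
  forall n k m l, bit n k s -> bit m l s -> rho (c k) (c l) <= eps n + eps m].
have limC s : C s -> exists x, forall n k, bit n k s -> rho (c k) x <= eps n.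
  move=> [exk dist]; have [kn Hkn] := choice exk.
  have [|x xP] := compl (c \o kn).
    move=> e e0; have [N HN] := epsP (e / 2) (divr_gt0 e0 (ltr0Sn _ 1)).
    exists N => n Nn /=; have := dist _ _ _ _ (Hkn N) (Hkn n).
    have := HN _ (leqnn N); have := HN _ Nn; lra.
  exists x => n k nk; apply/ler_addgt0Pr => e e0.
  have [N HN] := xP (e / 2) (divr_gt0 e0 (ltr0Sn _ 1)).
  have [N' HN'] := epsP (e / 2) (divr_gt0 e0 (ltr0Sn _ 1)).
  pose m := maxn N N'.
  have h1 := HN m (leq_maxl _ _); have h2 := HN' m (leq_maxr _ _).
  have h3 := dist _ _ _ _ nk (Hkn m).
  have := rhoD (c k) (c (kn m)) x; rewrite (rhoC (c (kn m)) x); rewrite /= in h1.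
  lra.
have [s|g gP] := @choice R (borel T) (fun s x =>
    (C s -> forall n k, bit n k s -> rho (c k) x <= eps n) /\
    (~ C s -> x = point)).
  have [Cs|nCs] := pselect (C s); last by exists point.
  by have [x Hx] := limC s Cs; exists x; split.
have mC : measurable C.
  (* The distance condition does not involve [s]: each index either imposes nothing or forbids the
     two digits together. *)
  rewrite (_ : C = (\bigcap_n \bigcup_k bit n k) `&`
    \bigcap_n \bigcap_k \bigcap_m \bigcap_l
      (if pselect (rho (c k) (c l) <= eps n + eps m) then setT
       else ~` (bit n k `&` bit m l))).
    apply: measurableI.
      by apply: bigcapT_measurable => n; apply: bigcupT_measurable => k; exact: mD.
    apply: bigcapT_measurable => n; apply: bigcapT_measurable => k.
    apply: bigcapT_measurable => m; apply: bigcapT_measurable => l.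
    case: pselect => h //=; apply: measurableC; apply: measurableI; exact: mD.
  apply/seteqP; split => s.
    move=> [h1 h2]; split; first by move=> n _; have [k hk] := h1 n; exists k.
    move=> n _ k _ m _ l _ /=; case: pselect => // h [h3 h4]; apply: h; exact: h2.
  move=> [h1 h2]; split; first by move=> n; have [k _ hk] := h1 n I; exists k.
  move=> n k m l h3 h4; have := h2 n I k I m I l I.
  by case: pselect => // h /(_ (conj h3 h4)).
have gf x : g (f x) = x.
  have Cfx : C (f x).
    split.
      by move=> n; have [k hk] := cdense x _ (eps0 n); exists k; apply/bitP; rewrite rhoC.
    move=> n k m l /bitP h1 /bitP h2.
    by have := rhoD (c k) x (c l); rewrite (rhoC x); lra.
  apply: (rhoS _ _).2 => e e0; have [N HN] := epsP (e / 2) (divr_gt0 e0 (ltr0Sn _ 1)).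
  have [k hk] := cdense x _ (eps0 N).
  have /bitP hb : rho (c k) x < eps N by rewrite rhoC.
  have := (gP (f x)).1 Cfx N k hb.
  have := rhoD (g (f x)) (c k) x; rewrite (rhoC _ (c k)) (rhoC (c k) x).
  have := HN _ (leqnn N); lra.
exists f, g; split => //.
apply: (@measurability _ _ _ (borel T) setT g (@open T) erefl).
move=> _ [U oU <-]; rewrite setTI.
(* For [s] in [C] the limit [g s] lies in every closed ball named by [s], and these shrink to it; so
   [g s] is in [U] exactly when some named closed ball lies inside [U]. *)
pose good n k := forall y, rho (c k) y <= eps n -> U y.
rewrite (_ : g @^-1` U = (C `&` \bigcup_n \bigcup_k
    (if pselect (good n k) then bit n k else set0)) `|`
    (if pselect (U point) then ~` C else set0)).
  apply: measurableU.
    apply: measurableI => //; do 2 apply: bigcupT_measurable => ?.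
    by case: pselect => h //=; exact: mD.
  by case: pselect => h //=; exact: measurableC.
apply/seteqP; split => s /=.
  move=> Ugs; have [Cs|nCs] := pselect (C s); last first.
    by right; rewrite -((gP s).2 nCs); case: pselect.
  left; split => //; have [e e0 eU] := (openP U).1 oU _ Ugs.
  have [N HN] := epsP (e / 2) (divr_gt0 e0 (ltr0Sn _ 1)).
  have [k hk] := Cs.1 N; exists N => //; exists k => //.
  case: pselect => // -[] y ky; apply: eU.
  have := rhoD (g s) (c k) y; rewrite (rhoC _ (c k)).
  have := (gP s).1 Cs N k hk; have := HN _ (leqnn N); lra.
move=> [[Cs [n _ [k _]]]|]; case: pselect => // h hs.
  by apply: (h); exact: (gP s).1 Cs n k hs.
by rewrite (gP s).2.
Qed.

End polish_spaces.

(** * Open sets and the product sigma-algebra *)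

Section polish_product.
Context (R : realType).

Lemma polish_countable_base (T : ptopologicalType) : polish R T ->
  exists U : nat -> set T, (forall n, open (U n)) /\
    forall x (A : set T), nbhs x A -> exists n, U n x /\ U n `<=` A.
Proof.
move=> /polish_metric[rho [c [rhoS rhoD openP cdense compl]]].
have rhoC x y : rho x y = rho y x by case: (rhoS x y).
pose B (m : nat) : set T := if @unpickle (nat * nat)%type m is Some nk
  then [set x | (rho (c nk.2) x < (nk.1.+1%:R)^-1)%R] else set0.
exists B; split.
  move=> m; rewrite /B; case: unpickle => [nk|]; last exact: open0.
  apply/openP => y xy; exists ((nk.1.+1%:R)^-1 - rho (c nk.2) y)%R.
    by rewrite subr_gt0.
  move=> z yz /=; apply: (le_lt_trans (rhoD _ y _)).
  by rewrite -ltrBrDl.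
move=> x A; rewrite nbhsE => -[W [oW Wx] WA].
have [e e0 eO] := (openP W).1 oW _ Wx.
have [n _ /(_ n (leqnn n)) /= ne] :=
  near_infty_natSinv_lt (PosNum (divr_gt0 e0 (ltr0Sn _ 1))).
have n0 : (0 < (n.+1%:R : R)^-1)%R by rewrite invr_gt0.
have [k xk] := cdense x _ n0.
exists (pickle (n, k)); rewrite /B pickleK /=; split; first by rewrite rhoC.
move=> z /= kz; apply/WA/eO.
have h1 : (rho x (c k) < e / 2)%R := lt_trans xk ne.
have h2 : (rho (c k) z < e / 2)%R := lt_trans kz ne.
by have := rhoD x (c k) z; lra.
Qed.

(** Plans live on the product sigma-algebra. Countable bases write an open set as a countable union
    of open rectangles, which makes the complement of the edge set measurable. *)
Lemma open_measurable_prod (X Y : ptopologicalType) (O : set (X * Y)) :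
  polish R X -> polish R Y -> open O ->
  measurable (O : set (borel X * borel Y)%type).
Proof.
move=> /polish_countable_base[U [oU HU]] /polish_countable_base[V [oV HV]] oO.
rewrite (_ : O = \bigcup_n \bigcup_m
  (if pselect (U n `*` V m `<=` O) then U n `*` V m else set0)); last first.
  apply/seteqP; split => [[x y] Oxy|xy [n _ [m _]]]; last first.
    by case: pselect => // h; exact: h.
  have [[A B]/= [Ax By] AB] : nbhs (x, y) O by exact: open_nbhs_nbhs.
  have [n [Unx UA]] := HU _ _ Ax; have [m [Vmy VB]] := HV _ _ By.
  exists n => //; exists m => //; case: pselect => // -[] z [/= z1 z2].
  by apply: AB; split; [exact: UA|exact: VB].
apply: bigcupT_measurable => n; apply: bigcupT_measurable => m.
have mU : @measurable _ (borel X) (U n) by apply: sub_sigma_algebra; exact: oU.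
have mV : @measurable _ (borel Y) (V m) by apply: sub_sigma_algebra; exact: oV.
case: pselect => h; last exact: measurable0.
exact: measurableX.
Qed.

End polish_product.

(** * Randomization and disintegration *)

Section finite_measure_lemmas.
Context (R : realType) (d d' : measure_display).
Context (T : measurableType d) (T' : measurableType d').

Lemma finite_pushforward (M : {finite_measure set T -> \bar R}) (f : T -> T') :
  measurable_fun setT f ->
  exists N : {finite_measure set T' -> \bar R}, forall A, N A = M (f @^-1` A).
Proof.
move=> mf; pose N : {measure set T' -> \bar R} :=
  measure_function_pushforward__canonical__measure_function_Measure M mf.
apply: (@finite_measure_of _ _ _ N).
- exact: measure0.
- by move=> A; exact: measure_ge0.
- exact: measure_semi_sigma_additive.
- by rewrite /N/= /pushforward preimage_setT -ge0_fin_numE// fin_num_measure.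
Qed.

Lemma finite_measure_unique_real (M N : {finite_measure set R -> \bar R}) :
  (forall s, M `]s, +oo[%classic = N `]s, +oo[%classic) ->
  forall A, measurable A -> M A = N A.
Proof.
move=> MN A mA; apply: (@measure_unique _ _ _ (@RGenOInfty.G R)
  (fun n => `](- n%:R)%R, +oo[%classic) _ _ _ _ M N _ _ A mA).
- exact: RGenOInfty.measurableE.
- move=> _ _ [x ->] [y ->]; exists (Num.max x y).
  by apply/seteqP; split => z /=; rewrite !in_itv/= !andbT gt_max => /andP.
- by move=> n; exists (- n%:R)%R.
- rewrite -subTset => x _; exists (Num.truncn `|x|).+1 => //=.
  rewrite in_itv/= andbT ltrNl.
  by apply: le_lt_trans (truncnS_gt `|x|); rewrite -normrN ler_norm.
- by move=> _ [s ->]; exact: MN.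
- by move=> n; rewrite -ge0_fin_numE// fin_num_measure//; exact: measurable_itv.
Qed.

Lemma finite_measure_unique_prod
    (M N : {finite_measure set (T * T')%type -> \bar R}) :
  (forall A B, measurable A -> measurable B -> M (A `*` B) = N (A `*` B)) ->
  forall A, measurable A -> M A = N A.
Proof.
move=> MN; pose G := [set A `*` B | A in @measurable _ T & B in @measurable _ T'].
apply: (@measure_unique _ _ _ G (fun=> setT)).
- exact: measurable_prod_measurableType.
- move=> _ _ [A mA [B mB <-]] [A' mA' [B' mB' <-]].
  exists (A `&` A'); first exact: measurableI.
  by exists (B `&` B'); [exact: measurableI|rewrite setXI].
- by move=> _; exists setT => //; exists setT => //; rewrite setXTT.
- by rewrite bigcup_const//; exists 0%N.
- by move=> _ [A mA [B mB <-]]; exact: MN.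
- by move=> _; rewrite -ge0_fin_numE// fin_num_measure.
Qed.

End finite_measure_lemmas.

Definition uniform01 (R : realType) : probability (measurableTypeR R) R :=
  uniform_prob (@ltr01 R).

Lemma uniform01_gt (R : realType) (c : R) : (0 <= c <= 1)%R ->
  uniform01 R `]c, +oo[%classic = (1 - c)%:E.
Proof.
move=> /andP[c0 c1]; rewrite /uniform01/= /uniform_prob integral_uniform_pdf.
rewrite (_ : _ `&` _ = `]c, 1%R]%classic); last first.
  apply/seteqP; split => x /=; rewrite !in_itv/=.
    by move=> [/andP[cx _] /andP[_ ->]]; rewrite cx.
  by move=> /andP[cx ->]; rewrite cx (le_trans c0 (ltW cx)).
rewrite (eq_integral (cst 1)); last first.
  move=> x; rewrite inE/= in_itv/= => /andP[cx x1].
  by rewrite /uniform_pdf (le_trans c0 (ltW cx)) x1 subr0 invr1.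
rewrite integral_cst; last exact: measurable_itv.
rewrite mul1e/= lebesgue_measure_itv/= lte_fin.
by case: ltP => // h; congr EFin; apply/eqP; rewrite eq_sym subr_eq0 eq_le h.
Qed.

Section randomization.
Context (R : realType) (dY dZ : measure_display).
Context (Y : measurableType dY) (Z : measurableType dZ).
Variables (b : Z -> Y) (mb : measurable_fun setT b).
Variables (p : {finite_measure set Z -> \bar R}).
Variables (P : {finite_measure set Y -> \bar R}).
Hypothesis PE : forall B, measurable B -> P B = p (b @^-1` B).

Local Notation UR := (measurableTypeR R).
Local Notation lam := (uniform01 R).

Let measurable_preimage d' (T : measurableType d') (h : Z -> T) (A : set T) :
  measurable_fun setT h -> measurable A -> measurable (h @^-1` A).
Proof. by move=> mh mA; rewrite -[X in measurable X]setTI; exact: mh. Qed.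

(* The inverse of the conditional distribution function of xi given b,
   evaluated at a uniform variable: (y, u) |-> (y, Q (y, u)) transports
   P \x lam to the law of (b, xi). *)
Lemma conditional_quantile (xi : Z -> R) : measurable_fun setT xi ->
  (forall z, (0 <= xi z <= 1)%R) ->
  exists2 Q : Y * UR -> R, measurable_fun setT Q &
  forall A : set (Y * R), measurable A ->
    p ((fun z => (b z, xi z)) @^-1` A) =
    (P \x lam) ((fun w => (w.1, Q w)) @^-1` A).
Proof.
move=> mxi xi01.
have mB B : measurable B -> measurable (b @^-1` B) by exact: measurable_preimage.
have mxile s : measurable (xi @^-1` `]-oo, s]%classic).
  by apply: measurable_preimage => //; exact: measurable_itv.
have mxigt s : measurable (xi @^-1` `]s, +oo[%classic).
  by apply: measurable_preimage => //; exact: measurable_itv.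
(* A conditional distribution function, one density for each [s]. For each pair of levels
   monotonicity in [s] holds only almost everywhere, hence the countable family [rs] below. *)
have [s|F FP] := @choice R (Y -> R) (fun s Fs => [/\ measurable_fun setT Fs,
    forall y, (0 <= Fs y <= 1)%R & forall B, measurable B ->
    p (b @^-1` B `&` xi @^-1` `]-oo, s]%classic) = \int[P]_(y in B) (Fs y)%:E]).
  have [ps psE] := finite_measure_restr p (mxile s).
  have [Ps PsE] := finite_pushforward ps mb.
  have [|Fs [mFs Fs0 FsE] Fs1] := @dominated_density _ _ _ Ps P.
    move=> B mB'; rewrite PsE psE PE//; apply: le_measure; rewrite ?inE.
    - by apply: measurableI => //; exact: mB.
    - exact: mB.
    - exact: subIsetl.
  exists Fs; split => // [y|B mB']; first by rewrite Fs0 Fs1.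
  by rewrite -FsE// PsE psE.
have mF s : measurable_fun setT (F s) by case: (FP s).
have F01 s y : (0 <= F s y <= 1)%R by case: (FP s).
have FE s B : measurable B -> p (b @^-1` B `&` xi @^-1` `]-oo, s]%classic) =
    \int[P]_(y in B) (F s y)%:E by case: (FP s) => _ _; exact.
pose W s B : set (Y * UR) := [set w | B w.1 /\ (F s w.1 < w.2)%R].
have mW s B : measurable B -> measurable (W s B).
  move=> mB'; rewrite (_ : W s B = (fst @^-1` B) `&` [set w | (F s w.1 < w.2)%R])//.
  apply: measurableI.
    by rewrite -[X in measurable X]setTI; exact: measurable_fst.
  rewrite -[X in measurable X]setTI.
  apply: measurable_fun_ltr => //.
    exact: measurableT_comp (mF s) measurable_fst.
have WE s B : measurable B ->
    (P \x lam) (W s B) = p (b @^-1` B `&` xi @^-1` `]s, +oo[%classic).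
  move=> mB'.
  have -> : (P \x lam) (W s B) = \int[P]_(y in B) (1 - F s y)%:E.
    rewrite /product_measure1 [RHS]integral_mkcond; apply: eq_integral => y _ /=.
    rewrite patchE; case: ifPn => [/set_mem By|/negP yB].
      rewrite -uniform01_gt//; congr (lam _); apply/seteqP; split => u /=.
        by rewrite /xsection/= inE /W/= in_itv/= andbT => -[].
      by rewrite /xsection/= inE /W/= in_itv/= andbT.
    rewrite (_ : xsection _ _ = set0) ?measure0//; apply/seteqP; split => u //=.
    by rewrite /xsection/= inE => -[By]; exfalso; apply: yB; exact/mem_set.
  have H : \int[P]_(y in B) (F s y)%:E + \int[P]_(y in B) (1 - F s y)%:E =
      p (b @^-1` B).
    rewrite -ge0_integralD//; last 4 first.
    - by move=> y _; rewrite lee_fin; case/andP: (F01 s y).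
    - exact/measurable_funTS/measurable_EFinP.
    - by move=> y _; rewrite lee_fin subr_ge0; case/andP: (F01 s y).
    - apply/measurable_funTS/measurable_EFinP; apply: measurable_funB => //.
    under eq_integral do rewrite -EFinD addrC subrK.
    by rewrite integral_cst// mul1e; exact: PE.
  apply: (@addeIl _ (\int[P]_(y in B) (F s y)%:E)).
    by rewrite -FE// fin_num_measure//; apply: measurableI => //; exact: mB.
  rewrite H -FE// -measureU//.
  - congr (p _); apply/seteqP; split => z /= => [Bz|[[]|[]]//].
    by rewrite !in_itv/= andbT; case: leP => h; [left|right].
  - by apply: measurableI => //; exact: mB.
  - by apply: measurableI => //; exact: mB.
  - apply/seteqP; split => z //= [[_ +] [_]]; rewrite !in_itv/= andbT.
    by move=> h /(le_lt_trans h); rewrite ltxx.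
have [rs rsP] : exists rs : nat -> R, forall x y, (x < y)%R ->
    exists n, (x < rs n < y)%R.
  exists (fun n => if @unpickle rat n is Some r then ratr r else 0%R) => x y xy.
  have [r] := rat_in_itvoo xy; rewrite in_itv/= => rxy.
  by exists (pickle r); rewrite pickleK.
(* The generalized inverse of [F], taken along the dense sequence [rs]: a countable supremum stays
   measurable even where [F] is not monotone. The point 0 keeps the set nonempty. *)
pose S (w : Y * UR) : set R :=
  [set 0%R] `|` [set s | exists2 n, s = rs n &
                          (0 <= rs n <= 1)%R /\ (F (rs n) w.1 < w.2)%R].
have S0 w : S w 0%R by left.
have Sub w : has_ubound (S w).
  by exists 1%R => s [->|[n -> [/andP[]]]].
pose Q w := sup (S w).
have Qgt s w : (0 <= s)%R -> (s < Q w)%R <-> exists n,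
    [/\ (s < rs n)%R, (rs n <= 1)%R & (F (rs n) w.1 < w.2)%R].
  move=> s0; split=> [sQ|[n [sn n1 Fn]]].
    have [|t [->|[n -> [/andP[_ n1] Fn]]] st] := sup_gt _ sQ; first by exists 0%R.
      by rewrite ltNge s0 in st.
    by exists n.
  apply: (lt_le_trans sn); apply: ub_le_sup => //; right; exists n => //.
  by rewrite n1 (le_trans s0 (ltW sn)).
have Q0 w : (0 <= Q w)%R by apply: ub_le_sup.
have EQ s B : (0 <= s)%R ->
    [set w : Y * UR | B w.1 /\ (s < Q w)%R] =
    \bigcup_n (if (s < rs n)%R && (rs n <= 1)%R then W (rs n) B else set0).
  move=> s0; apply/seteqP; split => [w /= [Bw /(Qgt _ _ s0)[n [h1 h2 h3]]]|].
    by exists n => //; rewrite h1 h2.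
  move=> w [n _]; case: ifPn => // /andP[h1 h2] [Bw h3]; split => //.
  by apply/(Qgt _ _ s0); exists n.
have mEQ s B : measurable B -> measurable [set w : Y * UR | B w.1 /\ (s < Q w)%R].
  move=> mB'; have [s0|s0] := leP 0%R s.
    rewrite EQ//; apply: bigcupT_measurable => n.
    by case: ifPn => // _; exact: mW.
  rewrite (_ : [set w | _] = fst @^-1` B).
    by rewrite -[X in measurable X]setTI; exact: measurable_fst.
  apply/seteqP; split => [w []//|w Bw]; split => //.
  exact: lt_le_trans (Q0 w).
have mQ : measurable_fun setT Q.
  apply: (measurability _ (RGenOInfty.measurableE R)) => _ /= -[_ [s ->] <-].
  rewrite (_ : _ `&` _ = [set w : Y * UR | setT w.1 /\ (s < Q w)%R]); last first.
    by apply/seteqP; split => w /=; rewrite in_itv/= andbT.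
  exact: mEQ.
exists Q => //.
have mbxi : measurable_fun setT (fun z => (b z, xi z)).
  exact: measurable_fun_pair.
have mfQ : measurable_fun setT (fun w : Y * UR => (w.1, Q w)).
  by apply: measurable_fun_pair => //; exact: measurable_fst.
have prodE B : measurable B -> (P \x lam) (B `*` setT) = P B.
  move=> mB'; rewrite product_measure1E// [X in _ * X](_ : _ = 1) ?mule1//.
  exact: (probability_setT lam).
have [m mE] : exists m : {finite_measure set (Y * UR)%type -> \bar R},
    forall A, m A = (P \x lam) A.
  apply: (@finite_measure_of _ _ _ (P \x lam)).
  - exact: measure0.
  - by move=> A; exact: measure_ge0.
  - exact: measure_semi_sigma_additive.
  - rewrite -setXTT prodE//.
    by rewrite -ge0_fin_numE// fin_num_measure.
have ray s B : measurable B -> m [set w : Y * UR | B w.1 /\ (s < Q w)%R] =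
    p (b @^-1` B `&` xi @^-1` `]s, +oo[%classic).
  move=> mB'; have [s0|s0] := leP 0%R s; last first.
    rewrite (_ : [set w | _] = B `*` setT); last first.
      apply/seteqP; split => [w [Bw _]//|w [Bw _]]; split => //.
      exact: lt_le_trans (Q0 w).
    rewrite mE prodE// (PE mB').
    rewrite setIidl// => z _ /=; rewrite in_itv/= andbT.
    by apply: lt_le_trans s0 _; case/andP: (xi01 z).
  set Es := [set w | _]; have mEs : measurable Es by exact: mEQ.
  apply/eqP; rewrite eq_le; apply/andP; split.
    (* Where monotonicity fails between [s] and [rs n]. Off the null union of these sets, [s < Q w]
       implies [F s w.1 < w.2]. *)
    pose N n : set Y := if (s < rs n)%R then [set y | (F (rs n) y < F s y)%R] else set0.
    have mN n : measurable (N n).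
      rewrite /N; case: ifPn => // _; rewrite -[X in measurable X]setTI.
      exact: measurable_fun_ltr.
    have N0 : P.-negligible (\bigcup_n N n).
      apply: negligible_bigcup => n; rewrite /N; case: ifPn => [srn|_]; last first.
        exact: negligible_set0.
      have : {ae P, forall y, (F s y)%:E <= (F (rs n) y)%:E}.
        apply: ae_le_of_integral.
        - exact/measurable_EFinP.
        - exact/measurable_EFinP.
        - by move=> y; rewrite lee_fin; case/andP: (F01 s y).
        - by move=> y; rewrite lee_fin; case/andP: (F01 (rs n) y).
        - move=> A mA; rewrite -!FE//; apply: le_measure; rewrite ?inE.
          + by apply: measurableI => //; exact: mB.
          + by apply: measurableI => //; exact: mB.
          + apply: setIS => z /=; rewrite !in_itv/= => /le_trans; apply.
            exact: ltW.
        - by rewrite -FE// -ge0_fin_numE// fin_num_measure//; apply: measurableI => //; exact: mB.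
      by apply: negligibleS => y /=; rewrite lee_fin leNgt => -> .
    have mUN : measurable (\bigcup_n N n) by exact: bigcupT_measurable.
    have PN : P (\bigcup_n N n) = 0 by apply/negligibleP.
    have EW : Es `<=` W s B `|` (\bigcup_n N n) `*` setT.
      move=> w [Bw /(Qgt _ _ s0)[n [h1 h2 h3]]].
      have [h|h] := ltP (F (rs n) w.1) (F s w.1).
        by right; split => //; exists n => //; rewrite /N h1.
      by left; split => //; exact: le_lt_trans h3.
    have mX : measurable ((\bigcup_n N n) `*` (@setT UR)) by exact: measurableX.
    apply: (@le_trans _ _ (m (W s B `|` (\bigcup_n N n) `*` setT))).
      by apply: le_measure; rewrite ?inE//; apply: measurableU => //; exact: mW.
    apply: (@le_trans _ _ (m (W s B) + m ((\bigcup_n N n) `*` setT))).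
      by apply: measureU2 => //; exact: mW.
    by rewrite !mE prodE// PN adde0 WE.
  (* For the reverse bound [xi > s] is exhausted by [xi > s + 1/(k+1)], which leaves room for a term
     of [rs] strictly above [s]. *)
  pose G k := b @^-1` B `&` xi @^-1` `](s + k.+1%:R^-1)%R, +oo[%classic.
  have mG k : measurable (G k) by apply: measurableI => //; exact: mB.
  have -> : b @^-1` B `&` xi @^-1` `]s, +oo[%classic = \bigcup_k G k.
    rewrite -setI_bigcupr; congr (_ `&` _); apply/seteqP; split => z /=.
      rewrite in_itv/= andbT => /ltr_add_invr[k sk]; exists k => //=.
      by rewrite in_itv/= andbT.
    move=> [k _] /=; rewrite !in_itv/= !andbT; apply: le_lt_trans.
    by rewrite lerDl invr_ge0.
  have ndG : {homo G : n m / (n <= m)%N >-> (n <= m)%O}.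
    move=> k k' kk'; apply/subsetPset; apply: setIS => z /=; rewrite !in_itv/= !andbT.
    by apply: le_lt_trans; rewrite lerD2l lef_pV2 ?posrE// ler_nat.
  have := nondecreasing_cvg_mu (mu := p) mG (bigcupT_measurable _ mG) ndG.
  move/cvg_lim => <-//; apply: lime_le.
    by apply: ereal_nondecreasing_is_cvgn => k k' kk'; apply: le_measure;
      rewrite ?inE//; apply/subsetPset/ndG.
  apply: nearW => k /=.
  have [k1|k1] := leP 1%R (s + k.+1%:R^-1)%R.
    rewrite (_ : G k = set0) ?measure0// -subset0 => z [_] /=.
    rewrite in_itv/= andbT => h; case/andP: (xi01 z) => _.
    by rewrite leNgt (le_lt_trans k1 h).
  have [n /andP[sn nk]] := rsP s (s + k.+1%:R^-1)%R ltac:(by rewrite ltrDl invr_gt0).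
  apply: (@le_trans _ _ (p (b @^-1` B `&` xi @^-1` `](rs n), +oo[%classic))).
    apply: le_measure; rewrite ?inE//; first by apply: measurableI => //; exact: mB.
    by apply: setIS => z /=; rewrite !in_itv/= !andbT; apply: lt_trans.
  rewrite -WE// -mE; apply: le_measure; rewrite ?inE//; first exact: mW.
  move=> w [Bw Fw]; split => //; apply/(Qgt _ _ s0); exists n; split => //.
  exact: ltW (lt_trans nk k1).
have [M1 M1E] := finite_pushforward p mbxi.
have [M2 M2E] := finite_pushforward m mfQ.
suff H A : measurable A -> M1 A = M2 A.
  by move=> A mA; rewrite -mE -M2E -H// M1E.
apply: finite_measure_unique_prod => B A' mB' mA'.
have [p' p'E] := finite_measure_restr p (mB _ mB').
have [N1 N1E] := finite_pushforward p' mxi.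
have mfB : measurable (fst @^-1` B : set (Y * UR)).
  by rewrite -[X in measurable X]setTI; exact: measurable_fst.
have [m' m'E] := finite_measure_restr m mfB.
have [N2 N2E] := finite_pushforward m' mQ.
have : N1 A' = N2 A'.
  apply: finite_measure_unique_real => // s; rewrite N1E N2E p'E m'E setIC -ray//.
  by congr (m _); apply/seteqP; split => w /=; rewrite in_itv/= andbT => -[].
rewrite N1E N2E p'E m'E M1E M2E => h.
rewrite (_ : _ @^-1` _ = xi @^-1` A' `&` b @^-1` B); last first.
  by apply/seteqP; split => z [].
by rewrite h; congr (m _); apply/seteqP; split => z [].
Qed.

End randomization.

Section disintegration.
Context (R : realType) (dX dY dZ : measure_display).
Context (X : measurableType dX) (Y : measurableType dY) (Z : measurableType dZ).

Local Notation UR := (measurableTypeR R).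
Local Notation lam := (uniform01 R).

(** [G] decodes by [g] the conditional quantile of [f \o a] given [b]. The fibre of [p] over [y]
    thus becomes the image of a uniform variable, on which fibrewise Jensen and Tonelli operate. *)
Lemma randomization_retract (a : Z -> X) (b : Z -> Y) (mk : X * Y -> Z)
    (f : X -> R) (g : R -> X)
    (p : {finite_measure set Z -> \bar R}) (P : {finite_measure set Y -> \bar R}) :
  measurable_fun setT a -> measurable_fun setT b -> measurable_fun setT mk ->
  (forall z, mk (a z, b z) = z) ->
  measurable_fun setT f -> measurable_fun setT g ->
  (forall x, 0 <= f x <= 1)%R -> (forall x, g (f x) = x) ->
  (forall B, measurable B -> P B = p (b @^-1` B)) ->
  exists2 G : Y * UR -> X, measurable_fun setT G &
  forall C, measurable C -> p C = (P \x lam) ((fun w => mk (G w, w.1)) @^-1` C).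
Proof.
move=> ma mb mmk mkK mf mg f01 gf PE.
have mfa : measurable_fun setT (f \o a) by exact: measurableT_comp.
have [Q mQ QE] := conditional_quantile mb PE mfa (fun z => f01 (a z)).
exists (g \o Q); first exact: measurableT_comp.
move=> C mC.
pose A : set (Y * R) := (fun w => mk (g w.2, w.1)) @^-1` C.
have mA : measurable A.
  rewrite -[A]setTI; suff h : measurable_fun setT (fun w : Y * R => mk (g w.2, w.1)).
    exact: h.
  apply: (@measurableT_comp _ _ _ _ _ _ mk) => //.
  by apply: measurable_fun_pair => //; exact: measurableT_comp mg measurable_snd.
have <- := QE _ mA.
by congr (p _); apply/seteqP; split => z; rewrite /A/= gf mkK.
Qed.

Section kernel_of_function.
Variables (G : Y * UR -> X) (mG : measurable_fun setT G).

Let mGy y : measurable_fun setT (fun u => G (y, u)).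
Proof. exact: measurableT_comp mG (measurable_pair1 y). Qed.

Let kG y : {measure set X -> \bar R} :=
  measure_function_pushforward__canonical__measure_function_Measure lam (mGy y).

Lemma kernel_of_function : exists K : R.-pker Y ~> X, forall y A,
  measurable A -> K y A = lam [set u | A (G (y, u))].
Proof.
have kGE y A : kG y A = (lam \o xsection (G @^-1` A)) y.
  rewrite /kG /= /pushforward; congr (lam _).
  by apply/seteqP; split => u; rewrite /xsection/= inE.
have mkG U : measurable U -> measurable_fun setT (kG ^~ U).
  move=> mU; have mGU : measurable (G @^-1` U).
    by rewrite -[X in measurable X]setTI; exact: mG.
  have := measurable_fun_xsection lam mGU.
  by apply: eq_measurable_fun => y _; rewrite kGE.
have kG1 y : kG y setT = 1.
  by rewrite /kG /= /pushforward preimage_setT; exact: (probability_setT lam).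
pose k1 := isKernel.Build _ _ Y X R kG mkG.
pose K1 : R.-ker Y ~> X := HB.pack kG k1.
pose k2 := Kernel_isProbability.Build _ _ Y X R K1 kG1.
pose K2 : R.-pker Y ~> X := HB.pack kG k1 k2.
by exists K2 => y A mA.
Qed.

End kernel_of_function.
End disintegration.

(** * Divergence of plans and of marginals *)

Section integral_transfer.
Context (R : realType) (d d' : measure_display).
Context (T : measurableType d) (T' : measurableType d').
Implicit Types (M N Q : {finite_measure set T -> \bar R}).

Lemma integral_add_measure M N Q (f : T -> \bar R) D :
  (forall A, Q A = M A + N A) -> measurable D -> measurable_fun setT f ->
  (forall x, 0 <= f x) ->
  \int[Q]_(x in D) f x = \int[M]_(x in D) f x + \int[N]_(x in D) f x.
Proof.
move=> QE mD mf f0.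
have QE' A : measurable A -> A `<=` D -> Q A = measure_add M N A.
  by move=> _ _; rewrite QE [RHS]measure_addE.
rewrite (eq_measure_integral (measure_add M N) QE').
by apply: ge0_integral_measure_add => //; exact: measurable_funTS.
Qed.

Lemma integral_restr_measure M N S (f : T -> \bar R) D : measurable S ->
  (forall A, N A = M (A `&` S)) -> measurable D -> measurable_fun setT f ->
  (forall x, 0 <= f x) ->
  \int[N]_(x in D) f x = \int[M]_(x in D `&` S) f x.
Proof.
move=> mS NE mD mf f0.
have mSc : measurable (~` S) by exact: measurableC.
have NS : N (~` S) = 0 by rewrite NE setICl measure0.
rewrite -(integral_setD_null mD mSc mf f0 NS) setDE setCK.
apply: eq_measure_integral => A mA AS.
by change (N A = M A); rewrite NE setIidl// => x /AS[].
Qed.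

Lemma integral_image_measure (M : {finite_measure set T -> \bar R})
    (N : {finite_measure set T' -> \bar R}) (h : T -> T') (f : T' -> \bar R) D :
  measurable_fun setT h -> (forall A, measurable A -> N A = M (h @^-1` A)) ->
  measurable D -> measurable_fun setT f -> (forall x, 0 <= f x) ->
  \int[N]_(y in D) f y = \int[M]_(x in h @^-1` D) f (h x).
Proof.
move=> mh NE mD mf f0.
rewrite -[RHS](ge0_integral_pushforward mh)//.
- apply: eq_measure_integral => A mA AS.
  exact: NE.
- exact: measurable_funTS.
Qed.

End integral_transfer.

Section proportional.
Context (R : realType) (dX dY dZ : measure_display).
Context (X : measurableType dX) (Y : measurableType dY) (Z : measurableType dZ).
Variables (a : Z -> X) (b : Z -> Y) (N : set Z).
Hypotheses (ma : measurable_fun setT a) (mb : measurable_fun setT b).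
Hypothesis mN : measurable N.

(** The refinements of the side that [h] projects to, [N] being the complement of the edge set.
    Keeping [Z] and its projections abstract postpones the choice of orientation to the end. *)
Definition plan_of d' (T : measurableType d') (h : Z -> T)
    (nu : {finite_measure set T -> \bar R})
    (p : {finite_measure set Z -> \bar R}) : Prop :=
  p N = 0 /\ forall A, measurable A -> p (h @^-1` A) = nu A.

Variables (nu P : {finite_measure set Y -> \bar R}).
Variables (p q : {finite_measure set Z -> \bar R}).
Hypothesis pN : p N = 0.
Hypothesis PE : forall B, measurable B -> P B = p (b @^-1` B).
Hypothesis nuq : plan_of b nu q.

(** [q'] is [p] divided by [r] off [S] where [r] is positive, and copies [q] where [r = 0]. The
    copied part respects the edges and does not disturb the density equation, in which it is
    weighted by [r = 0]. *)
Lemma proportional_plan r S : density_off P nu r S ->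
  exists2 q', plan_of b nu q' & density_off p q' (r \o b) (b @^-1` S).
Proof.
move=> [mr r0 mS nuS PnuE]; have [qN qE] := nuq.
have mb1 B : measurable B -> measurable (b @^-1` B).
  by move=> mB; rewrite -[X in measurable X]setTI; exact: mb.
have mSc : measurable (~` S) by exact: measurableC.
have [p0 p0E] := finite_measure_restr p (mb1 _ mSc).
have [P0 P0E] := finite_measure_restr P mSc.
have P0p0 B : measurable B -> P0 B = p0 (b @^-1` B).
  by move=> mB; rewrite P0E p0E PE//; exact: measurableI.
have P0nu : has_density P0 nu r.
  by split => // B mB; rewrite P0E -setDE PnuE.
(* The inverse of 0 is 0, so [q1] carries nothing over [K], where [q2] takes over. *)
pose v y : R := ((r y)^-1)%R.
have v0 y : (0 <= v y)%R by rewrite invr_ge0.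
have mv : measurable_fun setT v by exact: measurable_fun_inv.
have mrb : measurable_fun setT (r \o b) by exact: measurableT_comp.
have mvb : measurable_fun setT (v \o b) by exact: measurableT_comp.
have mev : measurable_fun setT (EFin \o v) by exact/measurable_EFinP.
pose K := [set y | r y = 0%R].
have mK : measurable K.
  rewrite (_ : K = r @^-1` [set 0%R])// -[X in measurable X]setTI.
  exact: mr.
have mKc : measurable (~` K) by exact: measurableC.
have rv y : (r y * v y = \1_(~` K) y)%R.
  rewrite indicE; have [Ky|Ky] := pselect (K y).
    by rewrite memNset ?Ky ?mul0r.
  by rewrite mem_set// divff//; exact/eqP.
have P0K : P0 K = 0.
  case: P0nu => _ _ ->//; apply: integral0_eq => y Ky; by rewrite Ky.
have intv B : measurable B ->
    \int[p0]_(z in b @^-1` B) (v (b z))%:E = nu (B `\` K).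
  move=> mB; rewrite -(integral_image_measure mb P0p0 mB mev)//.
  rewrite (integral_density P0nu mB mev)//.
  rewrite (eq_integral (fun y => (\1_(~` K) y)%:E)) => [|y _]; last first.
    by rewrite -EFinM mulrC rv.
  by rewrite integral_indic// setIC -setDE.
have [|q1 q1v] := @density_measure _ _ _ p0 (v \o b) mvb (fun z => v0 (b z)).
  have := intv setT measurableT; rewrite preimage_setT => ->.
  rewrite -ge0_fin_numE// fin_num_measure//; exact: measurableD.
have [q2 q2E] := finite_measure_restr q (mb1 _ mK).
have [q' q'E] := finite_measure_add q1 q2.
have p0N : p0 N = 0.
  rewrite p0E; apply: (@subset_measure0 _ _ _ p _ N) => //.
  by apply: measurableI => //; exact: mb1.
exists q'.
  split.
    rewrite q'E; case: (q1v) => _ _ -> //.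
    rewrite null_set_integral// ?add0e.
      by rewrite q2E; apply: (@subset_measure0 _ _ _ q _ N) => //;
        apply: measurableI => //; exact: mb1.
    exact/measurable_funTS/measurable_EFinP.
  move=> B mB; rewrite q'E; case: (q1v) => _ _ -> //; last exact: mb1.
  rewrite intv// q2E -preimage_setI qE; last exact: measurableI.
  rewrite -measureU.
  - by rewrite setUC setUIDK.
  - exact: measurableD.
  - exact: measurableI.
  - by rewrite setDE setIACA setICl setI0.
have rb0 z : (0 <= (r \o b) z)%R by exact: r0.
have merb : measurable_fun setT (EFin \o (r \o b)) by exact/measurable_EFinP.
split => //.
- exact: mb1.
- rewrite q'E; case: (q1v) => _ _ -> //; last exact: mb1.
  have p0S : p0 (b @^-1` S) = 0.
    by rewrite p0E -preimage_setI setICr preimage_set0 measure0.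
  have mw : measurable_fun (b @^-1` S) (EFin \o (v \o b)).
    exact/measurable_funTS/measurable_EFinP.
  rewrite (null_set_integral (mb1 _ mS) mw p0S) add0e.
  rewrite q2E -preimage_setI qE; last exact: measurableI.
  by apply: (@subset_measure0 _ _ _ nu _ S) => //; exact: measurableI.
move=> A mA.
rewrite (integral_add_measure q'E mA merb)//.
rewrite (integral_density q1v mA merb)//.
rewrite (integral_restr_measure (mb1 _ mK) q2E mA merb)//.
rewrite [X in _ + X](_ : _ = 0) ?adde0; last first.
  by apply: integral0_eq => z [_ Kz] /=; rewrite Kz.
rewrite (eq_integral (fun z => (\1_(~` (b @^-1` K)) z)%:E)) => [|z _]; last first.
  by rewrite -EFinM /= rv.
rewrite integral_indic//; last by apply: measurableC; exact: mb1.
rewrite setIC -setDE.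
have -> : p (A `\` b @^-1` S) = p0 A by rewrite p0E -preimage_setC setDE.
have p0K : p0 (b @^-1` K) = 0 by rewrite -P0p0.
rewrite -[in LHS](setUIDK A (b @^-1` K)) measureU.
- rewrite [X in X + _ = _](_ : _ = 0) ?add0e//.
  apply: (@subset_measure0 _ _ _ p0 _ (b @^-1` K)) => //.
  + by apply: measurableI => //; exact: mb1.
  + exact: mb1.
- by apply: measurableI => //; exact: mb1.
- by apply: measurableD => //; exact: mb1.
- by rewrite setDE setIACA setICr setI0.
Qed.

End proportional.

(** * Jensen's inequality with escaping mass *)

Section jensen.
Context (R : realType) (d : measure_display) (T : measurableType d).
Variables (lam : probability T R) (phi : R -> \bar R).
Hypotheses (pphi : eproper phi) (cphi : strictly_convex_on_dom phi).
Hypothesis phi0 : forall z, (0 <= z)%R -> 0 <= phi z.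
Variables (f : T -> R) (r s : R).
Hypotheses (mf : measurable_fun setT f) (f0 : forall x, (0 <= f x)%R).
Hypotheses (r0 : (0 <= r)%R) (s0 : (0 <= s)%R).
Hypothesis meanf : \int[lam]_x (f x)%:E = (r - s)%:E.

(** In a fibre [r] is the marginal density and [s] the share of it belonging to the part of [p]
    singular to [q]; that share costs the recession slope. *)
Local Notation J := (\int[lam]_x phi (f x) + minorant_slope phi * s%:E).

Let mphif : measurable_fun setT (phi \o f).
Proof. exact: measurable_entropy. Qed.

Let phif0 x : 0 <= phi (f x).
Proof. exact: phi0. Qed.

Let intf : lam.-integrable setT (EFin \o f).
Proof.
apply/integrableP; split; first exact/measurable_EFinP.
rewrite (eq_integral (EFin \o f)) => [|x _]; last by rewrite /= ger0_norm.
by rewrite meanf ltry.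
Qed.

Let int_cst (c : \bar R) : \int[lam]_x cst c x = c.
Proof.
rewrite integral_cst// [X in _ * X](_ : _ = 1) ?mule1//.
exact: (probability_setT lam).
Qed.

Lemma minorant_slope_ge0 : 0 <= minorant_slope phi.
Proof. by apply: minorant_slope_ub; exists 0%R => z z0; rewrite mul0r addr0 phi0. Qed.

(** Unless the domain has points on both sides of [r], the values of [f] stay almost everywhere on
    one side of it. If none is below, the mean [r - s] forces [s = 0] and [f = r]. If the domain has
    no point above [r], it is bounded, the slope is infinite, and finiteness of [J] gives [s = 0]
    again. *)
Lemma mean_dichotomy : J < +oo ->
  (s = 0%R /\ {ae lam, forall x, f x = r}) \/
  ((exists2 a, edom phi a & (a < r)%R) /\ (exists2 b, edom phi b & (r < b)%R)).
Proof.
move=> Joo.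
have Iphi : \int[lam]_x phi (f x) < +oo.
  apply: le_lt_trans Joo; rewrite leeDl//; apply: mule_ge0.
    exact: minorant_slope_ge0.
  by rewrite lee_fin.
have aeD : {ae lam, forall x, edom phi (f x)}.
  have : {ae lam, forall x, setT x -> phi (f x) \is a fin_num}.
    apply: integrable_ae => //; apply/integrableP; split => //.
    rewrite (eq_integral (phi \o f)) => [|x _]; last by rewrite /= gee0_abs.
    exact: Iphi.
  by apply: filterS => x /(_ I); rewrite fin_numElt => /andP[_ ?]; split.
have mean_const c : \int[lam]_x c%:E = c%:E by exact: int_cst.
have eq_of_le : (s = 0)%R ->
    {ae lam, forall x, (f x <= r)%R} \/ {ae lam, forall x, (r <= f x)%R} ->
    {ae lam, forall x, f x = r}.
  move=> s00 h.
  have : ae_eq lam setT (fun x => ((f x - r)%:E)) (cst 0).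
    apply/ae_eq_integral_abs => //.
      by apply/measurable_EFinP; apply: measurable_funB => //; exact: measurable_cst.
    have ir : lam.-integrable setT (EFin \o cst r).
      exact: finite_measure_integrable_cst.
    case: h => h.
    - rewrite (ae_eq_integral (fun x => (r%:E - (f x)%:E))) //.
      + rewrite (integralB measurableT ir intf).
        by rewrite mean_const meanf s00 subr0 -EFinB subrr.
      + apply/measurable_EFinP; apply: measurableT_comp => //.
        by apply: measurable_funB => //; exact: measurable_cst.
      + apply/measurable_EFinP; apply: measurable_funB => //; exact: measurable_cst.
      + apply: filterS h => x fr _; rewrite /= -EFinB; congr EFin.
        by rewrite ler0_norm ?opprB// subr_le0.
    - rewrite (ae_eq_integral (fun x => ((f x)%:E - r%:E))) //.
      + rewrite (integralB measurableT intf ir).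
        by rewrite mean_const meanf s00 subr0 -EFinB subrr.
      + apply/measurable_EFinP; apply: measurableT_comp => //.
        by apply: measurable_funB => //; exact: measurable_cst.
      + apply/measurable_EFinP; apply: measurable_funB => //; exact: measurable_cst.
      + apply: filterS h => x fr _; rewrite /= -EFinB; congr EFin.
        by rewrite ger0_norm// subr_ge0.
  apply: filterS => x /(_ I) [] /eqP; rewrite subr_eq0 => /eqP ->//.
have s_eq0_of_ae : {ae lam, forall x, (r <= f x)%R} -> s = 0%R.
  move=> h; apply/eqP; rewrite eq_le s0 andbT.
  have : \int[lam]_x r%:E <= \int[lam]_x (f x)%:E.
    apply: ae_ge0_le_integral => //.
    - by move=> x _; rewrite lee_fin.
    - exact/measurable_EFinP.
    - by apply: filterS h => x rf _; rewrite lee_fin.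
  by rewrite mean_const meanf lee_fin; lra.
have [[sE fr]|H] := pselect (s = 0%R /\ {ae lam, forall x, f x = r}); first by left.
right; split; apply: contrapT => /forall2NP h.
  have rf : {ae lam, forall x, (r <= f x)%R}.
    by apply: filterS aeD => x Dx; case: (h (f x)) => // /negP; rewrite -leNgt.
  apply: H; split; first exact: s_eq0_of_ae.
  by apply: eq_of_le; [exact: s_eq0_of_ae|right].
have fr : {ae lam, forall x, (f x <= r)%R}.
  by apply: filterS aeD => x Dx; case: (h (f x)) => // /negP; rewrite -leNgt.
have [s00|s00] := eqVneq s 0%R.
  by apply: H; split => //; apply: eq_of_le => //; left.
have s1 : (0 < s)%R by rewrite lt_neqAle eq_sym s00.
have loo : minorant_slope phi < +oo.
  rewrite ltNge leye_eq; apply/negP => /eqP loo.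
  move: Joo; rewrite loo gt0_mulye ?lte_fin// addey ?ltxx//.
  by rewrite gt_eqF// (lt_le_trans (ltNyr 0%R))// integral_ge0.
have [z Dz rz] := minorant_slope_unbounded pphi cphi loo r.
by case: (h z).
Qed.

(** Integrating the strict supporting line at [r] gains a positive amount unless [f = r] almost
    everywhere. Its slope [g] is at most the recession slope, which pays for [s]; and [f = r] forces
    [s = 0] through the mean. *)
Lemma jensen_gap : J < +oo ->
  (s = 0%R /\ {ae lam, forall x, f x = r}) \/ phi r < J.
Proof.
move=> Joo; have [|[[a Da ar] [b Db rb]]] := mean_dichotomy Joo; first by left.
have [|Hne] := pselect (s = 0%R /\ {ae lam, forall x, f x = r}); first by left.
right.
have Dr : edom phi r by apply: (dom_between cphi.1 Da Db); rewrite !ltW.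
have [||g Hg] := entropy_subgradient pphi cphi Dr; [by exists a|by exists b|].
have gl : g%:E <= minorant_slope phi.
  apply: minorant_slope_ub; exists (fine (phi r) - g * r)%R => w w0.
  have [->|wr] := eqVneq w r; first by rewrite subrK -edom_fineK.
  by apply: le_trans (ltW (Hg _ w0 wr)); rewrite lee_fin; lra.
have Iphi : \int[lam]_x phi (f x) < +oo.
  apply: le_lt_trans Joo; rewrite leeDl//; apply: mule_ge0.
    exact: minorant_slope_ge0.
  by rewrite lee_fin.
pose l x : R := (fine (phi r) + g * (f x - r))%R.
pose h x := phi (f x) - (l x)%:E.
have h0 x : 0 <= h x.
  rewrite /h sube_ge0//; have [fxr|fr] := eqVneq (f x) r.
    by rewrite /l fxr subrr mulr0 addr0 -edom_fineK.
  exact: ltW (Hg _ (f0 x) fr).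
have il : lam.-integrable setT (EFin \o l).
  rewrite (_ : EFin \o l = (EFin \o cst (fine (phi r) - g * r)%R) \+
    (fun x => g%:E * (EFin \o f) x)).
    apply: integrableD => //; first exact: finite_measure_integrable_cst.
    exact: integrableZl.
  by apply/funext => x /=; rewrite -EFinM -EFinD; congr EFin; rewrite /l; ring.
have lE : \int[lam]_x (l x)%:E = (fine (phi r) - g * s)%:E.
  rewrite (eq_integral (fun x => (cst (fine (phi r) - g * r)%:E x) +
      (g%:E * (EFin \o f) x))); last first.
    by move=> x _; rewrite /= -EFinM -EFinD; congr EFin; rewrite /l; ring.
  rewrite integralD//; [|exact: finite_measure_integrable_cst|exact: integrableZl].
  rewrite integralZl// int_cst meanf.
  by rewrite -EFinM -EFinD; congr EFin; ring.
have iphi : lam.-integrable setT (phi \o f).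
  apply/integrableP; split => //.
  rewrite (eq_integral (phi \o f)) => [|x _]; last by rewrite /= gee0_abs.
  exact: Iphi.
have mh : measurable_fun setT h.
  apply: emeasurable_funB => //; exact: measurable_int il.
have hE : \int[lam]_x h x = \int[lam]_x phi (f x) - (fine (phi r) - g * s)%:E.
  by rewrite -lE -integralB.
have hgt : 0 < \int[lam]_x h x.
  rewrite lt_neqAle integral_ge0// andbT; apply/negP => /eqP hz.
  have : ae_eq lam setT h (cst 0).
    apply/ae_eq_integral_abs => //.
    by rewrite (eq_integral h)// => x _; rewrite gee0_abs.
  move=> hae; have fr : {ae lam, forall x, f x = r}.
    apply: filterS hae => x /(_ I) hx; apply/eqP; apply: contraT => fr.
    move: hx => /= /eqP; rewrite /h gt_eqF// sube_gt0.
    exact: Hg.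
  apply: Hne; split => //.
  have : \int[lam]_x (f x)%:E = \int[lam]_x (cst r%:E) x.
    apply: ae_eq_integral => //; first exact/measurable_EFinP.
    by apply: filterS fr => x -> _.
  rewrite meanf int_cst => -[]; lra.
have Ifin : \int[lam]_x phi (f x) \is a fin_num.
  by rewrite ge0_fin_numE// integral_ge0.
rewrite hE sube_gt0 in hgt.
rewrite (edom_fineK pphi Dr).
apply: (@lt_le_trans _ _ (\int[lam]_x phi (f x) + g%:E * s%:E)).
  rewrite -(fineK Ifin) -EFinM -EFinD lte_fin; move: hgt.
  by rewrite -(fineK Ifin) lte_fin; lra.
by apply: leeD2l; apply: lee_wpmul2r => //; rewrite lee_fin.
Qed.

Lemma jensen_le : phi r <= J.
Proof.
have [Joo|] := ltP J +oo; last by rewrite leye_eq => /eqP ->; rewrite leey.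
have [[s00 fr]|/ltW//] := jensen_gap Joo.
rewrite s00 mule0 adde0.
rewrite (ae_eq_integral (cst (phi r))) //.
- by rewrite int_cst.
- by apply: filterS fr => x -> _.
Qed.

End jensen.

Section ae_comparison.
Context (R : realType) (d : measure_display) (T : measurableType d).

Lemma ae_le_of_le_integral (M : {finite_measure set T -> \bar R})
    (f g : T -> \bar R) :
  measurable_fun setT f -> measurable_fun setT g ->
  (forall x, 0 <= f x) -> (forall x, 0 <= g x) ->
  {ae M, forall x, f x <= g x} -> \int[M]_x g x <= \int[M]_x f x ->
  \int[M]_x f x < +oo -> {ae M, forall x, g x <= f x}.
Proof.
move=> mf mg f0 g0 fg gf foo; apply: ae_le_of_integral => // A mA.
have mAc : measurable (~` A) by exact: measurableC.
have split h : measurable_fun setT h -> (forall x, 0 <= h x) ->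
    \int[M]_x h x = \int[M]_(x in A) h x + \int[M]_(x in ~` A) h x.
  move=> mh h0; rewrite -ge0_integral_setU ?setUv//.
  by apply/disj_setPS; rewrite setICr.
have fgAc : \int[M]_(x in ~` A) f x <= \int[M]_(x in ~` A) g x.
  apply: ae_ge0_le_integral => //; try exact: measurable_funTS.
  by apply: filterS fg.
have foo' : \int[M]_(x in ~` A) f x \is a fin_num.
  rewrite ge0_fin_numE ?integral_ge0//; apply: le_lt_trans foo.
  by rewrite (split f)// leeDr// integral_ge0.
have goo' : \int[M]_(x in A) f x \is a fin_num.
  rewrite ge0_fin_numE ?integral_ge0//; apply: le_lt_trans foo.
  by rewrite (split f)// leeDl// integral_ge0.
rewrite -(leeD2rE _ _ foo') -(split f)//; apply: le_trans gf.
by rewrite (split g)// leeD2l.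
Qed.

End ae_comparison.

(** * Comparing a pair of plans with its marginals *)

Section divergence_of_marginals.
Context (R : realType) (dY dZ : measure_display).
Context (Y : measurableType dY) (Z : measurableType dZ).
Variables (b : Z -> Y) (mb : measurable_fun setT b).
Variables (nu P : {finite_measure set Y -> \bar R}).
Variables (p q : {finite_measure set Z -> \bar R}).
Hypothesis PE : forall B, measurable B -> P B = p (b @^-1` B).

Local Notation UR := (measurableTypeR R).
Local Notation lam := (uniform01 R).

Variables (h : Y * UR -> Z) (mh : measurable_fun setT h).
Hypothesis bh : forall w, b (h w) = w.1.
Hypothesis qE : forall C, measurable C -> q C = (nu \x lam) (h @^-1` C).

Variable phi : R -> \bar R.
Hypotheses (pphi : eproper phi) (cphi : strictly_convex_on_dom phi).
Hypothesis phi0 : forall z, (0 <= z)%R -> 0 <= phi z.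

Variables (r : Y -> R) (S : set Y) (rho : Z -> R) (S' : set Z).
Hypotheses (Pnu : density_off P nu r S) (pq : density_off p q rho S').

Let mr : measurable_fun setT r. Proof. by case: Pnu. Qed.
Let r0 y : (0 <= r y)%R. Proof. by case: Pnu. Qed.
Let mS : measurable S. Proof. by case: Pnu. Qed.
Let mrho : measurable_fun setT rho. Proof. by case: pq. Qed.
Let rho0 z : (0 <= rho z)%R. Proof. by case: pq. Qed.
Let mS' : measurable S'. Proof. by case: pq. Qed.

Let F w : R := rho (h w).
Let mF : measurable_fun setT F. Proof. exact: measurableT_comp. Qed.

Let mb1 B : measurable B -> measurable (b @^-1` B).
Proof. by move=> mB; rewrite -[X in measurable X]setTI; exact: mb. Qed.

Let F0 w : (0 <= F w)%R. Proof. exact: rho0. Qed.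

Let mFy y : measurable_fun setT (fun u => F (y, u)).
Proof. exact: measurableT_comp mF (measurable_pair1 y). Qed.

Let int_h (g : Z -> \bar R) D : measurable D -> measurable_fun setT g ->
  (forall z, 0 <= g z) ->
  \int[q]_(z in D) g z = \int[nu \x lam]_(w in h @^-1` D) g (h w).
Proof.
move=> mD mg g0; rewrite -[RHS](ge0_integral_pushforward mh)//.
- by apply: eq_measure_integral => A mA AS; exact: qE.
- exact: measurable_funTS.
Qed.

Let int_fiber (g : Z -> \bar R) B : measurable B -> measurable_fun setT g ->
  (forall z, 0 <= g z) ->
  \int[q]_(z in b @^-1` B) g z = \int[nu]_(y in B) \int[lam]_u g (h (y, u)).
Proof.
move=> mB mg g0; rewrite int_h//; last exact: mb1.
have mgh : measurable_fun setT (g \o h) by exact: measurableT_comp mg mh.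
have mhb : measurable (h @^-1` (b @^-1` B)).
  by rewrite -[X in measurable X]setTI; apply: mh => //; exact: mb1.
rewrite integral_mkcond fubini_tonelli1; last 2 first.
- apply/(measurable_restrictT _ mhb); exact: measurable_funTS.
- by move=> w; apply: erestrict_ge0 => w' _; exact: g0.
rewrite [RHS]integral_mkcond; apply: eq_integral => y _.
rewrite /fubini_F patchE; case: ifPn => yB.
  apply: eq_integral => u _; rewrite patchE mem_set//=.
  by rewrite bh/=; exact/set_mem.
apply: integral0_eq => u _; rewrite patchE memNset//= bh/=.
by move=> By; rewrite mem_set in yB.
Qed.

Let m := fun y => \int[lam]_u (F (y, u))%:E.

Let mm : measurable_fun setT m.
Proof.
apply: (@measurable_fun_fubini_tonelli_F _ _ _ _ _ lam (EFin \o F)).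
- exact/measurable_EFinP.
- by move=> w; rewrite lee_fin.
Qed.

Let m0 y : 0 <= m y.
Proof. by apply: integral_ge0 => u _; rewrite lee_fin. Qed.

Let mE B : measurable B ->
  \int[nu]_(y in B) m y = p (b @^-1` B `\` S').
Proof.
move=> mB; rewrite -(int_fiber (g := EFin \o rho))//.
- by case: pq => _ _ _ _ ->//; exact: mb1.
- exact/measurable_EFinP.
Qed.

(** Over a set off [S], [m] integrates to the mass of [p] off [S'], while [r] integrates to the
    whole mass of [p]. *)
Let m_le_r : {ae nu, forall y, m y <= (r y)%:E}.
Proof.
have mer : measurable_fun setT (EFin \o r) by exact/measurable_EFinP.
have er0 y : 0 <= (EFin \o r) y by rewrite lee_fin.
apply: (ae_le_of_integral mm mer m0 er0) => [B mB|].
- have [_ _ _ nuS PnuE] := Pnu.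
  rewrite -(integral_setD_null mB mS mm m0 nuS) -PnuE// PE; last exact: measurableD.
  rewrite mE; last exact: measurableD.
  apply: le_measure; rewrite ?inE.
  + by apply: measurableD => //; apply: mb1; exact: measurableD.
  + by apply: mb1; exact: measurableD.
  + exact: subDsetl.
- case: Pnu => _ _ _ _ <-//; rewrite -ge0_fin_numE// fin_num_measure//.
  exact: measurableD.
Qed.

(* The r-share of the part of p singular to q. *)
Let s y : R := Num.max 0%R (r y - fine (m y))%R.

Let s0 y : (0 <= s y)%R. Proof. by rewrite le_max lexx. Qed.

Let ms : measurable_fun setT s.
Proof.
apply: measurable_maxr; first exact: measurable_cst.
apply: measurable_funB => //.
by apply: measurableT_comp mm; exact: fine_measurable.
Qed.

Let sE : {ae nu, forall y, m y = (r y - s y)%:E}.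
Proof.
apply: filterS m_le_r => y my.
have mfin : m y \is a fin_num by rewrite ge0_fin_numE// (le_lt_trans my)// ltry.
rewrite /s max_r; last by rewrite subr_ge0 -lee_fin fineK.
by rewrite opprB addrC subrK fineK.
Qed.

(** The total mass of [p] counted through both decompositions: what is singular to [q] lies either
    over [S] or in the fibre defects [s]. *)
Let int_s : \int[nu]_y (s y)%:E + P S = p S'.
Proof.
have Ir : \int[nu]_y (r y)%:E = \int[nu]_y m y + \int[nu]_y (s y)%:E.
  rewrite -ge0_integralD//; last 2 first.
  - by move=> y _; rewrite lee_fin.
  - exact/measurable_EFinP.
  apply: ae_eq_integral => //.
  - exact/measurable_EFinP.
  - by apply: emeasurable_funD => //; exact/measurable_EFinP.
  - by apply: filterS sE => y -> _; rewrite -EFinD subrK.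
have PT : P setT = P (setT `\` S) + P S.
  rewrite -measureU ?setTD ?setvU ?setICl//; exact: measurableC.
have pT : p setT = p (setT `\` S') + p S'.
  rewrite -measureU ?setTD ?setvU ?setICl//; exact: measurableC.
have [_ _ _ _ PnuE] := Pnu.
have := PE measurableT; rewrite preimage_setT PT pT PnuE// Ir mE//.
rewrite preimage_setT -addeA => /addeIl -> //.
by apply: fin_num_measure; exact: measurableD.
Qed.

Let J y := \int[lam]_u phi (F (y, u)) + minorant_slope phi * (s y)%:E.

Let l0 : 0 <= minorant_slope phi. Proof. exact: minorant_slope_ge0. Qed.

Let mphiF : measurable_fun setT (phi \o F).
Proof. by apply: measurable_entropy => // w; exact: rho0. Qed.

Let mIphi : measurable_fun setT (fun y => \int[lam]_u phi (F (y, u))).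
Proof.
apply: (@measurable_fun_fubini_tonelli_F _ _ _ _ _ lam (phi \o F)) => //.
by move=> w; exact: phi0.
Qed.

Let mls : measurable_fun setT (fun y => minorant_slope phi * (s y)%:E).
Proof. by apply: measurable_funeM; exact/measurable_EFinP. Qed.

Let mJ : measurable_fun setT J.
Proof. exact: emeasurable_funD. Qed.

Let Iphi0 y : 0 <= \int[lam]_u phi (F (y, u)).
Proof. by apply: integral_ge0 => u _; exact: phi0. Qed.

Let J0 y : 0 <= J y.
Proof. by rewrite adde_ge0// mule_ge0// lee_fin. Qed.

Let phi_le_J : {ae nu, forall y, phi (r y) <= J y}.
Proof. by apply: filterS sE => y my; exact: jensen_le. Qed.

(** By [int_s] the recession term splits between the fibres and [S], so that Jensen can be applied
    in each fibre separately. *)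
Let VJ : \int[q]_z phi (rho z) + minorant_slope phi * p S' =
  \int[nu]_y J y + minorant_slope phi * P S.
Proof.
rewrite ge0_integralD//; last by move=> y _; rewrite mule_ge0// lee_fin.
rewrite ge0_integralZl//; last 2 first.
- exact/measurable_EFinP.
- by move=> y _; rewrite lee_fin.
rewrite -addeA -ge0_muleDr//; last by apply: integral_ge0 => y _; rewrite lee_fin.
rewrite int_s; congr (_ + _).
rewrite -(preimage_setT b) (int_fiber (g := phi \o rho))//.
- exact: measurable_entropy.
- by move=> z; exact: phi0.
Qed.

Let mphir : measurable_fun setT (phi \o r).
Proof. exact: measurable_entropy. Qed.

Lemma divergence_marginals_le :
  \int[nu]_y phi (r y) + minorant_slope phi * P S <=
  \int[q]_z phi (rho z) + minorant_slope phi * p S'.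
Proof.
rewrite VJ leeD2r//; apply: ae_ge0_le_integral => //.
- by move=> y _; exact: phi0.
- by apply: filterS phi_le_J.
Qed.

(** Equal finite integrals force equality in Jensen on almost every fibre, where [jensen_gap] leaves
    only [F (y, u) = r y] for almost all [u]; Tonelli collects these null fibres. *)
Lemma divergence_marginals_eq :
  \int[q]_z phi (rho z) + minorant_slope phi * p S' <=
    \int[nu]_y phi (r y) + minorant_slope phi * P S ->
  \int[nu]_y phi (r y) + minorant_slope phi * P S < +oo ->
  q [set z | rho z != r (b z)] = 0.
Proof.
move=> Vle Voo.
have I0 : 0 <= \int[nu]_y phi (r y) by apply: integral_ge0 => y _; exact: phi0.
have lP0 : 0 <= minorant_slope phi * P S by rewrite mule_ge0.
have lPfin : minorant_slope phi * P S \is a fin_num.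
  by rewrite ge0_fin_numE//; apply: le_lt_trans Voo; rewrite leeDr.
have Ioo : \int[nu]_y phi (r y) < +oo.
  by apply: le_lt_trans Voo; rewrite leeDl.
rewrite VJ leeD2rE// in Vle.
have Jle : {ae nu, forall y, J y <= phi (r y)}.
  by apply: ae_le_of_le_integral => // y; exact: phi0.
have phifin : {ae nu, forall y, phi (r y) < +oo}.
  have : {ae nu, forall y, setT y -> phi (r y) \is a fin_num}.
    apply: integrable_ae => //; apply/integrableP; split => //.
    by rewrite (eq_integral (phi \o r))// => y _; rewrite gee0_abs// phi0.
  by apply: filterS => y /(_ I); rewrite fin_numElt => /andP[].
have mne : measurable [set z | rho z != r (b z)].
  rewrite (_ : [set z | _] = ~` [set z | (rho z == r (b z)) = true]); last first.
    by apply/seteqP; split => z /= => [/negbTE -> //|]; case: eqP.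
  have mrb : measurable_fun setT (r \o b) by exact: measurableT_comp mr mb.
  apply: measurableC; rewrite -[X in measurable X]setTI.
  have me := measurable_fun_eqr mrho mrb.
  exact: (me measurableT [set true]).
rewrite qE// /product_measure1.
have mhne : measurable (h @^-1` [set z | rho z != r (b z)]).
  by rewrite -[X in measurable X]setTI; exact: mh.
have -> : \int[nu]_y (lam \o xsection (h @^-1` [set z | rho z != r (b z)])) y =
    \int[nu]_y cst 0 y.
  apply: ae_eq_integral => //; first exact: measurable_fun_xsection.
  apply: filterS3 sE Jle phifin => y my Jy phiy _ /=.
  have Joo : J y < +oo by exact: le_lt_trans phiy.
  have [[_ Fr]|] := jensen_gap pphi cphi phi0 (mFy y) (fun u => rho0 _) (r0 y)
    (s0 y) my Joo; last by rewrite ltNge Jy.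
  have mx := measurable_xsection y mhne.
  apply: (measure_negligible mx); apply: negligibleS Fr => u.
  by rewrite /xsection/= inE/= bh/= => /eqP.
by rewrite integral0.
Qed.

End divergence_of_marginals.

(** * Level-optimality of minimizers *)

(** Below [t'] a density only gains, by at most [eps t]; from [t] upwards it only loses, at most the
    fraction [eps]; in between nothing changes. The two bounds on [eps] prevent either movement from
    crossing [tm]. *)
Lemma reroute_between (R : realType) (t t' tm eps k s x : R) :
  (0 < t)%R -> (0 < eps < 1)%R -> (t' + eps * t <= tm)%R -> (tm <= (1 - eps) * t)%R ->
  (0 <= k <= 1)%R -> (0 <= s <= t)%R -> (0 <= x)%R ->
  ((x < t')%R -> k = 0%R) -> (~~ (x < t')%R -> s = 0%R) ->
  ((t' <= x < t)%R -> k = 0%R) ->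
  let y := ((1 - eps * k) * x + eps * s)%R in
  (x <= y <= tm)%R || (tm <= y <= x)%R \/ y = x.
Proof.
move=> t0 /andP[ep0 ep1] e1 e2 /andP[k0 k1] /andP[s0 st] x0 kL sL kM /=.
have [xt'|t'x] := ltP x t'.
  left; rewrite (kL xt') mulr0 subr0 mul1r.
  have h1 : (0 <= eps * s)%R by rewrite mulr_ge0// ltW.
  have h2 : (eps * s <= eps * t)%R by rewrite ler_wpM2l// ltW.
  by apply/orP; left; apply/andP; split; lra.
have s00 : s = 0%R by apply: sL; rewrite -leNgt.
rewrite s00 mulr0 addr0.
have [tx|xt] := leP t x; last first.
  by right; rewrite kM ?t'x//; ring.
left; apply/orP; right.
have h1 : (eps * k <= eps)%R by rewrite -[leRHS]mulr1 ler_wpM2l// ltW.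
have h2 : (0 <= eps * k)%R by rewrite mulr_ge0// ltW.
have h3 : (eps * k * x <= eps * x)%R by rewrite ler_wpM2r.
have h4 : (0 <= eps * k * x)%R by rewrite mulr_ge0.
have h5 : ((1 - eps) * t <= (1 - eps) * x)%R by rewrite ler_wpM2l// subr_ge0 ltW.
by apply/andP; split; lra.
Qed.

Section maximin.
Context (R : realType) (dX dY dZ : measure_display).
Context (X : measurableType dX) (Y : measurableType dY) (Z : measurableType dZ).
Variables (a : Z -> X) (b : Z -> Y) (N : set Z).
Hypotheses (ma : measurable_fun setT a) (mb : measurable_fun setT b).
Hypothesis mN : measurable N.
Variables (mu : {finite_measure set X -> \bar R}).
Variables (nu P : {finite_measure set Y -> \bar R}).
Variables (p : {finite_measure set Z -> \bar R}).
Hypothesis mup : plan_of N a mu p.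
Hypothesis PE : forall B, measurable B -> P B = p (b @^-1` B).
Variables (r : Y -> R) (S : set Y).
Hypothesis Pnu : density_off P nu r S.

Definition feasible (t : R) (sigma : {finite_measure set Z -> \bar R}) : Prop :=
  [/\ sigma N = 0, forall A, measurable A -> sigma (a @^-1` A) <= mu A &
      forall B, measurable B -> sigma (b @^-1` B) <= t%:E * nu B].

Let mr : measurable_fun setT r. Proof. by case: Pnu. Qed.
Let r0 y : (0 <= r y)%R. Proof. by case: Pnu. Qed.
Let mS : measurable S. Proof. by case: Pnu. Qed.
Let nuS : nu S = 0. Proof. by case: Pnu. Qed.
Let PnuE A : measurable A -> P (A `\` S) = \int[nu]_(y in A) (r y)%:E.
Proof. by case: Pnu => _ _ _ _; exact. Qed.

Let ma1 A : measurable A -> measurable (a @^-1` A).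
Proof. by move=> mA; rewrite -[X in measurable X]setTI; exact: ma. Qed.
Let mb1 B : measurable B -> measurable (b @^-1` B).
Proof. by move=> mB; rewrite -[X in measurable X]setTI; exact: mb. Qed.

(** Off [S], [p] is scaled over [y] by [min (r y, t) / r y]. The factor is at most 1, so the mass
    leaving each part of [X] stays below [mu]. *)
Lemma feasible_truncation (t : R) : (0 < t)%R ->
  exists2 sigma, feasible t sigma &
    sigma setT = \int[nu]_y (Num.min (r y) t)%:E.
Proof.
move=> t0; have mSc : measurable (~` S) by exact: measurableC.
have [p0 p0E] := finite_measure_restr p (mb1 mSc).
have [P0 P0E] := finite_measure_restr P mSc.
have P0p0 B : measurable B -> P0 B = p0 (b @^-1` B).
  by move=> mB; rewrite P0E p0E PE//; exact: measurableI.
have P0nu : has_density P0 nu r.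
  by split => // B mB; rewrite P0E -setDE PnuE.
pose v y : R := (Num.min (r y) t * (r y)^-1)%R.
have min0 y : (0 <= Num.min (r y) t)%R by rewrite le_min r0 ltW.
have v0 y : (0 <= v y)%R by rewrite mulr_ge0// invr_ge0.
have v1 y : (v y <= 1)%R.
  rewrite /v; have [->|ry] := eqVneq (r y) 0%R; first by rewrite invr0 mulr0.
  by rewrite ler_pdivrMr ?mul1r ?ge_min ?lexx// lt_neqAle eq_sym ry r0.
have vr y : (v y * r y = Num.min (r y) t)%R.
  rewrite /v; have [ry|ry] := eqVneq (r y) 0%R; last by rewrite divfK.
  by rewrite ry mulr0 min_l// ltW.
have mmin : measurable_fun setT (fun y => Num.min (r y) t).
  by apply: measurable_minr.
have mv : measurable_fun setT v.
  by apply: measurable_funM => //; exact: measurable_fun_inv.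
have mvb : measurable_fun setT (v \o b) by exact: measurableT_comp.
have mev : measurable_fun setT (EFin \o v) by exact/measurable_EFinP.
have intv B : measurable B ->
    \int[p0]_(z in b @^-1` B) (v (b z))%:E = \int[nu]_(y in B) (Num.min (r y) t)%:E.
  move=> mB; rewrite -(integral_image_measure mb P0p0 mB mev)//.
  rewrite (integral_density P0nu mB mev)//.
  by apply: eq_integral => y _; rewrite -EFinM vr.
have le_t B : measurable B ->
    \int[nu]_(y in B) (Num.min (r y) t)%:E <= t%:E * nu B.
  move=> mB; rewrite -integral_cst//; apply: ge0_le_integral => //.
  - by move=> y _; rewrite lee_fin.
  - exact/measurable_funTS/measurable_EFinP.
  - by move=> y _; rewrite lee_fin ge_min lexx orbT.
have [|sg sgE] := @density_measure _ _ _ p0 (v \o b) mvb (fun z => v0 (b z)).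
  have := intv setT measurableT; rewrite preimage_setT => ->.
  apply: le_lt_trans (le_t _ measurableT) _.
  by rewrite -(fineK (fin_num_measure nu _ measurableT)) -EFinM ltry.
have sgB B : measurable B -> sg (b @^-1` B) = \int[nu]_(y in B) (Num.min (r y) t)%:E.
  by move=> mB; case: (sgE) => _ _ ->; [exact: intv|exact: mb1].
have sgp C : measurable C -> sg C <= p C.
  move=> mC; case: (sgE) => _ _ ->//.
  apply: (@le_trans _ _ (\int[p0]_(z in C) cst 1 z)).
    apply: ge0_le_integral => //.
    - by move=> z _; rewrite lee_fin v0.
    - exact/measurable_funTS/measurable_EFinP.
    - by move=> z _; rewrite lee_fin v1.
  rewrite integral_cst// mul1e.
  change (p0 C <= p C); rewrite p0E; apply: le_measure; rewrite ?inE//.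
    by apply: measurableI => //; exact: mb1.
have [pN pA] := mup.
exists sg; last by rewrite -(preimage_setT b) sgB.
split.
- by apply/eqP; rewrite eq_le measure_ge0 andbT -[leRHS]pN sgp.
- by move=> A mA; rewrite -pA// sgp//; exact: ma1.
- by move=> B mB; rewrite sgB// le_t.
Qed.

Variable phi : R -> \bar R.
Hypotheses (pphi : eproper phi) (cphi : strictly_convex_on_dom phi).
Hypothesis phi0 : forall z, (0 <= z)%R -> 0 <= phi z.
Hypothesis Voo : \int[nu]_y phi (r y) + minorant_slope phi * P S < +oo.
Hypothesis Vmin : forall (p' : {finite_measure set Z -> \bar R})
  (P' : {finite_measure set Y -> \bar R}) (r' : Y -> R) S', plan_of N a mu p' ->
  (forall B, measurable B -> P' B = p' (b @^-1` B)) ->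
  density_off P' nu r' S' ->
  \int[nu]_y phi (r y) + minorant_slope phi * P S <=
  \int[nu]_y phi (r' y) + minorant_slope phi * P' S'.

Section exchange.
Variables (t t' : R) (sigma : {finite_measure set Z -> \bar R}).
Hypotheses (t0 : (0 < t)%R) (tt' : (t' < t)%R) (feas_sigma : feasible t sigma).

(** The set [S], which carries the singular part of [P], counts as density infinity: it is removed
    from the low set and added to the high one. *)
Let L := [set y | (r y < t')%R] `\` S.
Let H := [set y | (t <= r y)%R] `|` S.

Let mL : measurable L.
Proof.
apply: measurableD => //; rewrite -[X in measurable X]setTI.
exact: measurable_fun_ltr.
Qed.

Let mH : measurable H.
Proof.
apply: measurableU => //; rewrite -[X in measurable X]setTI.
exact: measurable_fun_ler.
Qed.

Variables (pH sL : {finite_measure set Z -> \bar R}) (al h : X -> R).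
Hypothesis pHE : forall C, pH C = p (C `&` b @^-1` H).
Hypothesis sLE : forall C, sL C = sigma (C `&` b @^-1` L).
Hypotheses (mal : measurable_fun setT al) (al01 : forall x, (0 <= al x <= 1)%R).
Hypotheses (mh : measurable_fun setT h) (h01 : forall x, (0 <= h x <= 1)%R).
Hypothesis alE : forall A, measurable A -> pH (a @^-1` A) = \int[mu]_(x in A) (al x)%:E.
Hypothesis hE : forall A, measurable A -> sL (a @^-1` A) = \int[mu]_(x in A) (h x)%:E.

(* A fraction eps of the mass that p sends into H from the points served by
   sigma in L is rerouted along sigma. *)
Lemma exchange_density : exists (k s : Y -> R),
  [/\ measurable_fun setT k, measurable_fun setT s,
      forall y, (0 <= k y <= 1)%R /\ (~ H y -> k y = 0%R),
      forall y, (0 <= s y <= t)%R /\ (~ L y -> s y = 0%R) &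
      \int[nu]_y (s y)%:E = \int[mu]_x (al x * h x)%:E /\
      forall eps : R, (0 < eps < 1)%R ->
      exists (p' : {finite_measure set Z -> \bar R})
             (P' : {finite_measure set Y -> \bar R}),
        [/\ plan_of N a mu p', forall B, measurable B -> P' B = p' (b @^-1` B),
            density_off P' nu (fun y => (1 - eps * k y) * r y + eps * s y)%R S &
            P' S = \int[P]_(y in S) (1 - eps * k y)%:E]].
Proof.
have [sN sA sB] := feas_sigma.
have h0 x : (0 <= h x)%R by case/andP: (h01 x).
have h1 x : (h x <= 1)%R by case/andP: (h01 x).
have al0 x : (0 <= al x)%R by case/andP: (al01 x).
have al1 x : (al x <= 1)%R by case/andP: (al01 x).
have mha : measurable_fun setT (h \o a) by exact: measurableT_comp.
have mala : measurable_fun setT (al \o a) by exact: measurableT_comp.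
have meh : measurable_fun setT (EFin \o h) by exact/measurable_EFinP.
have meal : measurable_fun setT (EFin \o al) by exact/measurable_EFinP.
have le_meas (Q : {finite_measure set Z -> \bar R}) (w : Z -> R) C :
    measurable_fun setT w -> (forall z, 0 <= w z <= 1)%R -> measurable C ->
    \int[Q]_(z in C) (w z)%:E <= Q C.
  move=> mw w01 mC; rewrite -[leRHS]mul1e -integral_cst//.
  apply: ge0_le_integral => //.
  - by move=> z _; rewrite lee_fin; case/andP: (w01 z).
  - exact/measurable_funTS/measurable_EFinP.
  - by move=> z _; rewrite lee_fin; case/andP: (w01 z).
have dens_meas (Q : {finite_measure set Z -> \bar R}) (w : Z -> R) :
    measurable_fun setT w -> (forall z, 0 <= w z <= 1)%R ->
    exists M : {finite_measure set Z -> \bar R}, has_density M Q w.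
  move=> mw w01; apply: density_measure => //.
    by move=> z; case/andP: (w01 z).
  apply: le_lt_trans (le_meas _ _ _ mw w01 measurableT) _.
  by rewrite -ge0_fin_numE// fin_num_measure.
(* The weights are crossed: [pH] has [X]-density [al] and is weighted by [h], [sL] has [X]-density
   [h] and is weighted by [al]. Both results have [X]-density [al h], so exchanging them preserves
   the [X]-marginal. *)
have [M1 [_ _ M1E]] := dens_meas pH (h \o a) mha (fun z => h01 (a z)).
have [M2 [_ _ M2E]] := dens_meas sL (al \o a) mala (fun z => al01 (a z)).
have M1le C : measurable C -> M1 C <= p (C `&` b @^-1` H).
  by move=> mC; rewrite M1E// -pHE; apply: le_meas => // z; exact: h01.
have M2le C : measurable C -> M2 C <= sigma (C `&` b @^-1` L).
  by move=> mC; rewrite M2E// -sLE; apply: le_meas => // z; exact: al01.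
have [B1 B1E] := finite_pushforward M1 mb.
have [B2 B2E] := finite_pushforward M2 mb.
(* Feasibility bounds the [Y]-marginal of [M2] by [t nu]; a density with respect to this measure,
   bounded by 1, yields [s <= t] at every point. *)
have [tnu tnuE] : exists tnu : {finite_measure set Y -> \bar R}, has_density tnu nu (cst t).
  apply: density_measure => //; first by move=> y; exact: ltW.
  rewrite [ltLHS](integral_cst nu measurableT t%:E).
  by rewrite ltey_eq fin_numM//; exact: fin_num_measure.
have tnuB B : measurable B -> tnu B = t%:E * nu B.
  by move=> mB; case: (tnuE) => _ _ ->//; exact: (integral_cst nu mB t%:E).
have mHc : measurable (~` H) by exact: measurableC.
have mLc : measurable (~` L) by exact: measurableC.
have [k0 B1k0 k01] : exists2 k0, has_density B1 P k0 & forall y, (k0 y <= 1)%R.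
  apply: dominated_density => B mB; rewrite B1E PE//.
  apply: le_trans (M1le _ (mb1 mB)) _; apply: le_measure; rewrite ?inE//.
  - by apply: measurableI; exact: mb1.
  - exact: mb1.
have [s0 B2s0 s01] : exists2 s0, has_density B2 tnu s0 & forall y, (s0 y <= 1)%R.
  apply: dominated_density => B mB; rewrite B2E tnuB//.
  apply: le_trans (M2le _ (mb1 mB)) (le_trans _ (sB _ mB)).
  apply: le_measure; rewrite ?inE//.
  - by apply: measurableI; exact: mb1.
  - exact: mb1.
have B1H : B1 (~` H) = 0.
  apply/eqP; rewrite eq_le measure_ge0 andbT B1E.
  apply: le_trans (M1le _ (mb1 mHc)) _.
  by rewrite -preimage_setI setICl preimage_set0 measure0.
have B2L : B2 (~` L) = 0.
  apply/eqP; rewrite eq_le measure_ge0 andbT B2E.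
  apply: le_trans (M2le _ (mb1 mLc)) _.
  by rewrite -preimage_setI setICl preimage_set0 measure0.
have [mk k_ge0 B1k] := has_density_indic B1k0 mH B1H.
have [ms1 s1_ge0 B2s1] := has_density_indic B2s0 mL B2L.
pose k y : R := (k0 y * \1_H y)%R.
pose s y : R := (s0 y * \1_L y * t)%R.
have ind1 (A : set Y) y : ((\1_A y : R) <= 1)%R by rewrite indicE; case: (_ \in _).
have ms : measurable_fun setT s by exact: measurable_funM.
have mes1 : measurable_fun setT (fun y => (s0 y * \1_L y)%:E) by exact/measurable_EFinP.
have k_le1 y : (k y <= 1)%R.
  by apply: mulr_ile1 => //; case: B1k0 => _ ? _.
have s1_le1 y : (s0 y * \1_L y <= 1)%R.
  by apply: mulr_ile1 => //; case: B2s0 => _ ? _.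
have s_ge0 y : (0 <= s y)%R by rewrite mulr_ge0// ltW.
have B2s B : measurable B -> B2 B = \int[nu]_(y in B) (s y)%:E.
  move=> mB; rewrite B2s1// (integral_density tnuE mB mes1)//.
  all: try by move=> y; rewrite lee_fin.
have mes : measurable_fun setT (EFin \o s) by exact/measurable_EFinP.
have mek : measurable_fun setT (EFin \o k) by exact/measurable_EFinP.
(* Both sides move the mass \int al h dmu over each piece of X. *)
have swap A : measurable A -> M1 (a @^-1` A) = M2 (a @^-1` A).
  move=> mA; have maA := ma1 mA.
  have [aH aHE] := finite_pushforward pH ma.
  have [aL aLE] := finite_pushforward sL ma.
  have aHd : has_density aH mu al by split => // B mB; rewrite aHE alE.
  have aLd : has_density aL mu h by split => // B mB; rewrite aLE hE.
  rewrite M1E// M2E//.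
  rewrite -(integral_image_measure ma (fun B _ => aHE B) mA meh)//.
  rewrite -(integral_image_measure ma (fun B _ => aLE B) mA meal)//.
  rewrite (integral_density aHd mA meh)//.
  rewrite (integral_density aLd mA meal)//.
  by apply: eq_integral => x _; rewrite muleC.
exists k, s; split => //.
- move=> y; rewrite k_ge0 k_le1; split => // Hy.
  by rewrite /k indicE memNset// mulr0.
- move=> y; rewrite s_ge0/=; split.
    by rewrite /s -[leRHS]mul1r ler_wpM2r// ltW.
  by move=> Ly; rewrite /s indicE memNset// mulr0 mul0r.
split.
  rewrite -B2s// B2E preimage_setT M2E//.
  have [aL aLE] := finite_pushforward sL ma.
  have aLd : has_density aL mu h by split => // B mB; rewrite aLE hE.
  rewrite -(preimage_setT a).
  rewrite -(integral_image_measure ma (fun B _ => aLE B) measurableT meal)//.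
  by rewrite (integral_density aLd measurableT meal).
move=> eps /andP[eps0 eps1].
(* The new plan is [p - eps M1 + eps M2], assembled from three nonnegative pieces: [p] off [H],
   [pH - eps M1] and [eps M2]. *)
have [pHc pHcE] := finite_measure_restr p (mb1 mHc).
have [w1 [_ _ w1E]] : exists M : {finite_measure set Z -> \bar R},
    has_density M pH (fun z => 1 - eps * h (a z))%R.
  apply: dens_meas; first by apply: measurable_funB => //; exact: measurable_funM.
  by move=> z; rewrite subr_ge0 mulr_ile1 ?(ltW eps0) ?(ltW eps1)//= gerBl mulr_ge0 ?(ltW eps0).
have [w2 [_ _ w2E]] : exists M : {finite_measure set Z -> \bar R},
    has_density M sL (fun z => eps * al (a z))%R.
  apply: dens_meas; first exact: measurable_funM.
  by move=> z; rewrite mulr_ge0 ?(ltW eps0)//= mulr_ile1 ?(ltW eps0) ?(ltW eps1).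
have [w12 w12E] := finite_measure_add w1 w2.
have [p' p'E] := finite_measure_add pHc w12.
have w1M C : measurable C -> w1 C + eps%:E * M1 C = pH C.
  move=> mC; rewrite w1E// M1E//; apply: (integral_onem_scale _ mha _ (ltW eps0)) => // z.
    exact: h0.
  by rewrite mulr_ile1 ?(ltW eps0) ?(ltW eps1)//=.
have w2M C : measurable C -> w2 C = eps%:E * M2 C.
  move=> mC; rewrite w2E// M2E//; apply: (integral_scale _ mala _ (ltW eps0)) => // z.
  exact: al0.
have fin_e (Q : {finite_measure set Z -> \bar R}) C :
    measurable C -> eps%:E * Q C \is a fin_num.
  by move=> mC; rewrite fin_numM// fin_num_measure.
have p'M C : measurable C -> p' C + eps%:E * M1 C = p C + eps%:E * M2 C.
  move=> mC; rewrite p'E w12E w2M// -addeA -[_ + _ + eps%:E * M1 C]addeAC w1M//.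
  rewrite addeA; congr (_ + _); rewrite pHcE pHE -preimage_setC -setDE addeC -measureU.
  - by rewrite setUIDK.
  - by apply: measurableI => //; exact: mb1.
  - by apply: measurableD => //; exact: mb1.
  - by rewrite setDE setIACA setICr setI0.
have [P' P'E] := finite_pushforward p' mb.
have planp' : plan_of N a mu p'.
  have [pN pA] := mup; split.
    apply/eqP; rewrite eq_le measure_ge0 andbT.
    have M2N : M2 N = 0.
      apply/eqP; rewrite eq_le measure_ge0 andbT.
      apply: le_trans (M2le _ mN) _; rewrite -[leRHS]sN; apply: le_measure; rewrite ?inE//.
      by apply: measurableI => //; exact: mb1.
    have := p'M _ mN; rewrite pN M2N mule0 adde0 => <-.
    by rewrite leeDl// mule_ge0// lee_fin ltW.
  move=> A mA; have maA := ma1 mA; have := p'M _ maA; rewrite -swap// pA//.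
  by rewrite ![_ + eps%:E * _]addeC => /addeIl; apply; exact: fin_e.
have mkS : measurable_fun setT (fun y => (1 - eps * k y)%R).
  by apply: measurable_funB => //; exact: measurable_funM.
have epsk y : (0 <= 1 - eps * k y)%R.
  by rewrite subr_ge0 mulr_ile1 ?(ltW eps0) ?(ltW eps1)//; exact: k_ge0.
have mekS : measurable_fun setT (fun y => (1 - eps * k y)%:E) by exact/measurable_EFinP.
have P'B B : measurable B -> P' B =
    \int[P]_(y in B) (1 - eps * k y)%:E + eps%:E * \int[nu]_(y in B) (s y)%:E.
  move=> mB; have mbB := mb1 mB.
  have PB : \int[P]_(y in B) (1 - eps * k y)%:E + eps%:E * B1 B = P B.
    rewrite B1k//; apply: (integral_onem_scale _ mk k_ge0 (ltW eps0)) => // y.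
    by apply: mulr_ile1; rewrite ?(ltW eps0) ?(ltW eps1) ?k_ge0 ?k_le1.
  have := p'M _ mbB; rewrite -PE// -PB -B1E -B2E -P'E B2s//.
  rewrite [X in _ = X]addeAC ![_ + eps%:E * B1 B]addeC => /addeIl; apply.
  by rewrite fin_numM// fin_num_measure.
exists p', P'; split => //.
  split => //.
  - by apply: measurable_funD; [apply: measurable_funM|exact: measurable_funM].
  - by move=> y; rewrite addr_ge0// mulr_ge0// ltW.
  - move=> A mA; have mAS : measurable (A `\` S) by exact: measurableD.
    rewrite P'B// (integral_density_off Pnu mA mekS)//.
    rewrite (integral_setD_null mA mS mes)// -ge0_integralZl//; last 3 first.
    + exact: measurable_funTS.
    + by move=> y _; rewrite lee_fin.
    + by rewrite lee_fin ltW.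
    rewrite -ge0_integralD//.
    + by move=> y _; rewrite -EFinM lee_fin mulr_ge0.
    + by apply/measurable_funTS/measurable_EFinP; apply: measurable_funM.
    + by move=> y _; rewrite -EFinM lee_fin mulr_ge0// ltW.
    + by apply/measurable_funTS/measurable_EFinP; apply: measurable_funM.
rewrite P'B// [X in _ + eps%:E * X](_ : _ = 0) ?mule0 ?adde0//.
by apply: null_set_integral => //; exact: measurable_funTS.
Qed.

(** Densities move towards [tm], so by [subgradient_between] the function [gap] is nonnegative, and
    positive where the density changes. Its integral is at most [(g - minorant_slope phi)] times the
    singular mass lost, by minimality and conservation of mass, hence at most 0. So no density
    changes, and [s] vanishes. *)
Lemma exchange_null : \int[mu]_x (al x * h x)%:E = 0.
Proof.
have [k [s [mk ms kP sP [sE Hex]]]] := exchange_density.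
have k0 y : (0 <= k y)%R by case: (kP y) => /andP[].
have s0 y : (0 <= s y)%R by case: (sP y) => /andP[].
pose tm := ((t' + t) / 2)%R.
have [t'm tmt] : (t' < tm)%R /\ (tm < t)%R.
  by have lt := tt'; rewrite /tm; split; lra.
have Iphi0 (r' : Y -> R) : (forall y, 0 <= r' y)%R -> 0 <= \int[nu]_y phi (r' y).
  by move=> r'0; apply: integral_ge0 => y _; exact: phi0.
have l0 : 0 <= minorant_slope phi by exact: minorant_slope_ge0.
have Ioo : \int[nu]_y phi (r y) < +oo.
  by apply: le_lt_trans Voo; rewrite leeDl// mule_ge0.
have Ifin : \int[nu]_y phi (r y) \is a fin_num by rewrite ge0_fin_numE// Iphi0.
have mphir : measurable_fun setT (phi \o r) by exact: measurable_entropy.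
have aeD : {ae nu, forall y, edom phi (r y)}.
  have : {ae nu, forall y, setT y -> phi (r y) \is a fin_num}.
    apply: integrable_ae => //; apply/integrableP; split => //.
    by rewrite (eq_integral (phi \o r))// => y _; rewrite /= gee0_abs// phi0.
  by apply: filterS => y /(_ I); rewrite fin_numElt => /andP[_ ?]; split.
have aeS : {ae nu, forall y, ~ S y}.
  by exists S; split => // y /= /contrapT.
have mes : measurable_fun setT (EFin \o s) by exact/measurable_EFinP.
have s_zero : {ae nu, forall y, s y = 0%R} -> \int[mu]_x (al x * h x)%:E = 0.
  move=> sz; rewrite -sE (ae_eq_integral (cst 0))//; first by rewrite integral0.
  by apply: filterS sz => y -> _.
(* Without domain points below [tm], [r] stays above [t'] almost everywhere, so [L] is null and [s]
   vanishes. *)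
have [[a0 Da0 a0t]|] := pselect (exists2 a, edom phi a & (a < tm)%R); last first.
  move=> /forall2NP h0; apply: s_zero; apply: filterS aeD => y Dy.
  apply: (sP y).2 => -[/= rt _]; case: (h0 (r y)) => //; apply.
  exact: lt_trans t'm.
have [eps [ep01 e1 e2]] : exists eps : R,
    [/\ (0 < eps < 1)%R, (t' + eps * t <= tm)%R & (tm <= (1 - eps) * t)%R].
  (* The second term makes [eps t] at most the distance from [tm] to [t'] and to [t]; the first
     keeps [eps] below 1, as [t'] may be negative. *)
  exists (Num.min (1 / 2) ((t - t') / (2 * t)))%R.
  set eps := Num.min _ _.
  have h1 : (eps <= 1 / 2)%R by rewrite /eps ge_min lexx.
  have h2 : (eps <= (t - t') / (2 * t))%R by rewrite /eps ge_min lexx orbT.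
  have h3 : (0 < eps)%R.
    rewrite /eps lt_min; apply/andP; split; first by lra.
    by rewrite divr_gt0 ?mulr_gt0// subr_gt0.
  have h4 : (eps * t <= (t - t') / 2)%R.
    apply: (@le_trans _ _ ((t - t') / (2 * t) * t)%R); first by rewrite ler_wpM2r// ltW.
    rewrite le_eqVlt; apply/orP; left; apply/eqP; field; exact: lt0r_neq0.
  split; first by rewrite h3; lra.
    by rewrite /tm; lra.
  by rewrite /tm; lra.
have [ep0 ep1] := andP ep01.
have [p' [P' [planp' P'E P'nu P'S]]] := Hex eps ep01.
pose re y := ((1 - eps * k y) * r y + eps * s y)%R.
have [mre re0 _ _ P'nuE] := P'nu.
have PT (Q : {finite_measure set Y -> \bar R}) (rq : Y -> R) :
    density_off Q nu rq S -> Q setT = \int[nu]_y (rq y)%:E + Q S.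
  move=> [_ _ _ _ <-//]; rewrite -measureU ?setTD ?setvU ?setICl//.
  exact: measurableC.
have l0oo : minorant_slope phi = +oo -> P S = 0.
  move=> loo; apply/eqP; rewrite eq_le measure_ge0 andbT leNgt; apply/negP => PS0.
  move: Voo; rewrite loo gt0_mulye// addey ?ltxx//.
  by rewrite gt_eqF// (lt_le_trans (ltNyr 0%R))// Iphi0.
(* Without domain points above [tm] the slope is infinite, so finiteness gives [P S = 0]. Moreover
   [r] stays below [t] almost everywhere, so [P] does not charge [H] and [al] vanishes. *)
have [[b0 Db0 b0t]|] := pselect (exists2 b, edom phi b & (tm < b)%R); last first.
  move=> /forall2NP h0.
  have loo : minorant_slope phi = +oo.
    apply/eqP; rewrite -leye_eq leNgt; apply/negP => loo.
    have [z Dz tz] := minorant_slope_unbounded pphi cphi loo tm.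
    by case: (h0 z).
  have PS0 := l0oo loo.
  have nuH : nu H = 0.
    apply: (measure_negligible mH).
    have : {ae nu, forall y, ~ H y}.
      apply: filterS2 aeD aeS => y Dy nSy [/= tr|//].
      by case: (h0 (r y)) => //; apply; exact: lt_le_trans tr.
    by apply: negligibleS => y Hy /=; apply.
  have PH : P H = 0.
    have -> : P H = P (H `&` S) + P (H `\` S).
      rewrite -measureU; [by rewrite setUIDK|exact: measurableI|exact: measurableD|].
      by rewrite setDE setIACA setICr setI0.
    rewrite PnuE// null_set_integral//; last exact/measurable_funTS/measurable_EFinP.
    rewrite adde0; apply: (@subset_measure0 _ _ _ P _ S) => //.
    exact: measurableI.
  have alint : \int[mu]_x (al x)%:E = 0.
    rewrite -alE// pHE preimage_setT setTI -PE//.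
  apply/eqP; rewrite eq_le; apply/andP; split; last first.
    apply: integral_ge0 => x _; rewrite lee_fin mulr_ge0//.
      by case/andP: (al01 x).
    by case/andP: (h01 x).
  rewrite -alint; apply: ge0_le_integral => //.
  - move=> x _; rewrite lee_fin mulr_ge0//; first by case/andP: (al01 x).
    by case/andP: (h01 x).
  - by apply/measurable_EFinP; apply: measurable_funM.
  - exact/measurable_EFinP.
  - move=> x _; rewrite lee_fin -[leRHS]mulr1 ler_wpM2l//.
      by case/andP: (al01 x).
    by case/andP: (h01 x).
have Dtm : edom phi tm by apply: (dom_between cphi.1 Da0 Db0); rewrite !ltW.
have [||g Hg] := entropy_subgradient pphi cphi Dtm; [by exists a0|by exists b0|].
have gl : g%:E <= minorant_slope phi.
  apply: minorant_slope_ub; exists (fine (phi tm) - g * tm)%R => w w0.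
  have [->|wr] := eqVneq w tm; first by rewrite subrK -edom_fineK.
  by apply: le_trans (ltW (Hg _ w0 wr)); rewrite lee_fin; lra.
have Hg' z : edom phi z -> z != tm ->
    (fine (phi tm) + g * (z - tm) < fine (phi z))%R.
  move=> Dz ztm; have := Hg z Dz.1 ztm.
  by rewrite (edom_fineK pphi Dz) lte_fin.
have between y : ~ S y -> (r y <= re y <= tm)%R || (tm <= re y <= r y)%R \/ re y = r y.
  move=> nSy; have [kP1 kP2] := kP y; have [sP1 sP2] := sP y.
  apply: (reroute_between t0 ep01 e1 e2 kP1 sP1 (r0 y)) => [rt'|/negP rt'|/andP[_ rt]].
  - by apply: kP2 => -[/=|//]; rewrite leNgt (lt_trans rt' tt').
  - by apply: sP2 => -[/=].
  - by apply: kP2 => -[/=|//]; rewrite leNgt rt.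
have gapP y : ~ S y -> edom phi (r y) ->
    edom phi (re y) /\
    ((fine (phi (re y)) <= fine (phi (r y)) + g * (re y - r y))%R /\
     (re y != r y -> (fine (phi (re y)) < fine (phi (r y)) + g * (re y - r y))%R)).
  move=> nSy Dr; have [rer|rer] := eqVneq (re y) (r y).
    by rewrite rer subrr mulr0 addr0 lexx; split => //; split.
  case: (between y nSy) => [bet|re_r]; last by rewrite re_r eqxx in rer.
  have lt := subgradient_between (strictly_convex_fine pphi cphi)
    Dtm Dr Hg' bet rer.
  split; last by split=> // ; exact: ltW.
  by case/orP: bet => bet; [exact: (dom_between cphi.1 Dr Dtm)|
    exact: (dom_between cphi.1 Dtm Dr)].
have aegood : {ae nu, forall y, ~ S y /\ edom phi (r y)}.
  by apply: filterS2 aeS aeD => y nSy Dr; split.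
have ir := density_off_integrable Pnu.
have ire : nu.-integrable setT (EFin \o re) := density_off_integrable P'nu.
have mphire : measurable_fun setT (phi \o re) by exact: measurable_entropy.
pose F1 y := fine (phi (r y)). pose F2 y := fine (phi (re y)).
have F10 y : (0 <= F1 y)%R by apply: fine_ge0; exact: phi0.
have F20 y : (0 <= F2 y)%R by apply: fine_ge0; apply: phi0; exact: re0.
have mF1 : measurable_fun setT F1.
  by apply: measurableT_comp mphir; exact: fine_measurable.
have mF2 : measurable_fun setT F2.
  by apply: measurableT_comp mphire; exact: fine_measurable.
have meF1 : measurable_fun setT (EFin \o F1) by exact/measurable_EFinP.
have meF2 : measurable_fun setT (EFin \o F2) by exact/measurable_EFinP.
have IF1 : \int[nu]_y phi (r y) = \int[nu]_y (F1 y)%:E.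
  apply: ae_eq_integral => //.
  by apply: filterS aegood => y [_ Dr] _; rewrite /= -edom_fineK.
have IF2 : \int[nu]_y phi (re y) = \int[nu]_y (F2 y)%:E.
  apply: ae_eq_integral => //.
  by apply: filterS aegood => y [nSy Dr] _; rewrite /= -edom_fineK//; case: (gapP y nSy Dr).
have iF1 : nu.-integrable setT (EFin \o F1).
  apply/integrableP; split => //.
  by rewrite (eq_integral (EFin \o F1)) => [|y _]; [rewrite -IF1|rewrite /= ger0_norm].
have igr : nu.-integrable setT (fun y => g%:E * ((re y)%:E - (r y)%:E)).
  by apply: integrableZl => //; exact: integrableB.
have iU : nu.-integrable setT (fun y => (F1 y)%:E + g%:E * ((re y)%:E - (r y)%:E)).
  exact: integrableD.
have iF2 : nu.-integrable setT (EFin \o F2).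
  apply/integrableP; split => //.
  rewrite (eq_integral (EFin \o F2)) => [|y _]; last by rewrite /= ger0_norm.
  have /integrableP[mU] := iU; apply: le_lt_trans.
  apply: ae_ge0_le_integral => //.
  - by move=> y _; rewrite lee_fin.
  - exact: measurableT_comp.
  - apply: filterS aegood => y [nSy Dr] _.
    rewrite -EFinB -EFinM -EFinD /= lee_fin; apply: le_trans (ler_norm _).
    by case: (gapP y nSy Dr) => _ [].
pose gap y := (F1 y + g * (re y - r y) - F2 y)%R.
have gap0 : {ae nu, forall y, (0 <= gap y)%R}.
  apply: filterS aegood => y [nSy Dr]; rewrite subr_ge0.
  by case: (gapP y nSy Dr) => _ [].
have gapE : \int[nu]_y (gap y)%:E = \int[nu]_y (F1 y)%:E +
    g%:E * (\int[nu]_y (re y)%:E - \int[nu]_y (r y)%:E) - \int[nu]_y (F2 y)%:E.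
  rewrite -integralB// -integralZl//; last exact: integrableB.
  by rewrite -integralD// -integralB.
have mgap : measurable_fun setT gap.
  apply: measurable_funB => //; apply: measurable_funD => //.
  by apply: measurable_funM => //; apply: measurable_funB.
have Vle := Vmin planp' P'E P'nu.
have P'SP : P' S <= P S.
  rewrite P'S -[leRHS]mul1e -integral_cst//; apply: ge0_le_integral => //.
  - move=> y _; rewrite lee_fin subr_ge0.
    by have [k_ge0 k_le] := andP (kP y).1; rewrite mulr_ile1// ltW.
  - apply/measurable_funTS/measurable_EFinP; apply: measurable_funB => //.
    by apply: measurable_funM.
  - move=> y _; rewrite lee_fin gerBl mulr_ge0// ?ltW//.
have Psfin : P S \is a fin_num by exact: fin_num_measure.
have P'sfin : P' S \is a fin_num by exact: fin_num_measure.
have i1 := integrable_fin_num measurableT iF1.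
have i2 := integrable_fin_num measurableT iF2.
have jr := integrable_fin_num measurableT ir.
have jre := integrable_fin_num measurableT ire.
have mass : \int[nu]_y (re y)%:E + P' S = \int[nu]_y (r y)%:E + P S.
  rewrite -(PT _ _ P'nu) -(PT _ _ Pnu) P'E// PE// !preimage_setT.
  by rewrite -(preimage_setT a) planp'.2// mup.2.
have gap_le0 : \int[nu]_y (gap y)%:E <= 0.
  have P'S0 : 0 <= P' S by [].
  rewrite gapE; move: Vle mass P'SP gl l0oo P'S0; rewrite IF1 IF2.
  move: i1 i2 jr jre Psfin P'sfin.
  case: (\int[nu]_y (F1 y)%:E) => // x1 _; case: (\int[nu]_y (F2 y)%:E) => // x2 _.
  case: (\int[nu]_y (r y)%:E) => // x3 _; case: (\int[nu]_y (re y)%:E) => // x4 _.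
  case: (P S) => // x5 _; case: (P' S) => // x6 _.
  move=> Vle1 [] mass1; rewrite lee_fin => x65 gl1 loo.
  rewrite lee_fin => x6_ge0; rewrite -!(EFinB, EFinM, EFinD) lee_fin.
  have e43 : (x4 - x3 = x5 - x6)%R by move: mass1; lra.
  (* With a finite slope [l], minimality and [g <= l] bound the integral; with an infinite one both
     singular masses are 0 and no linear term remains. *)
  rewrite e43; move: Vle1 gl1 loo; case: (minorant_slope phi) => [l||].
  - rewrite -!(EFinM, EFinD) !lee_fin => Vle2 gl2 _.
    have : (g * (x5 - x6) <= l * (x5 - x6))%R by rewrite ler_wpM2r// subr_ge0.
    by move: Vle2; lra.
  - move=> + _ /(_ erefl) [x50].
    have x60 : x6 = 0%R by apply/eqP; rewrite eq_le x6_ge0 -x50 x65.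
    rewrite x50 x60 mule0 !adde0 lee_fin subrr mulr0 addr0.
    by lra.
  - by rewrite leeNy_eq.
have : ae_eq nu setT (fun y => (gap y)%:E) (cst 0).
  apply/ae_eq_integral_abs => //; first exact/measurable_EFinP.
  apply/eqP; rewrite eq_le integral_ge0// andbT.
  rewrite (ae_eq_integral (fun y => (gap y)%:E)) //.
  - by apply: measurableT_comp => //; exact/measurable_EFinP.
  - exact/measurable_EFinP.
  - by apply: filterS gap0 => y gy _; rewrite /= ger0_norm.
move=> gapz; apply: s_zero.
apply: filterS2 aegood gapz => y [nSy Dr] /(_ I) [] gy.
have [re_r|re_r] := eqVneq (re y) (r y); last first.
  by have := (gapP y nSy Dr).2.2 re_r; rewrite -subr_gt0 -/(gap y) gy ltxx.
apply: contrapT => sy.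
have Ly : L y by apply: contrapT => nLy; apply: sy; exact: (sP y).2.
have ky : k y = 0%R.
  by apply: (kP y).2 => -[/= tr|//]; case: Ly => /= rt _;
    rewrite ltNge (le_trans (ltW tt') tr) in rt.
move: re_r; rewrite /re ky mulr0 subr0 mul1r => rs.
have : (eps * s y = 0)%R by lra.
by move/eqP; rewrite mulf_eq0 gt_eqF//= => /eqP.
Qed.

End exchange.

(** [D] collects the points of [X] from which [p] sends mass into [H]. The exchange shows that
    [sigma] sends nothing from [D] into [L c], for each [c < t]. *)
Lemma feasible_le_truncation (t : R) sigma : (0 < t)%R -> feasible t sigma ->
  sigma setT <= \int[nu]_y (Num.min (r y) t)%:E.
Proof.
move=> t0 feas_sigma; have [sN sA sB] := feas_sigma.
have [pN pA] := mup.
have mlt c : measurable [set y | (r y < c)%R].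
  rewrite -[X in measurable X]setTI; exact: measurable_fun_ltr.
have mge : measurable [set y | (t <= r y)%R].
  by rewrite -[X in measurable X]setTI; exact: measurable_fun_ler.
pose H := [set y | (t <= r y)%R] `|` S.
pose L c := [set y | (r y < c)%R] `\` S.
have mH : measurable H by exact: measurableU.
have mL c : measurable (L c) by exact: measurableD.
have [pH pHE] := finite_measure_restr p (mb1 mH).
have density_a (M : {finite_measure set Z -> \bar R}) :
    (forall A, measurable A -> M (a @^-1` A) <= mu A) ->
    exists f : X -> R, [/\ measurable_fun setT f, forall x, (0 <= f x <= 1)%R &
      forall A, measurable A -> M (a @^-1` A) = \int[mu]_(x in A) (f x)%:E].
  move=> Mmu; have [aM aME] := finite_pushforward M ma.
  have [|f [mf f0 fE] f1] := @dominated_density _ _ _ aM mu.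
    by move=> A mA; rewrite aME Mmu.
  exists f; split => //; first by move=> x; rewrite f0 f1.
  by move=> A mA; rewrite -aME fE.
have [|al [mal al01 alE]] := density_a pH.
  move=> A mA; rewrite -pA// pHE; apply: le_measure; rewrite ?inE//.
  - by apply: measurableI; [exact: ma1|exact: mb1].
  - exact: ma1.
pose D := [set x | al x != 0%R].
have mD : measurable D.
  rewrite (_ : D = setT `&` al @^-1` (~` [set 0%R])); last first.
    by rewrite setTI; apply/seteqP; split => x /= /eqP.
  by apply: mal => //; exact: measurableC.
have mDc : measurable (~` D) by exact: measurableC.
have null c : (c < t)%R -> sigma (a @^-1` D `&` b @^-1` (L c)) = 0.
  move=> ct; have [sL sLE] := finite_measure_restr sigma (mb1 (mL c)).
  have [|h [mh h01 hE]] := density_a sL.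
    move=> A mA; apply: le_trans (sA _ mA); rewrite sLE.
    apply: le_measure; rewrite ?inE//.
    - by apply: measurableI; [exact: ma1|exact: mb1].
    - exact: ma1.
  have al0 x : (0 <= al x)%R by case/andP: (al01 x).
  have h0 x : (0 <= h x)%R by case/andP: (h01 x).
  have al_h := exchange_null t0 ct feas_sigma pHE sLE mal al01 mh h01 alE hE.
  have malh : measurable_fun setT (fun x => (al x * h x)%:E).
    by apply/measurable_EFinP; exact: measurable_funM.
  have : \int[mu]_x `|(al x * h x)%:E| = 0.
    by rewrite -al_h; apply: eq_integral => x _; rewrite gee0_abs// lee_fin mulr_ge0.
  move/(ae_eq_integral_abs mu measurableT malh) => al_h0.
  rewrite -sLE hE// (ae_eq_integral (cst 0)) ?integral0//.
    exact/measurable_funTS/measurable_EFinP.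
  apply: filterS al_h0 => x /(_ I) [] /eqP; rewrite mulf_eq0.
  by move=> + /eqP alx; rewrite (negbTE (introN eqP alx)) => /eqP -> .
(* The sets [L c] with [c = t - 1/(n+1)] exhaust [L t]. *)
have null_t : sigma (a @^-1` D `&` b @^-1` (L t)) = 0.
  pose c n : R := (t - n.+1%:R^-1)%R.
  have -> : a @^-1` D `&` b @^-1` (L t) =
      \bigcup_n (a @^-1` D `&` b @^-1` (L (c n))).
    rewrite -setI_bigcupr; congr (_ `&` _); rewrite -preimage_bigcup.
    congr (_ @^-1` _); apply/seteqP; split => [y [/= ryt nSy]|y [n _ [/= ryc nSy]]].
      have [n nP] := ltr_add_invr ryt.
      by exists n => //; split => //=; rewrite ltrBrDr.
    by split => //=; apply: lt_le_trans ryc _; rewrite gerBl invr_ge0.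
  apply: measure_negligible.
    by apply: bigcupT_measurable => n; apply: measurableI; [exact: ma1|exact: mb1].
  apply: negligible_bigcup => n; apply/negligibleP.
    by apply: measurableI; [exact: ma1|exact: mb1].
  by apply: null; rewrite ltrBlDr ltrDl invr_gt0.
have LE : L t = ~` H.
  apply/seteqP; split => y /=.
    by move=> [/= ryt nSy] [/=|//]; rewrite leNgt ryt.
  by move/not_orP => [/negP]; rewrite -ltNge.
have mmin : measurable_fun setT (fun y => (Num.min (r y) t)%:E).
  by apply/measurable_EFinP/measurable_minr.
have min0 y : 0 <= (Num.min (r y) t)%:E by rewrite lee_fin le_min r0 ltW.
(* On [H] the minimum is [t] except on the null set [S], so the capacity bound of [sigma] already
   has the required form. *)
have H_le : sigma (b @^-1` H) <= \int[nu]_(y in H) (Num.min (r y) t)%:E.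
  apply: le_trans (sB _ mH) _.
  have te0 (y : Y) : 0 <= (cst t%:E : Y -> \bar R) y by rewrite lee_fin ltW.
  have -> : t%:E * nu H = \int[nu]_(y in H) cst t%:E y by rewrite integral_cst.
  rewrite -(integral_setD_null mH mS (measurable_cst _) te0 nuS).
  rewrite -(integral_setD_null mH mS mmin min0 nuS).
  rewrite le_eqVlt; apply/orP; left; apply/eqP/eq_integral => y.
  by rewrite inE => -[[/= ty|//] _]; rewrite min_r.
(* What [sigma] sends into [L t] comes from the complement of [D], hence is at most its [mu]-mass;
   [p] sends all of that mass into [L t], where the minimum is [r]. *)
have L_le : sigma (b @^-1` (L t)) <= \int[nu]_(y in L t) (Num.min (r y) t)%:E.
  have -> : sigma (b @^-1` L t) = sigma (a @^-1` (~` D) `&` b @^-1` (L t)).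
    rewrite -[RHS]add0e -null_t -measureU.
    - by rewrite -setIUl -preimage_setC setUv setTI.
    - by apply: measurableI; [exact: ma1|exact: mb1].
    - by apply: measurableI; [exact: ma1|exact: mb1].
    - by rewrite setIACA -preimage_setC setICr set0I.
  apply: le_trans (_ : _ <= sigma (a @^-1` (~` D))) _.
    apply: le_measure; rewrite ?inE//; first apply: measurableI.
    all: try exact: ma1. all: try exact: mb1.
  apply: le_trans (sA _ mDc) _; rewrite -pA//.
  have -> : p (a @^-1` (~` D)) = p (a @^-1` (~` D) `&` b @^-1` (L t)).
    rewrite -[RHS]add0e LE.
    have <- : pH (a @^-1` (~` D)) = 0.
      rewrite alE//; apply: integral0_eq => x /=.
      by rewrite /D /= => /negP; rewrite negbK => /eqP ->.
    rewrite pHE -measureU.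
    - by rewrite -setIUr -preimage_setC setUv setIT.
    - by apply: measurableI; [exact: ma1|exact: mb1].
    - by apply: measurableI; [exact: ma1|apply: mb1; exact: measurableC].
    - by rewrite setIACA -preimage_setC setICr setI0.
  apply: le_trans (_ : _ <= p (b @^-1` (L t))) _.
    apply: le_measure; rewrite ?inE//; first apply: measurableI.
    all: try exact: ma1. all: try exact: mb1.
  rewrite -PE//.
  have -> : P (L t) = P (L t `\` S).
    by congr (P _); rewrite /L setDDl setUid.
  rewrite PnuE// le_eqVlt; apply/orP; left; apply/eqP/eq_integral => y.
  by rewrite inE => -[/= ty _]; rewrite min_l// ltW.
have -> : sigma setT = sigma (b @^-1` H) + sigma (b @^-1` (L t)).
  rewrite -measureU; [|exact: mb1|exact: mb1|].
    by rewrite LE -preimage_setC setUv.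
  by rewrite LE -preimage_setC setICr.
apply: le_trans (leeD H_le L_le) _.
rewrite -ge0_integral_setU//.
- by rewrite LE setUv.
- by rewrite LE setUv.
- by rewrite LE; apply/disj_setPS; rewrite setICr.
Qed.
End maximin.

(** * Proportional responses *)

Section proportional_response_abstract.
Context (R : realType) (dX dY dZ : measure_display).
Context (X : measurableType dX) (Y : measurableType dY) (Z : measurableType dZ).
Variables (a : Z -> X) (b : Z -> Y).
Hypotheses (ma : measurable_fun setT a) (mb : measurable_fun setT b).

Let ma1 A : measurable A -> measurable (a @^-1` A).
Proof. by move=> mA; rewrite -[X in measurable X]setTI; exact: ma. Qed.
Let mb1 B : measurable B -> measurable (b @^-1` B).
Proof. by move=> mB; rewrite -[X in measurable X]setTI; exact: mb. Qed.

(** [K y] is the law of [G (y, u)] for uniform [u]. Besides rectangles, general sets [C] are covered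
    in order to show that a kernel avoids the forbidden pairs. *)
Lemma disintegration_kernel (mk : X * Y -> Z) (G : Y * measurableTypeR R -> X)
    (p : {finite_measure set Z -> \bar R}) (P : {finite_measure set Y -> \bar R}) :
  measurable_fun setT mk -> (forall w, a (mk w) = w.1) -> (forall w, b (mk w) = w.2) ->
  measurable_fun setT G ->
  (forall C, measurable C ->
    p C = (P \x uniform01 R) ((fun w => mk (G w, w.1)) @^-1` C)) ->
  exists K : R.-pker Y ~> X,
  [/\ forall A B, measurable A -> measurable B ->
        p (a @^-1` A `&` b @^-1` B) = \int[P]_(y in B) K y A,
      forall C, measurable C -> p C = \int[P]_y K y [set x | C (mk (x, y))] &
      forall C, measurable C ->
        measurable_fun setT (fun y => K y [set x | C (mk (x, y))])].
Proof.
move=> mmk amk bmk mG pE; have [K KE] := kernel_of_function mG.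
have mfib C y : measurable C -> measurable [set x | C (mk (x, y))].
  move=> mC; rewrite -[X in measurable X]setTI.
  have mm : measurable_fun setT (fun x => mk (x, y)).
    by apply: measurableT_comp => //; exact: measurable_pair2.
  exact: mm.
pose D C := (fun w => mk (G w, w.1)) @^-1` C.
have mD C : measurable C -> measurable (D C).
  move=> mC; rewrite -[X in measurable X]setTI.
  have mh : measurable_fun setT (fun w => mk (G w, w.1)).
    by apply: measurableT_comp => //; exact: measurable_fun_pair.
  exact: mh.
have fibE C y : measurable C ->
    K y [set x | C (mk (x, y))] = uniform01 R (xsection (D C) y).
  move=> mC; rewrite KE; last exact: mfib.
  by congr (uniform01 R _); apply/seteqP; split => u; rewrite /xsection/= inE.
have pK C : measurable C -> p C = \int[P]_y K y [set x | C (mk (x, y))].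
  move=> mC; rewrite pE// /product_measure1; apply: eq_integral => y _.
  by rewrite fibE.
exists K; split => // [A B mA mB|C mC]; last first.
  apply: eq_measurable_fun (measurable_fun_xsection (uniform01 R) (mD C mC)) => y _.
  by rewrite fibE.
rewrite pK; last by apply: measurableI; [exact: ma1|exact: mb1].
rewrite [RHS]integral_mkcond; apply: eq_integral => y _; rewrite patchE.
have [yB|yB] := boolP (y \in B).
  congr (K y _); apply/seteqP; split => x /=; rewrite amk bmk /=; first by case.
  by move=> Ax; split => //; exact: set_mem.
rewrite (_ : [set x | _] = set0) ?measure0//; apply/seteqP; split => x //=.
by rewrite bmk /= => -[_ /mem_set]; rewrite (negbTE yB).
Qed.

Variables (p q : {finite_measure set Z -> \bar R}).
Variables (P nu : {finite_measure set Y -> \bar R}).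
Hypothesis PE : forall B, measurable B -> P B = p (b @^-1` B).
Hypothesis nuE : forall B, measurable B -> q (b @^-1` B) = nu B.
Variables (r : Y -> R) (S : set Y).
Hypothesis Pnu : density_off P nu r S.

Let U := [set y | r y != 0%R].

Let mr : measurable_fun setT r. Proof. by case: Pnu. Qed.
Let r0 y : (0 <= r y)%R. Proof. by case: Pnu. Qed.
Let mS : measurable S. Proof. by case: Pnu. Qed.
Let nuS : nu S = 0. Proof. by case: Pnu. Qed.
Let PnuE A : measurable A -> P (A `\` S) = \int[nu]_(y in A) (r y)%:E.
Proof. by case: Pnu => _ _ _ _; exact. Qed.

Lemma measurable_density_neq0 : measurable U.
Proof.
rewrite (_ : U = setT `&` r @^-1` (~` [set 0%R])); last first.
  by rewrite setTI; apply/seteqP; split => x /= /eqP.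
by apply: mr => //; exact: measurableC.
Qed.

(** Here [nu] is decomposed with respect to [P]. A [P]-null set has [r = 0] almost everywhere, so it
    meets [U] in a [nu]-null set; and [P] is carried by the union of [U] and [S], which [nuperp]
    does not charge. *)
Lemma lebesgue_decomposition_density (nuac nuperp : {finite_measure set Y -> \bar R}) :
  (forall A, nuac A = nu (A `&` U)) -> (forall A, nuperp A = nu (A `&` ~` U)) ->
  lebesgue_decomposition nu P nuac nuperp.
Proof.
move=> acE perpE; have mU := measurable_density_neq0.
have mUc : measurable (~` U) by exact: measurableC.
split.
- move=> A mA; rewrite acE perpE -measureU; [|exact: measurableI|exact: measurableI|].
    by rewrite -setIUr setUv setIT.
  by rewrite setIACA setICr setI0.
- apply/null_content_dominatesP => A mA PA; rewrite acE.
  have : \int[nu]_(y in A) (r y)%:E = 0.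
    apply/eqP; rewrite -PnuE// eq_le measure_ge0 andbT -[leRHS]PA.
    by apply: le_measure; rewrite ?inE//; exact: measurableD.
  have mer : measurable_fun A (EFin \o r) by exact/measurable_funTS/measurable_EFinP.
  have -> : \int[nu]_(y in A) (r y)%:E = \int[nu]_(y in A) `|(r y)%:E|.
    by apply: eq_integral => y _; rewrite gee0_abs// lee_fin.
  move/(ae_eq_integral_abs nu mA mer) => rA.
  apply: measure_negligible; first exact: measurableI.
  apply: negligibleS rA => y [Ay /eqP ry] /= /(_ Ay) [].
  exact: ry.
- exists (U `|` S); first exact: measurableU.
  split.
    apply/eqP; rewrite eq_le measure_ge0 andbT perpE -[leRHS]nuS.
    apply: le_measure; rewrite ?inE//.
      by apply: measurableI => //; exact: measurableU.
    by move=> y [[|]].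
  rewrite setCU -setDE PnuE//; apply: integral0_eq => y /=.
  by rewrite /U /= => /negP; rewrite negbK => /eqP ->.
Qed.

(** It must be seen that [S'] and the preimage of [S] agree up to a [p]-null set. Since the density
    is a function of [y], removing either one leaves the same mass over every [B]; [B = S] and its
    complement give the two inclusions. *)
Lemma density_off_fibered (rho : Z -> R) S' : density_off p q rho S' ->
  q [set z | rho z != r (b z)] = 0 -> density_off p q (r \o b) (b @^-1` S).
Proof.
move=> pq rho_r; have [mrho rho0 mS' qS' pqE] := pq.
have mrb : measurable_fun setT (r \o b) by exact: measurableT_comp mr mb.
have mne : measurable [set z | rho z != r (b z)].
  rewrite (_ : [set z | _] = ~` [set z | (rho z == r (b z)) = true]); last first.
    by apply/seteqP; split => z /= => [/negbTE -> //|]; case: eqP.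
  apply: measurableC; rewrite -[X in measurable X]setTI.
  have me := measurable_fun_eqr mrho mrb.
  exact: (me measurableT [set true]).
have pqrE A : measurable A -> p (A `\` S') = \int[q]_(z in A) (r (b z))%:E.
  move=> mA; rewrite pqE//; apply: ae_eq_integral => //.
  - exact/measurable_funTS/measurable_EFinP.
  - exact/measurable_funTS/measurable_EFinP.
  - exists [set z | rho z != r (b z)]; split => // z /= /not_implyP[_].
    by move=> ne; apply/eqP => e; apply: ne; rewrite e.
have pnull A D : measurable A -> measurable D -> p D = 0 -> p (A `\` D) = p A.
  move=> mA mD pD; have mAD : measurable (A `&` D) by exact: measurableI.
  have -> : p A = p (A `&` D) + p (A `\` D).
    rewrite -measureU; [by rewrite setUIDK|exact: measurableI|exact: measurableD|].
    by rewrite setDE setIACA setICr setI0.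
  have -> : p (A `&` D) = 0; last by rewrite add0e.
  apply/eqP; rewrite eq_le measure_ge0 andbT -[leRHS]pD.
  by apply: le_measure; rewrite ?inE.
have fib B : measurable B -> p (b @^-1` B `\` S') = p (b @^-1` B `\` b @^-1` S).
  move=> mB; rewrite pqrE; last exact: mb1.
  rewrite -(@integral_image_measure _ _ _ _ _ q nu b (EFin \o r) B)//.
  - by rewrite /= -PnuE// PE//; exact: measurableD.
  - by move=> A mA; rewrite nuE.
  - exact/measurable_EFinP.
have mbS : measurable (b @^-1` S) by exact: mb1.
have null1 : p (b @^-1` S `\` S') = 0 by rewrite fib// setDv measure0.
have null2 : p (S' `\` b @^-1` S) = 0.
  have mSc : measurable (~` S) by exact: measurableC.
  have := fib _ mSc; rewrite preimage_setC.
  rewrite (_ : (b @^-1` (~` S)) `\` b @^-1` S = b @^-1` (~` S)); last first.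
    by rewrite -preimage_setC setDE setIid.
  have -> : p (b @^-1` (~` S)) = p (b @^-1` (~` S) `\` S') + p (S' `\` b @^-1` S).
    rewrite -measureU.
    - by rewrite [S' `\` _]setDE preimage_setC [S' `&` _]setIC setUC setUIDK.
    - by apply: measurableD => //; exact: mb1.
    - exact: measurableD.
    - by apply/seteqP; split => z //= -[[_ nS'z] [/nS'z]].
  rewrite -[LHS]adde0 => /addeIl -> //.
  by apply: fin_num_measure; apply: measurableD => //; exact: mb1.
split => //.
- by move=> z; exact: r0.
- by rewrite nuE.
- move=> A mA; rewrite /= -pqrE//.
  rewrite -(pnull _ _ (measurableD mA mbS) (measurableD mS' mbS) null2).
  rewrite -(pnull _ _ (measurableD mA mS') (measurableD mbS mS') null1).
  congr (p _); rewrite !setDDl; congr (A `\` _).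
  apply/seteqP; split => z /=.
    by have [] := pselect (S' z); tauto.
  by have [] := pselect (S (b z)); tauto.
Qed.

(** Over [U], both [q] and [nu] are obtained from [p] and [P] off the singular set through the
    factor [1 / r]. The factor depends on [y] only, so the kernel of [p] serves for [q]. *)
Lemma kernel_product_density (K : R.-pker Y ~> X)
    (nuac : {finite_measure set Y -> \bar R}) (mu1 : {finite_measure set Z -> \bar R}) :
  density_off p q (r \o b) (b @^-1` S) ->
  (forall A B, measurable A -> measurable B ->
    p (a @^-1` A `&` b @^-1` B) = \int[P]_(y in B) K y A) ->
  (forall B, nuac B = nu (B `&` U)) -> (forall C, mu1 C = q (C `&` b @^-1` U)) ->
  forall A B, measurable A -> measurable B ->
    mu1 (a @^-1` A `&` b @^-1` B) = \int[nuac]_(y in B) K y A.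
Proof.
move=> pq pK acE mu1E A B mA mB; have mU := measurable_density_neq0.
have mKA : measurable_fun setT (K ^~ A) by exact: measurable_kernel.
have mBU : measurable (B `&` U) by exact: measurableI.
pose g y : \bar R := ((r y)^-1)%:E.
have g0 y : 0 <= g y by rewrite lee_fin invr_ge0.
have mg : measurable_fun setT g by apply/measurable_EFinP; exact: measurable_fun_inv.
have mgb : measurable_fun setT (g \o b) by exact: measurableT_comp mg mb.
rewrite (integral_restr_measure mU acE mB mKA)//.
have -> : \int[nu]_(y in B `&` U) K y A =
    \int[P]_(y in (B `&` U) `\` S) (K y A * g y).
  rewrite (integral_density_off Pnu mBU)//; first last.
  - by move=> y; rewrite mule_ge0.
  - exact: emeasurable_funM.
  apply: eq_integral => y; rewrite inE => -[_ Uy].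
  by rewrite -muleA -EFinM mulVf// mule1.
have [pA pAE] := finite_measure_restr p (ma1 mA).
have [M ME] := finite_pushforward pA mb.
have K1 y : K y A = (fine (K y A))%:E.
  rewrite fineK// ge0_fin_numE//; apply: (@le_lt_trans _ _ (K y setT)).
    by apply: le_measure; rewrite ?inE.
  by rewrite prob_kernel ltry.
have Md : has_density M P (fun y => fine (K y A)).
  split.
  - exact: measurableT_comp (@fine_measurable _ _ measurableT) mKA.
  - by move=> y; apply: fine_ge0.
  - move=> C mC; rewrite ME pAE setIC pK//.
    by apply: eq_integral => y _; exact: K1.
have -> : \int[P]_(y in (B `&` U) `\` S) (K y A * g y) =
    \int[M]_(y in (B `&` U) `\` S) g y.
  rewrite (integral_density Md _ mg)//; last exact: measurableD.
  by apply: eq_integral => y _; rewrite muleC -K1.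
have mBUS : measurable ((B `&` U) `\` S) by exact: measurableD.
have mABU : measurable (a @^-1` A `&` b @^-1` (B `&` U)).
  by apply: measurableI; [exact: ma1|exact: mb1].
have gb0 z : 0 <= (g \o b) z by exact: g0.
rewrite (integral_image_measure mb (fun C _ => ME C) mBUS mg g0).
rewrite (integral_restr_measure (ma1 mA) pAE (mb1 mBUS) mgb gb0).
have -> : b @^-1` ((B `&` U) `\` S) `&` a @^-1` A =
    (a @^-1` A `&` b @^-1` (B `&` U)) `\` b @^-1` S.
  by apply/seteqP; split => z /=; tauto.
rewrite (integral_density_off pq mABU mgb gb0).
rewrite mu1E -setIA -preimage_setI -[LHS]mul1e -integral_cst//.
apply: eq_integral => z; rewrite inE => -[_ [_ Uz]].
by rewrite /g /= -EFinM mulVf.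
Qed.

End proportional_response_abstract.

(** * Transfer to the two sides, and the theorem *)

Section two_sided_plans.
Context (R : realType) (Omega : bool -> ptopologicalType).
Context (E : set (Omega false * Omega true)).
Context (nu : forall i, {finite_measure set (borel (Omega i)) -> \bar R}).

Local Notation pairs := (borel (Omega false) * borel (Omega true))%type.
Local Notation plan := {finite_measure set pairs -> \bar R}.

Definition pairing (i : bool) (w : borel (Omega i) * borel (Omega (~~ i))) : pairs :=
  pair_of w.1 w.2.

Lemma measurable_pairing i : measurable_fun setT (@pairing i).
Proof.
case: i; first exact: (measurable_fun_pair measurable_snd measurable_fst).
exact: (measurable_fun_pair measurable_fst measurable_snd).
Qed.

Lemma pr_pairing i (w : borel (Omega i) * borel (Omega (~~ i))) :
  pr i (pairing w) = w.1 /\ pr (~~ i) (pairing w) = w.2.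
Proof. by case: i w. Qed.

Lemma pairing_pr i (z : pairs) : pairing (pr i z, pr (~~ i) z) = z.
Proof. by case: i z => -[]. Qed.

Lemma randomization_of_plan i (p : plan)
    (P : {finite_measure set (borel (Omega (~~ i))) -> \bar R}) :
  (forall j, polish R (Omega j)) ->
  (forall B, measurable B -> P B = p (pr (~~ i) @^-1` B)) ->
  exists2 G : borel (Omega (~~ i)) * measurableTypeR R -> borel (Omega i),
    measurable_fun setT G &
    forall C, measurable C ->
      p C = (P \x uniform01 R) ((fun w => pairing (G w, w.1)) @^-1` C).
Proof.
move=> pol PE; have [f [g [mf mg f01 gf]]] := polish_retract (pol i).
have [G mG GE] := randomization_retract (@measurable_pr Omega i)
  (@measurable_pr Omega (~~ i)) (@measurable_pairing i) (@pairing_pr i) mf mg f01 gf PE.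
by exists G.
Qed.

(** The subtracted constant is the same for all pairs of refinements, so minimality can be tested on
    the nonnegative shifted functional. *)
Lemma divergence_plan theta (a b : R) i (p q : plan) rho S :
  eproper theta -> strictly_convex_on_dom theta -> (0 <= a)%R -> (0 <= b)%R ->
  (forall z, (0 <= z)%R -> 0 <= shifted theta a b z) ->
  refinements E nu i p -> refinements E nu (~~ i) q ->
  density_off p q rho S ->
  divergence theta p q =
    \int[q]_z shifted theta a b (rho z) + minorant_slope (shifted theta a b) * p S -
    (a%:E * nu (~~ i) setT + b%:E * nu i setT).
Proof.
move=> pth cth a0 b0 phi0 [_ pnu] [_ qnu] pq.
rewrite (divergence_shifted p q pth cth a0 b0 phi0).
have -> : q setT = nu (~~ i) setT by rewrite -qnu// /marginal /pushforward preimage_setT.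
have -> : p setT = nu i setT by rewrite -pnu// /marginal /pushforward preimage_setT.
have pphi := eproper_shifted a b pth.
have cphi := strictly_convex_shifted a b pth cth.
rewrite (divergence_density_off (theta := shifted theta a b) _ pq).
  by rewrite recessionE.
by move=> r' mr' r'0; exact: measurable_entropy.
Qed.

End two_sided_plans.

Theorem theorem7p3 (R : realType) (Omega : bool -> ptopologicalType)
    (E : set (Omega false * Omega true))
    (nu : forall i, {finite_measure set (borel (Omega i)) -> \bar R})
    (i : bool) (theta : R -> \bar R)
    (p q : {finite_measure
              set (borel (Omega false) * borel (Omega true))%type -> \bar R}) :
  (forall j, polish R (Omega j)) ->
  closed E ->
  (forall j (y : Omega (~~ j)), neighborhood E y !=set0) ->
  (forall j, nu j setT != 0) ->
  eproper theta ->
  lsc_nonneg theta ->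
  strictly_convex_on_dom theta ->
  refinements E nu i p ->
  refinements E nu (~~ i) q ->
  divergence theta p q =
    ereal_inf [set v | exists2 p', refinements E nu i p' &
                       exists2 q', refinements E nu (~~ i) q' &
                       v = divergence theta p' q'] ->
  divergence theta p q < +oo ->
  level_optimal_maximin E nu i p /\ proportional_response E nu i p q.
Proof.
move=> pol clE _ _ pth _ cth pref qref pqmin pqoo.
pose pairs := (borel (Omega false) * borel (Omega true))%type.
pose N : set pairs := ~` E.
have mN : measurable N.
  by apply: (open_measurable_prod (pol false) (pol true)); exact: closed_openC.
have [al [be [al0 be0 minor]]] := entropy_affine_minorant pth cth.
pose phi := shifted theta al be.
have phi0 z : (0 <= z)%R -> 0 <= phi z.
  move=> /minor min; rewrite /phi /shifted.
  have -> : 0 = (- (al + be * z))%:E + (al + be * z)%:E by rewrite -EFinD addNr.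
  exact: leeD2r.
have pphi : eproper phi := eproper_shifted al be pth.
have cphi : strictly_convex_on_dom phi := strictly_convex_shifted al be pth cth.
have ma := @measurable_pr Omega i.
have mb := @measurable_pr Omega (~~ i).
have [r [S Pnu]] := density_off_exists (marginal (~~ i) p) (nu (~~ i)).
have [rho [S' pq]] := density_off_exists p q.
have PE B : measurable B -> marginal (~~ i) p B = p (pr (~~ i) @^-1` B) by [].
pose V (p' q' : {finite_measure set pairs -> \bar R}) rho' S'' :=
  \int[q']_z phi (rho' z) + minorant_slope phi * p' S''.
have Cfin : al%:E * nu (~~ i) setT + be%:E * nu i setT \is a fin_num.
  by rewrite fin_numD !fin_numM// fin_num_measure.
have Vle p' q' rho' S'' : refinements E nu i p' -> refinements E nu (~~ i) q' ->
    density_off p' q' rho' S'' -> V p q rho S' <= V p' q' rho' S''.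
  move=> p'ref q'ref p'q'.
  have : divergence theta p q <= divergence theta p' q'.
    by rewrite pqmin; apply: ereal_inf_lbound; exists p' => //; exists q'.
  rewrite (divergence_plan pth cth al0 be0 phi0 pref qref pq).
  rewrite (divergence_plan pth cth al0 be0 phi0 p'ref q'ref p'q').
  by rewrite leeD2rE// fin_numN.
have Voo : V p q rho S' < +oo.
  move: pqoo; rewrite (divergence_plan pth cth al0 be0 phi0 pref qref pq).
  rewrite lteBlDr// => /lt_le_trans; apply.
  exact: leey.
have [G mG qE] := randomization_of_plan (P := nu (~~ i)) pol
  (fun B mB => esym (qref.2 B mB)).
have mh : measurable_fun setT (fun w => pairing (G w, w.1)).
  by apply: measurableT_comp (@measurable_pairing _ i) _; exact: measurable_fun_pair.
have bh w : pr (~~ i) (pairing (G w, w.1)) = w.1 by have [_ ->] := pr_pairing (G w, w.1).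
have Vmarg : \int[nu (~~ i)]_y phi (r y) + minorant_slope phi * marginal (~~ i) p S
    <= V p q rho S'.
  exact: (divergence_marginals_le mb PE mh bh qE pphi cphi phi0 Pnu pq).
(* The value of any marginal is attained by a pair of plans, with [q] as fallback in the response;
   so minimality of the pair passes to marginals. *)
have Vreal (p' : {finite_measure set pairs -> \bar R})
    (P' : {finite_measure set borel (Omega (~~ i)) -> \bar R}) r' S'' :
    plan_of N (pr i : pairs -> borel (Omega i)) (nu i) p' ->
    (forall B, measurable B -> P' B = p' (pr (~~ i) @^-1` B)) ->
    density_off P' (nu (~~ i)) r' S'' ->
    V p q rho S' <= \int[nu (~~ i)]_y phi (r' y) + minorant_slope phi * P' S''.
  move=> p'plan P'E P'nu.
  have [q' q'plan p'q'] := proportional_plan mb mN p'plan.1 P'E qref P'nu.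
  apply: le_trans (Vle p' q' _ _ p'plan q'plan p'q') _.
  have [mr' r'0 mS'' _ _] := P'nu.
  rewrite /V P'E// (@integral_image_measure _ _ _ _ _ q' (nu (~~ i)) (pr (~~ i))
    (phi \o r') setT)//.
  - by move=> A mA; rewrite q'plan.2.
  - exact: measurable_entropy.
  - by move=> y; exact: phi0.
have Vmin p' P' r' S''
    (p'plan : plan_of N (pr i : pairs -> borel (Omega i)) (nu i) p') P'E P'nu :=
  le_trans Vmarg (@Vreal p' P' r' S'' p'plan P'E P'nu).
have VPoo := le_lt_trans Vmarg Voo.
split.
  have [M Md _] := density_off_lebesgue Pnu.
  exists r, M; split => // t t0; apply/eqP; rewrite eq_le; apply/andP; split.
    have [sg fsg <-] := feasible_truncation ma mb mN pref PE Pnu t0.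
    by apply: ereal_sup_ubound; exists sg.
  apply: ge_ereal_sup => _ [s sf <-].
  exact: (feasible_le_truncation ma mb mN pref PE Pnu pphi cphi phi0 VPoo Vmin t0 sf).
(* Comparing [q] with the proportional plan for the same [p] gives the reverse inequality, hence the
   equality case. *)
have rho_r := divergence_marginals_eq mb PE mh bh qE pphi cphi phi0 Pnu pq
  (Vreal p (marginal (~~ i) p) r S pref PE Pnu) VPoo.
have nuE := qref.2.
have pqf := density_off_fibered mb PE nuE Pnu pq rho_r.
have mU := measurable_density_neq0 Pnu.
set U := [set y | r y != 0%R] in mU.
have mUc : measurable (~` U) by exact: measurableC.
have pr1 w : pr i (@pairing Omega i w) = w.1 by have [] := pr_pairing w.
have pr2 w : pr (~~ i) (@pairing Omega i w) = w.2 by have [] := pr_pairing w.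
have [G' mG' pE] := randomization_of_plan (P := marginal (~~ i) p) pol PE.
have [K [Kprod _ _]] :=
  disintegration_kernel ma mb (@measurable_pairing _ i) pr1 pr2 mG' pE.
(* The fallback kernel disintegrates [q] itself over [nu]: the part of [q] over the complement of
   [U] is then its product with [nuperp], and [q N = 0] confines it to neighbours. *)
have [Kfb [Kfbprod KfbE mKfb]] :=
  disintegration_kernel ma mb (@measurable_pairing _ i) pr1 pr2 mG qE.
have mb1 B : measurable B -> measurable (pr (~~ i) @^-1` B : set pairs).
  by move=> mB; rewrite -[X in measurable X]setTI; exact: mb.
have [nuac acE] := finite_measure_restr (nu (~~ i)) mU.
have [nuperp perpE] := finite_measure_restr (nu (~~ i)) mUc.
have [mu1 mu1E] := finite_measure_restr q (mb1 _ mU).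
have [mu2 mu2E] := finite_measure_restr q (mb1 _ mUc).
exists nuac, nuperp, K, Kfb, mu1, mu2; split => //.
- exact: (lebesgue_decomposition_density Pnu acE perpE).
- have : \int[nu (~~ i)]_y `|Kfb y [set x | N (pairing (x, y))]| = 0.
    rewrite -[RHS](qref.1) KfbE//; apply: eq_integral => y _.
    by rewrite gee0_abs.
  move/(ae_eq_integral_abs (nu (~~ i)) measurableT (mKfb _ mN)).
  move=> [D [mD D0 DE]]; exists D; split => //.
    apply/eqP; rewrite eq_le measure_ge0 andbT perpE -[leRHS]D0.
    by apply: le_measure; rewrite ?inE//; exact: measurableI.
  move=> y /= ny; apply: DE => /= /(_ I) ny'; exact: ny.
- split; first exact: (kernel_product_density ma mb Pnu pqf Kprod acE mu1E).
  move=> A B mA mB; rewrite mu2E -setIA -preimage_setI Kfbprod//; last exact: measurableI.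
  rewrite (integral_restr_measure mUc perpE mB (measurable_kernel Kfb A mA))//.
- move=> C mC; rewrite mu1E mu2E -measureU.
  + by rewrite -setIUr -preimage_setU setUv setIT.
  + by apply: measurableI => //; exact: mb1.
  + by apply: measurableI => //; exact: mb1.
  + by rewrite setIACA -preimage_setI setICr setI0.
Qed.
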